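(* There is no modular category $\mathcal{C}$ of rank $5$ with simple objects $\mathbf{1}=X_0,X_1,X_2,X_3,X_4$ (up to isomorphism) such that $\dim(X_i)>0$ for all $i$, $X_3^*\cong X_4$, $X_1$ and $X_2$ are self-dual, and $\mathrm{Gal}(\mathcal{C})$ is isomorphic to the subgroup $\langle (0\;1),(3\;4)\rangle$ of the symmetric group on $\{0,1,2,3,4\}$.
   Context: A modular category is a finite semisimple $\mathbb{C}$-linear rigid braided balanced (ribbon) monoidal category with simple unit object $\mathbf{1}$ whose $S$-matrix is invertible. Its rank is the number $n$ of isomorphism classes of simple objects, with representatives $\mathbf{1}=X_0,X_1,\ldots,X_{n-1}$. $\dim(X)$ denotes the categorical (quantum) dimension with respect to the ribbon structure. The $S$-matrix is $\tilde S=(\tilde s_{ij})$, where $\theta_i\theta_j\tilde s_{ij}=\sum_k N_{i^*,j}^k\dim(X_k)\theta_k$, $\theta_i$ is the twist of $X_i$, $X_{i^*}=X_i^*$ is the dual of $X_i$, and $N_{i,j}^k=\dim\mathrm{Hom}(X_i\otimes X_j,X_k)$. Let $\psi_i$ be the character of the Grothendieck ring $Gr(\mathcal{C})$ given by $\psi_i(X_j)=\tilde s_{ij}/\dim(X_i)$. Let $K=\mathbb{Q}(\tilde s_{ij})$ and $\mathrm{Gal}(\mathcal{C})=\mathrm{Gal}(K/\mathbb{Q})$. The action of $\mathrm{Gal}(\mathcal{C})$ on $K$ permutes the characters $\psi_0,\ldots,\psi_{n-1}$, giving an injective group homomorphism $\mathrm{Gal}(\mathcal{C})\to S_n$ (permutations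 of the labels $0,\ldots,n-1$), through which $\mathrm{Gal}(\mathcal{C})$ is regarded as a subgroup of $S_n$. *)

(* Defs.v *)
From HB Require Import structures.
From mathcomp Require Import all_boot all_order all_algebra all_fingroup.
From mathcomp Require Import boolp classical_sets functions reals.
From mathcomp.real_closed Require Import complex.

Set Implicit Arguments.
Unset Strict Implicit.
Unset Printing Implicit Defensive.

Import Order.TTheory GRing.Theory Num.Theory.

Local Open Scope ring_scope.

Declare Scope cat_scope.
Delimit Scope cat_scope with cat.
Local Open Scope cat_scope.

Reserved Notation "g ∘ f" (at level 40, left associativity).
Reserved Notation "X ⊗ Y" (at level 39, left associativity).
Reserved Notation "f ⊠ g" (at level 39, left associativity).
Reserved Notation "X ≅ Y" (at level 70).

Record linCat (K : fieldType) := LinCat {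
  obj :> Type;
  hom : obj -> obj -> vectType K;
  idm : forall X, hom X X;
  comp : forall X Y Z, hom Y Z -> hom X Y -> hom X Z;
  comp1m : forall X Y (f : hom X Y), comp (idm Y) f = f;
  compm1 : forall X Y (f : hom X Y), comp f (idm X) = f;
  compmA : forall X Y Z W (h : hom Z W) (g : hom Y Z) (f : hom X Y),
    comp h (comp g f) = comp (comp h g) f;
  comp_linear_l : forall X Y Z (f : hom X Y),
    linear (fun g : hom Y Z => comp g f);
  comp_linear_r : forall X Y Z (g : hom Y Z),
    linear (fun f : hom X Y => comp g f)
}.

Arguments hom {K C} X Y : rename.
Arguments idm {K C} X : rename.
Arguments comp {K C X Y Z} g f : rename.

Notation "g ∘ f" := (comp g f) : cat_scope.

Section LinearCategory.
Variables (K : fieldType) (C : linCat K).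
Implicit Types X Y Z W : C.

Definition inverses X Y (f : hom X Y) (g : hom Y X) :=
  g ∘ f = idm X /\ f ∘ g = idm Y.

Definition is_iso X Y (f : hom X Y) := exists g, inverses f g.

Definition isomorphic X Y := exists f : hom X Y, is_iso f.

Definition mono X Y (f : hom X Y) :=
  forall W (u v : hom W X), f ∘ u = f ∘ v -> u = v.

Definition epi X Y (f : hom X Y) :=
  forall W (u v : hom Y W), u ∘ f = v ∘ f -> u = v.

Definition is_kernel X Y (f : hom X Y) A (k : hom A X) :=
  f ∘ k = 0 /\
  forall W (h : hom W X), f ∘ h = 0 -> exists! u : hom W A, k ∘ u = h.

Definition is_cokernel X Y (f : hom X Y) A (q : hom Y A) :=
  q ∘ f = 0 /\
  forall W (h : hom Y W), h ∘ f = 0 -> exists! u : hom A W, u ∘ q = h.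

(* The case n = 0 says that P is a zero object. *)
Definition is_direct_sum n (S : 'I_n -> C) P :=
  exists (i : forall k, hom (S k) P) (p : forall k, hom P (S k)),
    [/\ forall k, p k ∘ i k = idm (S k),
        forall k l, k != l -> p k ∘ i l = 0
      & \sum_k (i k ∘ p k) = idm P].

Definition abelian_cat :=
  [/\ forall n (S : 'I_n -> C), exists P, is_direct_sum S P,
      forall X Y (f : hom X Y), exists A (k : hom A X), is_kernel f k,
      forall X Y (f : hom X Y), exists A (q : hom Y A), is_cokernel f q,
      forall X Y (f : hom X Y), mono f ->
        exists Z (g : hom Y Z), is_kernel g f
    & forall X Y (f : hom X Y), epi f ->
        exists Z (g : hom Z X), is_cokernel g f].

Definition simple_obj X :=
  idm X <> 0 /\ forall Y (f : hom Y X), mono f -> f = 0 \/ is_iso f.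

Definition semisimple_cat :=
  abelian_cat /\
  forall X, exists n (S : 'I_n -> C),
    (forall k, simple_obj (S k)) /\ is_direct_sum S X.

Definition simple_reps n (X : 'I_n -> C) :=
  [/\ forall i, simple_obj (X i),
      forall i j, isomorphic (X i) (X j) -> i = j
    & forall Y, simple_obj Y -> exists i, isomorphic Y (X i)].

(* The scalar a such that f = a id_X; it exists (and is unique) when X is
   simple and K is algebraically closed.  The junk value is 0. *)
Definition scalar_of X (f : hom X X) : K :=
  xget 0 [set a : K | f = a *: idm X]%classic.

End LinearCategory.

Notation "X ≅ Y" := (isomorphic X Y) : cat_scope.

Record monCat (K : fieldType) := MonCat {
  mon_lin :> linCat K;
  tens : mon_lin -> mon_lin -> mon_lin;
  tensm : forall X Y X' Y' : mon_lin,
    hom X X' -> hom Y Y' -> hom (tens X Y) (tens X' Y');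
  tensm1 : forall X Y, tensm (idm X) (idm Y) = idm (tens X Y);
  tensm_comp : forall X Y X' Y' X'' Y'' (f' : hom X' X'') (f : hom X X')
      (g' : hom Y' Y'') (g : hom Y Y'),
    tensm (f' ∘ f) (g' ∘ g) = tensm f' g' ∘ tensm f g;
  tensm_linear_l : forall X Y X' Y' (g : hom Y Y'),
    linear (fun f : hom X X' => tensm f g);
  tensm_linear_r : forall X Y X' Y' (f : hom X X'),
    linear (fun g : hom Y Y' => tensm f g);
  tunit : mon_lin;
  assoc : forall X Y Z, hom (tens (tens X Y) Z) (tens X (tens Y Z));
  associ : forall X Y Z, hom (tens X (tens Y Z)) (tens (tens X Y) Z);
  lunit : forall X, hom (tens tunit X) X;
  luniti : forall X, hom X (tens tunit X);
  runit : forall X, hom (tens X tunit) X;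
  runiti : forall X, hom X (tens X tunit);
  assocK : forall X Y Z, inverses (assoc X Y Z) (associ X Y Z);
  lunitK : forall X, inverses (lunit X) (luniti X);
  runitK : forall X, inverses (runit X) (runiti X);
  assoc_nat : forall X Y Z X' Y' Z'
      (f : hom X X') (g : hom Y Y') (h : hom Z Z'),
    assoc X' Y' Z' ∘ tensm (tensm f g) h =
    tensm f (tensm g h) ∘ assoc X Y Z;
  lunit_nat : forall X X' (f : hom X X'),
    lunit X' ∘ tensm (idm tunit) f = f ∘ lunit X;
  runit_nat : forall X X' (f : hom X X'),
    runit X' ∘ tensm f (idm tunit) = f ∘ runit X;
  pentagon : forall X Y Z W,
    tensm (idm X) (assoc Y Z W) ∘ assoc X (tens Y Z) W
      ∘ tensm (assoc X Y Z) (idm W) =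
    assoc X Y (tens Z W) ∘ assoc (tens X Y) Z W;
  triangle : forall X Y,
    tensm (idm X) (lunit Y) ∘ assoc X tunit Y = tensm (runit X) (idm Y)
}.

Arguments tens {K m} X Y.
Arguments tensm {K m X Y X' Y'} f g.
Arguments tunit {K m}.
Arguments assoc {K m} X Y Z.
Arguments associ {K m} X Y Z.
Arguments lunit {K m} X.
Arguments luniti {K m} X.
Arguments runit {K m} X.
Arguments runiti {K m} X.

Notation "X ⊗ Y" := (tens X Y) : cat_scope.
Notation "f ⊠ g" := (tensm f g) : cat_scope.

(* Y is a left dual of X, i.e. X is a right dual of Y. *)
Definition is_left_dual (K : fieldType) (C : monCat K) (X Y : C)
    (ev : hom (Y ⊗ X) tunit) (coev : hom tunit (X ⊗ Y)) :=
  runit X ∘ (idm X ⊠ ev) ∘ assoc X Y X ∘ (coev ⊠ idm X) ∘ luniti X = idm X /\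
  lunit Y ∘ (ev ⊠ idm Y) ∘ associ Y X Y ∘ (idm Y ⊠ coev) ∘ runiti Y = idm Y.

Arguments is_left_dual {K} C X Y ev coev.

Record rigidCat (K : fieldType) := RigidCat {
  rigid_mon :> monCat K;
  dual : rigid_mon -> rigid_mon;
  ev : forall X, hom (dual X ⊗ X) tunit;
  coev : forall X, hom tunit (X ⊗ dual X);
  dualP : forall X, is_left_dual rigid_mon X (dual X) (ev X) (coev X);
  right_dualP : forall X, exists Y (e : hom (X ⊗ Y) tunit)
    (c : hom tunit (Y ⊗ X)), is_left_dual rigid_mon Y X e c
}.

Arguments dual {K r} X.
Arguments ev {K r} X.
Arguments coev {K r} X.

Definition dualm (K : fieldType) (C : rigidCat K) (X Y : C) (f : hom X Y) :
    hom (dual Y) (dual X) :=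
  lunit (dual X) ∘ (ev Y ⊠ idm (dual X))
    ∘ ((idm (dual Y) ⊠ f) ⊠ idm (dual X)) ∘ associ (dual Y) X (dual X)
    ∘ (idm (dual Y) ⊠ coev X) ∘ runiti (dual Y).

Record ribbonCat (K : fieldType) := RibbonCat {
  ribbon_rigid :> rigidCat K;
  braid : forall X Y : ribbon_rigid, hom (X ⊗ Y) (Y ⊗ X);
  braid_iso : forall X Y, is_iso (braid X Y);
  braid_nat : forall X Y X' Y' (f : hom X X') (g : hom Y Y'),
    braid X' Y' ∘ (f ⊠ g) = (g ⊠ f) ∘ braid X Y;
  hexagon1 : forall X Y Z,
    assoc Y Z X ∘ braid X (Y ⊗ Z) ∘ assoc X Y Z =
    (idm Y ⊠ braid X Z) ∘ assoc Y X Z ∘ (braid X Y ⊠ idm Z);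
  hexagon2 : forall X Y Z,
    associ Z X Y ∘ braid (X ⊗ Y) Z ∘ associ X Y Z =
    (braid X Z ⊠ idm Y) ∘ associ X Z Y ∘ (idm X ⊠ braid Y Z);
  twist : forall X : ribbon_rigid, hom X X;
  twist_iso : forall X, is_iso (twist X);
  twist_nat : forall X Y (f : hom X Y), twist Y ∘ f = f ∘ twist X;
  twist_tens : forall X Y,
    twist (X ⊗ Y) = braid Y X ∘ braid X Y ∘ (twist X ⊠ twist Y);
  twist_dual : forall X, twist (dual X) = dualm (twist X)
}.

Arguments braid {K r} X Y.
Arguments twist {K r} X.

Section ModularData.
Variables (K : fieldType) (C : ribbonCat K).

Definition qdim (X : C) : K :=
  scalar_of (ev X ∘ braid X (dual X) ∘ (twist X ⊠ idm (dual X)) ∘ coev X).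

Definition theta (X : C) : K := scalar_of (twist X).

Section Representatives.
Variables (n : nat) (X : 'I_n -> C).

Definition smatrix : 'M[K]_n :=
  \matrix_(i, j) ((theta (X i))^-1 * (theta (X j))^-1 *
    \sum_k (\dim {: hom (dual (X i) ⊗ X j) (X k)})%:R
             * qdim (X k) * theta (X k)).

Definition psi (i j : 'I_n) : K := smatrix i j / qdim (X i).

Definition smatrix_field : set K :=
  smallest [set F : set K | divring_closed [in F]]%classic
           [set x | exists i j, x = smatrix i j]%classic.

End Representatives.

(* Invertibility of the S-matrix does not depend on the representatives. *)
Definition modular :=
  [/\ semisimple_cat C, simple_obj (tunit : C),
      exists n (X : 'I_n -> C), simple_reps X
    & forall n (X : 'I_n -> C), simple_reps X -> smatrix X \in unitmx].

End ModularData.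

(* g restricts to a field automorphism of F over the rationals; its values
   outside F are irrelevant. *)
Definition galois_aut (K : numFieldType) (F : set K) (g : K -> K) :=
  [/\ set_bij F F g,
      forall q : rat, g (ratr q) = ratr q,
      forall x y, F x -> F y -> g (x + y) = g x + g y
    & forall x y, F x -> F y -> g (x * y) = g x * g y].

(* Gal(C) as a subgroup of S_n: the permutations s of the labels for which some
   automorphism of the field of S-matrix entries maps psi_i to psi_(s i). *)
Definition Gal (K : numFieldType) (C : ribbonCat K) (n : nat)
    (X : 'I_n -> C) : {set 'S_n} :=
  [set s : 'S_n | `[< exists2 g : K -> K, galois_aut (smatrix_field X) g
                      & forall i j, g (psi X i j) = psi X (s i) j >]]%SET.

(* Main.v *)
From HB Require Import structures.
From mathcomp Require Import all_boot all_order all_algebra all_fingroup.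
From mathcomp Require Import all_solvable all_field.
From mathcomp Require Import boolp classical_sets functions reals.
From mathcomp.real_closed Require Import complex.
From mathcomp Require Import ring zify.
Require Import Defs.

(** Suppose that such a category exists.

    The topology of the braiding is condensed into finitely many numbers: the
    multiplicities N_ij^k, the dimensions d_i, the twists theta_i, and the
    scalars chi_i(j) by which a loop coloured X_j acts on a strand X_i that it
    encircles.  Loops can be nested and decomposed ([hopf_tens], [hopf_sum]),
    so every chi_i is a character of the fusion ring; closing the encircled
    strand as well gives the trace of a double braiding, which balancing
    expresses through the twists ([hopf_double_braid], [trace_sum]).  Hence
    the S-matrix has entries d_i psi_i(j), where psi_i is chi at the dual of
    i.  Its invertibility makes the characters psi_i linearly independent, and
    everything else is a formal consequence: commutativity of the fusion ring,
    orthogonality, psi_i(j dual) = conj psi_i(j), the symmetry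
    d_i psi_i(j) = d_j psi_j(i), the equality of d_i^2 sum_j |psi_i(j)|^2 with
    the global dimension D for all i, and the proportionality of S T^-1 S and
    T S T ([twist_sum]).

    Let F be the field generated by the S-matrix.  An embedding of F sends
    characters to characters, hence permutes the psi_i and preserves F; so F
    is normal over the rationals, and its elements fixed by all automorphisms
    are rational ([fixed_rational]).  The numbers psi_i(j) are algebraic
    integers.  Complex conjugation induces (3 4), and a Klein four-group of
    permutations of five labels that contains (3 4) is generated by (3 4) and
    a transposition of two labels among 0, 1, 2 ([klein_four]).

    If that transposition is (1 2), all d_i are rational, and comparison of
    norms gives d_1 = d_2.  Orthogonality of psi_1 and psi_2 then reads
    1 + 2 x y + 2 r^2 = 0 with integers x y and r, which parity forbids
    ([swap_fixing_unit_impossible]).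

    If it is (0 a), let b be the remaining self-dual label.  Applying the
    automorphism to the identity d_i^2 sum_j |psi_i(j)|^2 = D shows that
    psi_b(a), psi_3(a) and d_a psi_a(a) are signs.  Orthogonality leaves few
    sign patterns ([swap_unit_impossible]).  One contradicts positivity; one
    forces (psi_3(b) / psi_b(3))^2 = 2 with both values rational, or their
    vanishing, which is inconsistent; one makes 2 the sum A + 2 B of positive
    integers.  The last pattern is realised by infinitely many tables of
    integers, for instance with dimensions 1, 1, 2, sqrt 3, sqrt 3, and only
    the twists exclude it: the relation between S and T forces theta_a = 1 and
    then (psi_3(3) + psi_3(4))^2 = 2, although this trace is rational. *)

Set Implicit Arguments.
Unset Strict Implicit.
Unset Printing Implicit Defensive.

Import Order.TTheory GRing.Theory Num.Theory.

Local Open Scope ring_scope.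
Local Open Scope cat_scope.

Local Notation "X ◁ f" := (idm X ⊠ f)
  (at level 38, right associativity) : cat_scope.
Local Notation "f ▷ W" := (f ⊠ idm W)
  (at level 37, left associativity) : cat_scope.

(** * Calculus in a monoidal category *)

Section Reassociation.
Variables (K : fieldType) (C : linCat K).

(** Composites are kept left-associated.  These lemmas turn an equation
    between short composites into one that rewrites in the middle of a longer
    chain. *)
Lemma reassoc2 (X Y Z : C) (g : hom Y Z) (f : hom X Y) k :
  g ∘ f = k -> forall W (h : hom Z W), h ∘ g ∘ f = h ∘ k.
Proof. by move=> <- W h; rewrite compmA. Qed.

Lemma reassoc3 (X Y Z T : C) (g : hom Y Z) (f : hom X Y) (e : hom T X) k :
  g ∘ f ∘ e = k -> forall W (h : hom Z W), h ∘ g ∘ f ∘ e = h ∘ k.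
Proof. by move=> <- W h; rewrite !compmA. Qed.

Lemma reassoc4 (X Y Z T S : C) (g : hom Y Z) (f : hom X Y) (e : hom T X)
    (d : hom S T) k :
  g ∘ f ∘ e ∘ d = k -> forall W (h : hom Z W), h ∘ g ∘ f ∘ e ∘ d = h ∘ k.
Proof. by move=> <- W h; rewrite !compmA. Qed.

Lemma comp_addl (X Y Z : C) (g g' : hom Y Z) (f : hom X Y) :
  (g + g') ∘ f = g ∘ f + g' ∘ f.
Proof. by have := comp_linear_l f 1 g g'; rewrite !scale1r. Qed.

Lemma comp_addr (X Y Z : C) (g : hom Y Z) (f f' : hom X Y) :
  g ∘ (f + f') = g ∘ f + g ∘ f'.
Proof. by have := comp_linear_r g 1 f f'; rewrite !scale1r. Qed.

Lemma comp0m (X Y Z : C) (f : hom X Y) : (0 : hom Y Z) ∘ f = 0.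
Proof. by apply: (addrI (0 ∘ f)); rewrite -comp_addl !addr0. Qed.

Lemma compm0 (X Y Z : C) (g : hom Y Z) : g ∘ (0 : hom X Y) = 0.
Proof. by apply: (addrI (g ∘ 0)); rewrite -comp_addr !addr0. Qed.

Lemma comp_scalel (X Y Z : C) a (g : hom Y Z) (f : hom X Y) :
  (a *: g) ∘ f = a *: (g ∘ f).
Proof. by have := comp_linear_l f a g 0; rewrite comp0m !addr0. Qed.

Lemma comp_scaler (X Y Z : C) a (g : hom Y Z) (f : hom X Y) :
  g ∘ (a *: f) = a *: (g ∘ f).
Proof. by have := comp_linear_r g a f 0; rewrite compm0 !addr0. Qed.

Lemma comp_oppl (X Y Z : C) (g : hom Y Z) (f : hom X Y) :
  (- g) ∘ f = - (g ∘ f).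
Proof. by rewrite -scaleN1r comp_scalel scaleN1r. Qed.

Lemma comp_oppr (X Y Z : C) (g : hom Y Z) (f : hom X Y) :
  g ∘ (- f) = - (g ∘ f).
Proof. by rewrite -scaleN1r comp_scaler scaleN1r. Qed.

Lemma comp_suml (X Y Z : C) n (g : 'I_n -> hom Y Z) (f : hom X Y) :
  (\sum_i g i) ∘ f = \sum_i (g i ∘ f).
Proof.
elim/big_rec2: _ => [|i y1 y2 _ <-]; first exact: comp0m.
by rewrite comp_addl.
Qed.

Lemma comp_sumr (X Y Z : C) n (g : hom Y Z) (f : 'I_n -> hom X Y) :
  g ∘ (\sum_i f i) = \sum_i (g ∘ f i).
Proof.
elim/big_rec2: _ => [|i y1 y2 _ <-]; first exact: compm0.
by rewrite comp_addr.
Qed.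

Lemma iso_inj_r (X Y Z : C) (f : hom X Y) f' (u v : hom Y Z) :
  inverses f f' -> u ∘ f = v ∘ f -> u = v.
Proof.
by case=> _ ff' /(congr1 (fun h => h ∘ f')); rewrite -!compmA ff' !compm1.
Qed.

Lemma iso_inj_l (X Y Z : C) (f : hom X Y) f' (u v : hom Z X) :
  inverses f f' -> f ∘ u = f ∘ v -> u = v.
Proof.
by case=> f'f _ /(congr1 (fun h => f' ∘ h)); rewrite !compmA f'f !comp1m.
Qed.

Lemma inversesV (X Y : C) (f : hom X Y) g : inverses f g -> inverses g f.
Proof. by case. Qed.

Lemma inverses_comp (X Y Z : C) (f : hom X Y) f' (g : hom Y Z) g' :
  inverses f f' -> inverses g g' -> inverses (g ∘ f) (f' ∘ g').
Proof.
case=> f1 f2 [g1 g2]; split.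
- by rewrite compmA (reassoc2 g1) compm1.
- by rewrite compmA (reassoc2 f2) compm1.
Qed.

Lemma isomorphic_sym (X Y : C) : X ≅ Y -> Y ≅ X.
Proof. by case=> f [g fg]; exists g, f; apply: inversesV. Qed.

Lemma isomorphic_trans (X Y Z : C) : X ≅ Y -> Y ≅ Z -> X ≅ Z.
Proof.
by case=> f [f' ff] [g [g' gg]]; exists (g ∘ f), (f' ∘ g'); apply: inverses_comp.
Qed.

Lemma isomorphic_refl (X : C) : X ≅ X.
Proof. by exists (idm X), (idm X); split; rewrite comp1m. Qed.

End Reassociation.

Section Monoidal.
Variables (K : fieldType) (C : monCat K).
Implicit Types X Y Z W V : C.

Lemma lw_comp X Y Z W (g : hom Y Z) (f : hom W Y) :
  X ◁ (g ∘ f) = (X ◁ g) ∘ (X ◁ f).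
Proof. by rewrite -tensm_comp comp1m. Qed.

Lemma rw_comp X Y Z W (g : hom Y Z) (f : hom W Y) :
  (g ∘ f) ▷ X = (g ▷ X) ∘ (f ▷ X).
Proof. by rewrite -tensm_comp comp1m. Qed.

Lemma whisker_exchange X X' W W' (f : hom X X') (g : hom W W') :
  (X' ◁ g) ∘ (f ▷ W) = (f ▷ W') ∘ (X ◁ g).
Proof. by rewrite -!tensm_comp !comp1m !compm1. Qed.

Lemma lw_scale X Y Z a (f : hom Y Z) : X ◁ (a *: f) = a *: (X ◁ f).
Proof.
have t0 : X ◁ (0 : hom Y Z) = 0.
  have := tensm_linear_r (idm X) 1 (0 : hom Y Z) 0.
  rewrite !scale1r addr0 /= => E; apply: (addrI (X ◁ (0 : hom Y Z))).
  by rewrite addr0.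
by have := tensm_linear_r (idm X) a f 0; rewrite !addr0 t0 addr0.
Qed.

Lemma rw_scale X Y Z a (f : hom Y Z) : (a *: f) ▷ X = a *: (f ▷ X).
Proof.
have t0 : (0 : hom Y Z) ▷ X = 0.
  have := tensm_linear_l (idm X) 1 (0 : hom Y Z) 0.
  rewrite !scale1r addr0 /= => E; apply: (addrI ((0 : hom Y Z) ▷ X)).
  by rewrite addr0.
by have := tensm_linear_l (idm X) a f 0; rewrite !addr0 t0 addr0.
Qed.

Lemma rw_sum X Y Z n (f : 'I_n -> hom Y Z) :
  (\sum_i f i) ▷ X = \sum_i (f i ▷ X).
Proof.
elim/big_rec2: _ => [|i y1 y2 _ <-].
  by rewrite -(scale0r (0 : hom Y Z)) rw_scale scale0r.
by have := tensm_linear_l (idm X) 1 (f i) y2; rewrite !scale1r.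
Qed.

Lemma lw_sum X Y Z n (f : 'I_n -> hom Y Z) :
  X ◁ (\sum_i f i) = \sum_i (X ◁ f i).
Proof.
elim/big_rec2: _ => [|i y1 y2 _ <-].
  by rewrite -(scale0r (0 : hom Y Z)) lw_scale scale0r.
by have := tensm_linear_r (idm X) 1 (f i) y2; rewrite !scale1r.
Qed.

Lemma inverses_lw X Y Z (f : hom Y Z) g :
  inverses f g -> inverses (X ◁ f) (X ◁ g).
Proof. by case=> fg gf; split; rewrite -lw_comp ?fg ?gf tensm1. Qed.

Lemma inverses_rw X Y Z (f : hom Y Z) g :
  inverses f g -> inverses (f ▷ X) (g ▷ X).
Proof. by case=> fg gf; split; rewrite -rw_comp ?fg ?gf tensm1. Qed.

Lemma assocVK X Y Z : assoc X Y Z ∘ associ X Y Z = idm _.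
Proof. by have [] := assocK X Y Z. Qed.

Lemma associK X Y Z : associ X Y Z ∘ assoc X Y Z = idm _.
Proof. by have [] := assocK X Y Z. Qed.

Lemma associ_nat X Y Z X' Y' Z' (f : hom X X') (g : hom Y Y') (h : hom Z Z') :
  associ X' Y' Z' ∘ (f ⊠ (g ⊠ h)) = (f ⊠ g ⊠ h) ∘ associ X Y Z.
Proof.
apply: (iso_inj_r (assocK X Y Z)).
by rewrite -!compmA -assoc_nat associK compm1 compmA associK comp1m.
Qed.

Lemma assoc_lw X Y Z Z' (h : hom Z Z') :
  assoc X Y Z' ∘ ((X ⊗ Y) ◁ h) = (X ◁ Y ◁ h) ∘ assoc X Y Z.
Proof. by rewrite -tensm1 assoc_nat. Qed.

Lemma associ_lw X Y Z Z' (h : hom Z Z') :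
  associ X Y Z' ∘ (X ◁ Y ◁ h) = ((X ⊗ Y) ◁ h) ∘ associ X Y Z.
Proof. by rewrite -tensm1 associ_nat. Qed.

Lemma assoc_rw X X' Y Z (f : hom X X') :
  assoc X' Y Z ∘ (f ▷ Y ▷ Z) = (f ▷ (Y ⊗ Z)) ∘ assoc X Y Z.
Proof. by rewrite -tensm1 assoc_nat. Qed.

Lemma associ_rw X X' Y Z (f : hom X X') :
  associ X' Y Z ∘ (f ▷ (Y ⊗ Z)) = (f ▷ Y ▷ Z) ∘ associ X Y Z.
Proof. by rewrite -tensm1 associ_nat. Qed.

Lemma triangle_luniti X W :
  X ◁ luniti W = assoc X tunit W ∘ (runiti X ▷ W).
Proof.
have [lK lVK] := lunitK W; have [rK rVK] := runitK X.
apply: (iso_inj_l (inverses_lw X (lunitK W))).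
by rewrite -lw_comp lVK tensm1 compmA triangle -rw_comp rVK tensm1.
Qed.

Lemma luniti_nat X Y (f : hom X Y) : luniti Y ∘ f = (tunit ◁ f) ∘ luniti X.
Proof.
have [lK lVK] := lunitK Y; have [lK' lVK'] := lunitK X.
apply: (iso_inj_l (lunitK Y)).
by rewrite !compmA lVK lunit_nat comp1m -compmA lVK' compm1.
Qed.

Lemma tunit_faithful X Y (f g : hom X Y) : tunit ◁ f = tunit ◁ g -> f = g.
Proof.
move=> E; apply: (iso_inj_r (lunitK X)).
by rewrite -!lunit_nat E.
Qed.

Lemma pentagonE X Y Z W :
  (X ◁ assoc Y Z W) ∘ assoc X (Y ⊗ Z) W =
  assoc X Y (Z ⊗ W) ∘ assoc (X ⊗ Y) Z W ∘ (associ X Y Z ▷ W).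
Proof.
apply: (iso_inj_r (inverses_rw W (assocK X Y Z))).
by rewrite pentagon -!compmA -rw_comp associK tensm1 compm1.
Qed.

(** Kelly's argument: whiskering with the unit object is faithful, and after
    whiskering the equation follows from the pentagon at (1, 1, X, W) and two
    instances of the triangle. *)
Lemma lunit_tens X W :
  lunit (X ⊗ W) ∘ assoc tunit X W = lunit X ▷ W.
Proof.
apply: tunit_faithful.
apply: (iso_inj_r (assocK tunit (tunit ⊗ X) W)).
apply: (iso_inj_r (inverses_rw W (assocK tunit tunit X))).
rewrite lw_comp (reassoc3 (pentagon _ _ _ _)) compmA triangle -assoc_rw
  -triangle rw_comp.
by rewrite compmA assoc_nat.
Qed.

Lemma luniti_tens X W :
  luniti (X ⊗ W) = assoc tunit X W ∘ (luniti X ▷ W).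
Proof.
have [_ lK] := lunitK X; have [_ lKW] := lunitK (X ⊗ W).
apply: (iso_inj_l (lunitK _)).
by rewrite compmA lunit_tens -rw_comp lK lKW tensm1.
Qed.

Lemma associ_pentagon X Y Z W :
  (X ◁ associ Y Z W) ∘ assoc X Y (Z ⊗ W) =
  assoc X (Y ⊗ Z) W ∘ (assoc X Y Z ▷ W) ∘ associ (X ⊗ Y) Z W.
Proof.
apply: (iso_inj_l (inverses_lw X (assocK Y Z W))).
rewrite !compmA -lw_comp assocVK tensm1 comp1m pentagon.
by rewrite -compmA assocVK compm1.
Qed.

Lemma associ_pentagon' X Y Z W :
  associ X Y (Z ⊗ W) ∘ (X ◁ assoc Y Z W) =
  assoc (X ⊗ Y) Z W ∘ (associ X Y Z ▷ W) ∘ associ X (Y ⊗ Z) W.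
Proof.
apply: (iso_inj_l (assocK X Y (Z ⊗ W))).
rewrite !compmA assocVK comp1m -pentagonE -compmA assocVK.
by rewrite compm1.
Qed.

Lemma associ_pentagon2 X Y Z W :
  associ (X ⊗ Y) Z W ∘ associ X Y (Z ⊗ W) =
  (associ X Y Z ▷ W) ∘ associ X (Y ⊗ Z) W ∘ (X ◁ associ Y Z W).
Proof.
apply: (iso_inj_r (assocK X Y (Z ⊗ W))).
rewrite -(compmA (associ (X ⊗ Y) Z W)) associK compm1.
rewrite (reassoc2 (associ_pentagon X Y Z W)) !compmA (reassoc2 (associK _ _ _))
  compm1.
by rewrite -rw_comp associK tensm1 comp1m.
Qed.

End Monoidal.

(** * Braiding and duality inside right-nested tensor products *)

Section MonoidalFamilies.
Variables (K : fieldType) (C : monCat K).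
Implicit Types X Y Z W V : C.

(** A morphism out of A ⊗ B acts on the first two factors of A ⊗ (B ⊗ W),
    naturally in W.  Calculating with such families instead of morphisms keeps
    every product right-nested, so that associators occur only in the proofs of
    the basic identities of this part.  The families are locked because
    rewriting with associativity of composition would otherwise look inside. *)
Definition fam_ev A B (e : hom (A ⊗ B) tunit) W : hom (A ⊗ (B ⊗ W)) W :=
  locked (lunit W ∘ (e ▷ W) ∘ associ A B W).

Lemma fam_evE A B (e : hom (A ⊗ B) tunit) W :
  fam_ev e W = lunit W ∘ (e ▷ W) ∘ associ A B W.
Proof. by rewrite /fam_ev -lock. Qed.

Definition fam_coev A B (o : hom tunit (A ⊗ B)) W : hom W (A ⊗ (B ⊗ W)) :=
  locked (assoc A B W ∘ (o ▷ W) ∘ luniti W).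

Lemma fam_coevE A B (o : hom tunit (A ⊗ B)) W :
  fam_coev o W = assoc A B W ∘ (o ▷ W) ∘ luniti W.
Proof. by rewrite /fam_coev -lock. Qed.

Lemma fam_ev_nat A B (e : hom (A ⊗ B) tunit) W W' (g : hom W W') :
  fam_ev e W' ∘ (A ◁ B ◁ g) = g ∘ fam_ev e W.
Proof.
rewrite !fam_evE (reassoc2 (associ_lw _ _ g)) !compmA.
by rewrite (reassoc2 (esym (whisker_exchange _ _))) !compmA lunit_nat.
Qed.

Lemma fam_coev_nat A B (o : hom tunit (A ⊗ B)) W W' (g : hom W W') :
  (A ◁ B ◁ g) ∘ fam_coev o W = fam_coev o W' ∘ g.
Proof.
rewrite !fam_coevE !compmA -assoc_lw.
by rewrite (reassoc2 (whisker_exchange _ _)) !compmA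
  (reassoc2 (esym (luniti_nat g))) !compmA.
Qed.

Lemma fam_zigzag1 Y Y' (e : hom (Y' ⊗ Y) tunit) (o : hom tunit (Y ⊗ Y')) W :
  is_left_dual C Y Y' e o ->
  (Y ◁ fam_ev e W) ∘ fam_coev o (Y ⊗ W) = idm (Y ⊗ W).
Proof.
case=> zz _; rewrite !fam_evE !fam_coevE !lw_comp !compmA.
rewrite (reassoc2 (associ_pentagon _ _ _ _)) !compmA.
rewrite (reassoc2 (associ_rw _ _ _)) !compmA.
rewrite luniti_tens !compmA (reassoc2 (associK _ _ _)) compm1.
rewrite (reassoc2 (esym (assoc_nat _ _ _))) !compmA triangle.
by rewrite -!rw_comp zz tensm1.
Qed.

Lemma fam_zigzag2 Y Y' (e : hom (Y' ⊗ Y) tunit) (o : hom tunit (Y ⊗ Y')) W :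
  is_left_dual C Y Y' e o ->
  fam_ev e (Y' ⊗ W) ∘ (Y' ◁ fam_coev o W) = idm (Y' ⊗ W).
Proof.
case=> _ zz; rewrite !fam_evE !fam_coevE !lw_comp !compmA.
rewrite triangle_luniti !compmA (reassoc2 (esym (assoc_nat _ _ _))) !compmA.
rewrite (reassoc2 (associ_pentagon' _ _ _ _)) !compmA (reassoc2 (associK _ _ _))
  compm1.
rewrite (reassoc2 (esym (assoc_rw _ _ _))) !compmA lunit_tens.
by rewrite -!rw_comp zz tensm1.
Qed.

End MonoidalFamilies.

Section Braid.
Variables (K : fieldType) (C : ribbonCat K).
Implicit Types X Y Z W V : C.

Definition brd X Y W : hom (X ⊗ (Y ⊗ W)) (Y ⊗ (X ⊗ W)) :=
  locked (assoc Y X W ∘ (braid X Y ▷ W) ∘ associ X Y W).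

Lemma brdE X Y W :
  brd X Y W = assoc Y X W ∘ (braid X Y ▷ W) ∘ associ X Y W.
Proof. by rewrite /brd -lock. Qed.

Lemma brd_natW X Y W W' (g : hom W W') :
  brd X Y W' ∘ (X ◁ Y ◁ g) = (Y ◁ X ◁ g) ∘ brd X Y W.
Proof.
rewrite !brdE (reassoc2 (associ_lw _ _ g)) !compmA.
by rewrite (reassoc2 (esym (whisker_exchange _ _))) !compmA assoc_lw.
Qed.

Lemma brd_nat2 X Y Y' W (f : hom Y Y') :
  brd X Y' W ∘ (X ◁ (f ▷ W)) = (f ▷ (X ⊗ W)) ∘ brd X Y W.
Proof.
rewrite !brdE (reassoc2 (associ_nat _ _ _)) !compmA.
rewrite (reassoc2 (esym (rw_comp _ _ _))) braid_nat rw_comp !compmA.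
by rewrite assoc_nat tensm1.
Qed.

Lemma brd_nat1 X X' Y W (f : hom X X') :
  brd X' Y W ∘ (f ▷ (Y ⊗ W)) = (Y ◁ (f ▷ W)) ∘ brd X Y W.
Proof.
rewrite !brdE (reassoc2 (associ_rw _ _ _)) !compmA.
rewrite (reassoc2 (esym (rw_comp _ _ _))) braid_nat rw_comp !compmA.
by rewrite assoc_nat.
Qed.

Lemma brd_iso X Y W : is_iso (brd X Y W).
Proof.
have [g gK] := braid_iso X Y.
rewrite brdE; exists (assoc X Y W ∘ ((g ▷ W) ∘ associ Y X W)).
apply: inverses_comp; first exact: inversesV (assocK _ _ _).
apply: inverses_comp; last exact: assocK.
exact: inverses_rw.
Qed.

Lemma brd_hex1 X Y Z W :
  brd X (Y ⊗ Z) W =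
  associ Y Z (X ⊗ W) ∘ (Y ◁ brd X Z W) ∘ brd X Y (Z ⊗ W) ∘ (X ◁ assoc Y Z W).
Proof.
rewrite !brdE !lw_comp !compmA (reassoc2 (associ_pentagon' _ _ _ _)) !compmA.
rewrite (reassoc2 (esym (assoc_rw _ _ _))) !compmA.
rewrite (reassoc2 (associ_pentagon _ _ _ _)) !compmA (reassoc2 (associK _ _ _))
  compm1.
rewrite (reassoc2 (esym (assoc_nat _ _ _))) !compmA associ_pentagon'.
rewrite (reassoc2 (associK _ _ _)) compm1.
do 4! rewrite (reassoc2 (esym (rw_comp _ _ _))).
congr (_ ∘ (_ ▷ W) ∘ _).
apply: (iso_inj_r (assocK X Y Z)); apply: (iso_inj_l (assocK Y Z X)).
rewrite !compmA hexagon1 assocVK comp1m.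
by rewrite -!compmA associK compm1 !compmA.
Qed.

Lemma brd_hex2 X Y Z W :
  brd (X ⊗ Y) Z W =
  (Z ◁ associ X Y W) ∘ brd X Z (Y ⊗ W) ∘ (X ◁ brd Y Z W) ∘ assoc X Y (Z ⊗ W).
Proof.
rewrite !brdE !lw_comp !compmA (reassoc2 (associ_pentagon _ _ _ _)) !compmA.
rewrite (reassoc2 (esym (assoc_nat _ _ _))) !compmA.
rewrite (reassoc2 (associ_pentagon' _ _ _ _)) !compmA (reassoc2 (associK _ _ _))
  compm1.
rewrite (reassoc2 (esym (assoc_rw _ _ _))) !compmA.
rewrite associ_pentagon (reassoc2 (associK _ _ _)) compm1.
do 4! rewrite (reassoc2 (esym (rw_comp _ _ _))).
congr (_ ∘ (_ ▷ W) ∘ _).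
apply: (iso_inj_r (inversesV (assocK X Y Z))).
apply: (iso_inj_l (inversesV (assocK Z X Y))).
rewrite !compmA hexagon2 associK comp1m.
by rewrite -!compmA assocVK compm1 !compmA.
Qed.

(** Naturality of the braiding of X with Y ⊗ Z with respect to the braiding of
    Y with Z, both sides being split by the first hexagon. *)
Lemma brd_yang_baxter X Y Z W :
  (Z ◁ brd X Y W) ∘ brd X Z (Y ⊗ W) ∘ (X ◁ brd Y Z W) =
  brd Y Z (X ⊗ W) ∘ (Y ◁ brd X Z W) ∘ brd X Y (Z ⊗ W).
Proof.
have E := brd_nat2 X W (braid Y Z).
rewrite [brd X (Y ⊗ Z) W]brd_hex1 [brd X (Z ⊗ Y) W]brd_hex1 in E.
apply: (iso_inj_r (inverses_lw X (assocK Y Z W))).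
apply: (iso_inj_l (inversesV (assocK Z Y (X ⊗ W)))).
rewrite !compmA in E *.
rewrite [brd Y Z W]brdE [brd Y Z (X ⊗ W)]brdE !lw_comp !compmA associK comp1m
  -E.
by rewrite (reassoc2 (esym (lw_comp X _ _))) associK tensm1 compm1.
Qed.

(** The first hexagon with both objects equal to the unit shows that braiding
    past the unit is idempotent; being invertible, it is trivial. *)
Lemma brd_unit X W : lunit (X ⊗ W) ∘ brd X tunit W = X ◁ lunit W.
Proof.
have lun1 V : lunit (tunit ⊗ V) = tunit ◁ lunit V :> hom (tunit ⊗ (tunit ⊗ V))
  _.
  by apply: (iso_inj_l (lunitK V)); rewrite lunit_nat.
have unit_case : lunit (X ⊗ (tunit ⊗ W)) ∘ brd X tunit (tunit ⊗ W)
    = X ◁ lunit (tunit ⊗ W).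
  have [g gK] := brd_iso X tunit W.
  apply: (iso_inj_l gK); apply: (iso_inj_r (inverses_lw X (assocK _ _ _))).
  rewrite -!compmA -lw_comp lunit_tens brd_nat2 -lunit_tens brd_hex1 !compmA.
  by rewrite (reassoc2 (assocVK _ _ _)) compm1 lunit_nat.
have [lK lVK] := lunitK W.
apply: (iso_inj_r (inverses_lw X (inverses_lw tunit (lunitK W)))).
rewrite -compmA brd_natW compmA lunit_nat -compmA unit_case.
by rewrite -!lw_comp lun1.
Qed.

Lemma brd_uniti X W : brd X tunit W ∘ (X ◁ luniti W) = luniti (X ⊗ W).
Proof.
have [_ lVK] := lunitK W; have [_ lVK'] := lunitK (X ⊗ W).
apply: (iso_inj_l (lunitK (X ⊗ W))).
by rewrite compmA brd_unit -lw_comp lVK tensm1 lVK'.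
Qed.

(** A strand X slides across e by naturality of the braiding in e, because
    braiding with the unit is trivial. *)
Lemma fam_ev_slide A B (e : hom (A ⊗ B) tunit) X W :
  fam_ev e (X ⊗ W) ∘ (A ◁ brd X B W) ∘ brd X A (B ⊗ W) = X ◁ fam_ev e W.
Proof.
rewrite !fam_evE !lw_comp -brd_unit (reassoc2 (brd_nat2 _ _ _)) brd_hex1
  !compmA.
by rewrite (reassoc2 (esym (lw_comp _ _ _))) assocVK tensm1 compm1.
Qed.

Lemma fam_coev_slide A B (o : hom tunit (A ⊗ B)) X W :
  (A ◁ brd X B W) ∘ brd X A (B ⊗ W) ∘ (X ◁ fam_coev o W) = fam_coev o (X ⊗ W).
Proof.
rewrite !fam_coevE -brd_uniti !lw_comp !compmA.
rewrite [in RHS](reassoc2 (esym (brd_nat2 _ _ o))) brd_hex1 !compmA.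
by rewrite assocVK comp1m.
Qed.

End Braid.

(** * Quantum traces and duals of tensor products *)

Section Traces.
Variables (K : fieldType) (C : ribbonCat K).
Implicit Types X Y Z W V : C.

(** A left dual described by its action on right-nested products.  The slide
    axioms stand for naturality of the braiding in the evaluation and the
    coevaluation.  In this form the dual of a tensor product is obtained by
    nesting the two dualities ([tens_dual]). *)
Record famdual Y := FamDual {
  fd : C;
  fev : forall W, hom (fd ⊗ (Y ⊗ W)) W;
  fco : forall W, hom W (Y ⊗ (fd ⊗ W));
  fev_nat : forall W W' (g : hom W W'), fev W' ∘ (fd ◁ Y ◁ g) = g ∘ fev W;
  fco_nat : forall W W' (g : hom W W'), (Y ◁ fd ◁ g) ∘ fco W = fco W' ∘ g;
  fzigzag1 : forall W, (Y ◁ fev W) ∘ fco (Y ⊗ W) = idm (Y ⊗ W);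
  fzigzag2 : forall W, fev (fd ⊗ W) ∘ (fd ◁ fco W) = idm (fd ⊗ W);
  fev_slide : forall X W,
    fev (X ⊗ W) ∘ (fd ◁ brd X Y W) ∘ brd X fd (Y ⊗ W) = X ◁ fev W;
  fco_slide : forall X W,
    (Y ◁ brd X fd W) ∘ brd X Y (fd ⊗ W) ∘ (X ◁ fco W) = fco (X ⊗ W)
}.

Definition dual_fam Y : famdual Y :=
  FamDual (@fam_ev_nat _ _ _ _ (ev Y)) (@fam_coev_nat _ _ _ _ (coev Y))
    (fun W => fam_zigzag1 W (dualP Y)) (fun W => fam_zigzag2 W (dualP Y))
    (@fam_ev_slide _ _ _ _ (ev Y)) (@fam_coev_slide _ _ _ _ (coev Y)).

(** Evaluation on the other side, built from the braiding and the twist like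
    the one that closes the loop in [qdim]. *)
Definition tev Y (D : famdual Y) W : hom (Y ⊗ (fd D ⊗ W)) W :=
  locked (fev D W ∘ brd Y (fd D) W ∘ (twist Y ▷ (fd D ⊗ W))).

Lemma tevE Y (D : famdual Y) W :
  tev D W = fev D W ∘ brd Y (fd D) W ∘ (twist Y ▷ (fd D ⊗ W)).
Proof. by rewrite /tev -lock. Qed.

(** Yang-Baxter brings the two crossings of X next to the evaluation, across
    which X then slides. *)
Lemma fev_brd_slide X Y (D : famdual Y) W :
  fev D (X ⊗ W) ∘ brd Y (fd D) (X ⊗ W) ∘ (Y ◁ brd X (fd D) W)
    ∘ brd X Y (fd D ⊗ W) = (X ◁ fev D W) ∘ (X ◁ brd Y (fd D) W).
Proof.
rewrite (reassoc3 (esym (brd_yang_baxter X Y (fd D) W))) !compmA.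
by rewrite fev_slide.
Qed.

Section Tensor.
Variables (Y Z : C) (DY : famdual Y) (DZ : famdual Z).
Let Y' := fd DY.
Let Z' := fd DZ.
Let P := Y ⊗ Z.
Let P' := Z' ⊗ Y'.

(** The duality of Y ⊗ Z with all four factors separated: the pairing of Y
    sits inside that of Z. *)
Definition nest_fev W : hom (Z' ⊗ (Y' ⊗ (Y ⊗ (Z ⊗ W)))) W :=
  locked (fev DZ W ∘ (Z' ◁ fev DY (Z ⊗ W))).

Definition nest_fco W : hom W (Y ⊗ (Z ⊗ (Z' ⊗ (Y' ⊗ W)))) :=
  locked ((Y ◁ fco DZ (Y' ⊗ W)) ∘ fco DY W).

Lemma nest_fevE W : nest_fev W = fev DZ W ∘ (Z' ◁ fev DY (Z ⊗ W)).
Proof. by rewrite /nest_fev -lock. Qed.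

Lemma nest_fcoE W : nest_fco W = (Y ◁ fco DZ (Y' ⊗ W)) ∘ fco DY W.
Proof. by rewrite /nest_fco -lock. Qed.

Lemma nest_fev_nat W W' (g : hom W W') :
  nest_fev W' ∘ (Z' ◁ Y' ◁ Y ◁ Z ◁ g) = g ∘ nest_fev W.
Proof.
by rewrite !nest_fevE (reassoc2 (esym (lw_comp _ _ _))) fev_nat lw_comp !compmA
  fev_nat.
Qed.

Lemma nest_fco_nat W W' (g : hom W W') :
  (Y ◁ Z ◁ Z' ◁ Y' ◁ g) ∘ nest_fco W = nest_fco W' ∘ g.
Proof.
by rewrite !nest_fcoE compmA -lw_comp fco_nat lw_comp -!compmA fco_nat.
Qed.

Lemma nest_zigzag1 W :
  (Y ◁ Z ◁ nest_fev W) ∘ nest_fco (Y ⊗ (Z ⊗ W)) = idm (Y ⊗ (Z ⊗ W)).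
Proof.
rewrite nest_fevE nest_fcoE compmA -lw_comp (lw_comp Z) -(compmA (Z ◁ _))
  fco_nat compmA.
by rewrite fzigzag1 comp1m fzigzag1.
Qed.

Lemma nest_zigzag2 W :
  nest_fev (Z' ⊗ (Y' ⊗ W)) ∘ (Z' ◁ Y' ◁ nest_fco W) = idm (Z' ⊗ (Y' ⊗ W)).
Proof.
rewrite nest_fevE nest_fcoE -compmA -lw_comp (lw_comp Y') compmA fev_nat
  -compmA.
by rewrite fzigzag2 compm1 fzigzag2.
Qed.

Lemma nest_fev_slide X W :
  nest_fev (X ⊗ W) ∘ (Z' ◁ Y' ◁ Y ◁ brd X Z W) ∘ (Z' ◁ Y' ◁ brd X Y (Z ⊗ W))
    ∘ (Z' ◁ brd X Y' _) ∘ brd X Z' _ = X ◁ nest_fev W.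
Proof.
rewrite !nest_fevE; do 3! rewrite (reassoc2 (esym (lw_comp Z' _ _))).
rewrite !compmA fev_nat (reassoc3 (fev_slide _ _ _)) lw_comp !compmA.
by rewrite (reassoc2 (esym (brd_natW _ _ _))) !compmA fev_slide -lw_comp.
Qed.

Lemma nest_fco_slide X W :
  (Y ◁ Z ◁ Z' ◁ brd X Y' W) ∘ (Y ◁ Z ◁ brd X Z' (Y' ⊗ W))
    ∘ (Y ◁ brd X Z _) ∘ brd X Y _ ∘ (X ◁ nest_fco W) = nest_fco (X ⊗ W).
Proof.
rewrite nest_fcoE lw_comp !compmA (reassoc2 (brd_natW _ _ _)) !compmA
  -3!(lw_comp Y).
by rewrite (reassoc3 (fco_slide _ _ _)) fco_nat lw_comp
  (reassoc3 (fco_slide _ _ _)) nest_fcoE.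
Qed.

Definition tens_fev W : hom (P' ⊗ (P ⊗ W)) W :=
  locked (nest_fev W ∘ assoc Z' Y' _ ∘ (P' ◁ assoc Y Z W)).

Definition tens_fco W : hom W (P ⊗ (P' ⊗ W)) :=
  locked (associ Y Z (P' ⊗ W) ∘ (Y ◁ Z ◁ associ Z' Y' W) ∘ nest_fco W).

Lemma tens_fevE W :
  tens_fev W = nest_fev W ∘ assoc Z' Y' _ ∘ (P' ◁ assoc Y Z W).
Proof. by rewrite /tens_fev -lock. Qed.

Lemma tens_fcoE W :
  tens_fco W = associ Y Z (P' ⊗ W) ∘ (Y ◁ Z ◁ associ Z' Y' W) ∘ nest_fco W.
Proof. by rewrite /tens_fco -lock. Qed.

Lemma tens_fev_nat W W' (g : hom W W') :
  tens_fev W' ∘ (P' ◁ P ◁ g) = g ∘ tens_fev W.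
Proof.
rewrite !tens_fevE (reassoc2 (esym (lw_comp _ _ _))) assoc_lw lw_comp !compmA.
by rewrite (reassoc2 (assoc_lw _ _ _)) !compmA nest_fev_nat.
Qed.

Lemma tens_fco_nat W W' (g : hom W W') :
  (P ◁ P' ◁ g) ∘ tens_fco W = tens_fco W' ∘ g.
Proof.
rewrite !tens_fcoE !compmA -associ_lw (reassoc2 (esym (lw_comp Y _ _)))
  -(lw_comp Z).
by rewrite -associ_lw !lw_comp !compmA (reassoc2 (nest_fco_nat _)) !compmA.
Qed.

Lemma tens_zigzag1 W : (P ◁ tens_fev W) ∘ tens_fco (P ⊗ W) = idm (P ⊗ W).
Proof.
apply: (iso_inj_r (inversesV (assocK Y Z W))).
apply: (iso_inj_l (assocK Y Z W)).
rewrite [in LHS]tens_fcoE !compmA assoc_lw (reassoc2 (assocVK _ _ _)) !compm1.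
rewrite (reassoc2 (esym (nest_fco_nat _))) compmA -!lw_comp tens_fevE.
rewrite (reassoc2 (associ_lw _ _ _)) !compmA (reassoc2 (esym (lw_comp P' _ _)))
  assocVK.
by rewrite tensm1 compm1 (reassoc2 (assocVK _ _ _)) compm1 nest_zigzag1.
Qed.

Lemma tens_zigzag2 W : tens_fev (P' ⊗ W) ∘ (P' ◁ tens_fco W) = idm (P' ⊗ W).
Proof.
apply: (iso_inj_r (inversesV (assocK Z' Y' W))).
apply: (iso_inj_l (assocK Z' Y' W)).
rewrite tens_fevE !compmA (reassoc2 (esym (lw_comp P' _ _))).
rewrite (reassoc2 (esym (associ_lw _ _ _))) !compmA (reassoc2 (assocVK _ _ _))
  !compm1.
rewrite -nest_fev_nat assocVK (reassoc2 (esym (lw_comp Z' _ _))) -(lw_comp Y').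
rewrite tens_fcoE !compmA (reassoc2 (assocVK _ _ _)).
by rewrite compm1 -!lw_comp assocVK !tensm1 comp1m nest_zigzag2.
Qed.

Lemma tens_fev_slide X W :
  tens_fev (X ⊗ W) ∘ (P' ◁ brd X P W) ∘ brd X P' (P ⊗ W) = X ◁ tens_fev W.
Proof.
rewrite !tens_fevE !lw_comp -nest_fev_slide.
rewrite [brd X P W]brd_hex1 [brd X P' _]brd_hex1 !lw_comp !compmA.
rewrite (reassoc2 (esym (lw_comp P' (assoc _ _ _) (associ _ _ _)))) assocVK
  tensm1 compm1.
do 3! rewrite (reassoc2 (assoc_lw _ _ _)) !compmA.
rewrite (reassoc2 (assocVK _ _ _)) compm1.
rewrite (reassoc2 (esym (lw_comp Z' (Y' ◁ _) (brd _ _ _)))) -brd_natW lw_comp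
  !compmA.
rewrite (reassoc2 (esym (brd_natW _ _ _))) !compmA.
by rewrite [in RHS](reassoc2 (esym (lw_comp X _ _))) assoc_lw lw_comp !compmA.
Qed.

Lemma tens_fco_slide X W :
  (P ◁ brd X P' W) ∘ brd X P (P' ⊗ W) ∘ (X ◁ tens_fco W) = tens_fco (X ⊗ W).
Proof.
rewrite !tens_fcoE -nest_fco_slide !lw_comp !compmA.
rewrite [brd X P _]brd_hex1 [brd X P' W]brd_hex1 !lw_comp !compmA.
rewrite (reassoc2 (esym (lw_comp X (assoc _ _ _) (associ _ _ _)))) assocVK
  tensm1 compm1.
do 3! rewrite (reassoc2 (esym (associ_lw Y Z _))) !compmA.
rewrite -(associ_lw Y Z).
rewrite (reassoc2 (brd_natW _ _ _)) !compmA.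
rewrite (reassoc2 (esym (lw_comp Y (brd _ _ _) (X ◁ _)))) brd_natW lw_comp
  !compmA.
rewrite (reassoc2 (esym (lw_comp Y (Z ◁ X ◁ _) (Z ◁ X ◁ _)))) -(lw_comp Z)
  -(lw_comp X).
by rewrite assocVK !tensm1 compm1.
Qed.

Definition tens_dual : famdual P :=
  FamDual tens_fev_nat tens_fco_nat tens_zigzag1 tens_zigzag2
    tens_fev_slide tens_fco_slide.

Lemma twist_fam U :
  twist P ▷ U = associ Y Z U ∘ brd Z Y U ∘ brd Y Z U ∘ (twist Y ▷ (Z ⊗ U))
    ∘ (Y ◁ (twist Z ▷ U)) ∘ assoc Y Z U.
Proof.
rewrite twist_tens !rw_comp !brdE !compmA associK comp1m.
rewrite (reassoc2 (associK _ _ _)) compm1.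
rewrite (reassoc2 (esym (tensm_comp _ _ (idm (Z ⊗ U)) _))) comp1m compm1.
rewrite (reassoc2 (associ_nat _ _ _)) !compmA (reassoc2 (associK _ _ _)) compm1.
by [].
Qed.

(** Crossing Y ⊗ Z with its dual makes four crossings.  Together with the
    double braiding of Y and Z contributed by the twist, Yang-Baxter unlinks
    them: the loop of Y is first pulled off Z, then that of Z off Y. *)
Lemma nest_fev_brd W :
  nest_fev W ∘ (Z' ◁ brd Y Y' (Z ⊗ W)) ∘ brd Y Z' (Y' ⊗ (Z ⊗ W))
    ∘ (Y ◁ Z' ◁ brd Z Y' W) ∘ (Y ◁ brd Z Z' (Y' ⊗ W))
    ∘ brd Z Y (Z' ⊗ (Y' ⊗ W)) ∘ brd Y Z (Z' ⊗ (Y' ⊗ W)) =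
  fev DY W ∘ brd Y Y' W ∘ (Y ◁ fev DZ (Y' ⊗ W)) ∘ (Y ◁ brd Z Z' (Y' ⊗ W)).
Proof.
rewrite (reassoc2 (brd_natW _ _ _)) !compmA.
rewrite (reassoc3 (esym (brd_yang_baxter Z Y Z' (Y' ⊗ W)))) !compmA nest_fevE.
do 3! rewrite (reassoc2 (esym (lw_comp Z' _ _))).
rewrite !compmA fev_brd_slide !lw_comp !compmA fev_nat.
rewrite (reassoc2 (fev_nat DZ _)) -!compmA; congr (_ ∘ _); rewrite !compmA.
by rewrite -!compmA; congr (_ ∘ _); rewrite !compmA fev_brd_slide.
Qed.

(** Closing a strand Y ⊗ Z is the same as closing Z and then Y.  This is the
    compatibility of the twist with the tensor product. *)
Lemma tev_tens W :
  tev tens_dual W = tev DY W ∘ (Y ◁ tev DZ (Y' ⊗ W))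
    ∘ (Y ◁ Z ◁ assoc Z' Y' W) ∘ assoc Y Z (P' ⊗ W).
Proof.
rewrite !tevE /= tens_fevE twist_fam [brd P _ _]brd_hex2 !compmA.
rewrite (reassoc2 (esym (lw_comp P' (assoc _ _ _) (associ _ _ _)))) assocVK
  tensm1 compm1.
rewrite (reassoc2 (assocVK _ _ _)) compm1.
rewrite [brd Y P' _]brd_hex1 [brd Z P' _]brd_hex1 !lw_comp !compmA.
rewrite (reassoc2 (assocVK _ _ _)) compm1.
rewrite (reassoc2 (esym (lw_comp Y (assoc _ _ _) (associ _ _ _)))) assocVK
  tensm1 compm1.
do 2! rewrite (reassoc2 (esym (brd_natW _ _ (assoc _ _ _)))) !compmA.
rewrite (reassoc2 (whisker_exchange _ _)) !compmA.
rewrite (reassoc2 (esym (lw_comp Y (Z ◁ _) _))) whisker_exchange lw_comp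
  !compmA.
by rewrite nest_fev_brd; do 2! rewrite
  [in RHS](reassoc2 (esym (whisker_exchange (twist Y) _))) !compmA.
Qed.

End Tensor.

Section Mate.
Variables (Y A : C) (DY : famdual Y) (DA : famdual A) (f : hom Y A).

(** The transpose of f, as a family. *)
Definition mate W : hom (fd DA ⊗ W) (fd DY ⊗ W) :=
  locked (fev DA (fd DY ⊗ W) ∘ (fd DA ◁ (f ▷ (fd DY ⊗ W)))
            ∘ (fd DA ◁ fco DY W)).

Lemma mateE W : mate W =
  fev DA (fd DY ⊗ W) ∘ (fd DA ◁ (f ▷ (fd DY ⊗ W))) ∘ (fd DA ◁ fco DY W).
Proof. by rewrite /mate -lock. Qed.

Lemma fco_mate W :
  (A ◁ mate W) ∘ fco DA W = (f ▷ (fd DY ⊗ W)) ∘ fco DY W.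
Proof.
rewrite mateE !lw_comp (reassoc2 (fco_nat DA _)) !compmA
  (reassoc2 (fco_nat DA _)) !compmA.
by rewrite fzigzag1 comp1m.
Qed.

Lemma fev_mate W : fev DY W ∘ mate (Y ⊗ W) = fev DA W ∘ (fd DA ◁ (f ▷ W)).
Proof.
rewrite mateE !compmA -(fev_nat DA)
  (reassoc2 (esym (lw_comp (fd DA) (A ◁ _) _))) whisker_exchange lw_comp
  !compmA.
by rewrite (reassoc2 (esym (lw_comp (fd DA) _ _))) fzigzag1 tensm1 compm1.
Qed.

(** X slides in turn across the coevaluation, f and the evaluation that make
    up the transpose. *)
Lemma brd_mate X W :
  brd X (fd DY) W ∘ (X ◁ mate W) = mate (X ⊗ W) ∘ brd X (fd DA) W.
Proof.
rewrite !mateE !lw_comp -(fev_slide DA) !compmA.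
rewrite (reassoc2 (brd_natW _ _ _)) !compmA (reassoc2 (brd_natW _ _ _)) !compmA.
rewrite (reassoc2 (esym (lw_comp (fd DA) (brd _ _ _) (X ◁ _)))) brd_nat2 lw_comp
  !compmA.
rewrite -fev_nat (reassoc2 (esym (lw_comp (fd DA) _ (_ ▷ _)))) whisker_exchange
  lw_comp !compmA.
rewrite (reassoc2 (esym (lw_comp (fd DA) (Y ◁ _) _)))
  (reassoc2 (esym (lw_comp (fd DA) _ (X ◁ _)))).
by rewrite fco_slide.
Qed.

Lemma tev_mate W :
  tev DY W ∘ (Y ◁ mate W) = tev DA W ∘ (f ▷ (fd DA ⊗ W)).
Proof.
rewrite !tevE (reassoc2 (esym (whisker_exchange _ _))) !compmA
  (reassoc2 (brd_mate _ _)) !compmA.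
rewrite fev_mate (reassoc2 (esym (brd_nat1 _ _ _))) !compmA.
by rewrite -!compmA -!rw_comp twist_nat.
Qed.

(** Moving f once around the loop turns a loop coloured Y into a loop coloured
    A: f becomes its transpose at the coevaluation, passes G by naturality, and
    becomes f again at the evaluation. *)
Lemma ptrace_cyclic X
    (G : forall W, hom (X ⊗ (A ⊗ W)) (X ⊗ (Y ⊗ W)))
    (Gnat : forall W W' (g : hom W W'),
      G W' ∘ (X ◁ A ◁ g) = (X ◁ Y ◁ g) ∘ G W) W :
  (X ◁ tev DY W) ∘ G (fd DY ⊗ W) ∘ (X ◁ (f ▷ (fd DY ⊗ W))) ∘ (X ◁ fco DY W) =
  (X ◁ tev DA W) ∘ (X ◁ (f ▷ (fd DA ⊗ W))) ∘ G (fd DA ⊗ W) ∘ (X ◁ fco DA W).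
Proof.
rewrite (reassoc2 (esym (lw_comp X _ _))) -fco_mate lw_comp !compmA.
rewrite (reassoc2 (Gnat _ _ _)) !compmA.
by rewrite -lw_comp tev_mate lw_comp.
Qed.

Lemma trace_cyclic (g : hom A Y) W :
  tev DY W ∘ ((g ∘ f) ▷ (fd DY ⊗ W)) ∘ fco DY W =
  tev DA W ∘ ((f ∘ g) ▷ (fd DA ⊗ W)) ∘ fco DA W.
Proof.
rewrite !rw_comp !compmA (reassoc2 (esym (fco_mate _))) !compmA.
by rewrite (reassoc2 (esym (whisker_exchange _ _))) !compmA tev_mate.
Qed.

End Mate.

End Traces.

(** * Semisimplicity: Schur's lemma and dimensions of Hom spaces *)

Section LinearDimension.
Variable K : fieldType.

Lemma dimv_linear_bij (U V : vectType K) (f : U -> V) (g : V -> U) :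
  linear f -> cancel f g -> cancel g f -> \dim {: U} = \dim {: V}.
Proof.
move=> lf fK gK.
pose fL := GRing.isLinear.Build K U V *:%R f lf.
pose F : {linear U -> V} := HB.pack f fL.
have kerF : lker (linfun F) == 0%VS.
  apply/lker0P => x y; rewrite !lfunE /= => E.
  by rewrite -(fK x) E fK.
have imF : limg (linfun F) = fullv.
  apply/eqP; rewrite eqEsubv subvf /=; apply/subvP => y _.
  by rewrite -(gK y) -[f _](lfunE F) memv_img ?memvf.
by rewrite -[in RHS]imF limg_dim_eq // (eqP kerF) capv0.
Qed.

End LinearDimension.

Section Eigenvector.
Import VectorInternalTheory.

Lemma linear_eigenvector (K : closedFieldType) (V : vectType K)
  (F : {linear V -> V}) : (0 < dim V)%N ->
  exists a, exists2 v, v != 0 & F v = a *: v.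
Proof.
move=> V_gt0; pose A : 'M[K]_(dim V) := lin1_mx (v2r \o F \o r2v).
have [a] : exists a, root (char_poly A) a.
  by apply/closed_rootP; rewrite size_char_poly eqSS -lt0n.
rewrite -eigenvalue_root_char => /eigenvalueP[v vA v0].
exists a, (r2v v).
  by apply: contraNneq v0 => rv0; rewrite -(r2vK v) rv0 linear0.
have -> : a *: r2v v = r2v (a *: v) :> V by rewrite linearZ.
by rewrite -vA mul_rV_lin1 /= v2rK.
Qed.

End Eigenvector.

Section Schur.
Variables (K : closedFieldType) (C : linCat K).
Implicit Types X Y Z P : C.
Hypothesis ss : semisimple_cat C.

(** The kernel of f is a subobject of the simple object X, hence zero. *)
Lemma simple_mono X Y (f : hom X Y) : simple_obj X -> f <> 0 -> mono f.
Proof.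
move=> [_ sX] f0 W u v E.
have [_ /(_ _ _ f)[A [k [fk kP]]] _ _ _] := ss.1.
have kmono : mono k.
  move=> V a b kab.
  have fkb : f ∘ (k ∘ b) = 0 by rewrite compmA fk comp0m.
  have [w [_ uniqw]] := kP _ _ fkb.
  by rewrite -(uniqw a kab) -(uniqw b erefl).
have [k0|[l [lk kl]]] := sX _ k kmono.
  have fuv : f ∘ (u - v) = 0 by rewrite comp_addr comp_oppr E subrr.
  have [w [kw _]] := kP _ _ fuv.
  by apply/eqP; rewrite -subr_eq0 -kw k0 comp0m.
by case: f0; rewrite -(compm1 f) -kl compmA fk comp0m.
Qed.

Lemma simple_hom X Y (f : hom X Y) :
  simple_obj X -> simple_obj Y -> f = 0 \/ is_iso f.
Proof.
move=> sX sY; have [->|f0] := EM (f = 0); first by left.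
by apply: sY.2; apply: simple_mono.
Qed.

(** Composition with f is a linear endomorphism of a nonzero space, so it has
    an eigenvalue a; then f - a kills a nonzero morphism and is not
    invertible. *)
Lemma schur X (f : hom X X) : simple_obj X -> exists a, f = a *: idm X.
Proof.
move=> sX; have lf : linear (fun g : hom X X => f ∘ g) by apply: comp_linear_r.
pose fL := GRing.isLinear.Build K _ _ *:%R (fun g : hom X X => f ∘ g) lf.
pose F : {linear hom X X -> hom X X} := HB.pack (fun g : hom X X => f ∘ g) fL.
have [|a [v /eqP v0 Fv]] := @linear_eigenvector K _ F.
  rewrite lt0n; apply/negP => /eqP n0; case: sX => + _; apply.
  have : (\dim {: hom X X} == 0)%N by rewrite dimvf; apply/eqP.
  by rewrite dimv_eq0 => /eqP fv0; apply/eqP; rewrite -memv0 -fv0 memvf.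
exists a.
have [|[g [gK _]]] := simple_hom (f - a *: idm X) sX sX.
  by move/eqP; rewrite subr_eq0 => /eqP.
case: v0; rewrite -(comp1m v) -gK -compmA comp_addl [f ∘ v]Fv comp_oppl.
by rewrite comp_scalel comp1m subrr compm0.
Qed.

Lemma scalar_ofP X (f : hom X X) :
  simple_obj X -> f = scalar_of f *: idm X.
Proof. by move=> sX; have [a fa] := schur f sX; exact:
  (xgetPex 0 (ex_intro [set a | f = a *: idm X]%classic a fa)). Qed.

Lemma scalar_of_uniq X (f : hom X X) a :
  simple_obj X -> f = a *: idm X -> scalar_of f = a.
Proof.
move=> sX fa; have := scalar_ofP f sX; rewrite {1}fa => /eqP.
rewrite -subr_eq0 -scalerBl scaler_eq0 subr_eq0 => /orP[/eqP-> //|/eqP].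
by case: sX.
Qed.

End Schur.

Section Decomposition.
Variables (K : closedFieldType) (C : linCat K).
Hypothesis ss : semisimple_cat C.
Variables (n : nat) (X : 'I_n -> C).
Hypothesis XP : simple_reps X.

Lemma reps_simple i : simple_obj (X i).
Proof. by case: XP. Qed.

(** Taking the representatives themselves as summands avoids transporting
    loops along isomorphisms later. *)
Lemma decomposition (P : C) :
  exists m (k : 'I_m -> 'I_n), is_direct_sum (fun a => X (k a)) P.
Proof.
have [_ _ repsX] := XP; have [m [S [sS [i [p [pi1 pi0 sum1]]]]]] := ss.2 P.
have /choice[k kP] : forall a, exists l, S a ≅ X l by move=> a; exact: repsX.
have uvP a : {uv : hom (S a) (X (k a)) * hom (X (k a)) (S a) |
    inverses uv.1 uv.2}.
  by apply: cid; have [u [v uv]] := kP a; exists (u, v).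
pose u a := (sval (uvP a)).1; pose v a := (sval (uvP a)).2.
have vP a : inverses (u a) (v a) by exact: svalP (uvP a).
exists m, k, (fun a => i a ∘ v a), (fun a => u a ∘ p a); split=> [a|a b ab|].
- rewrite compmA (reassoc2 (pi1 a)) compm1; exact: (vP a).2.
- by rewrite compmA (reassoc2 (pi0 a b ab)) compm0 comp0m.
- rewrite -sum1; apply: eq_bigr => a _.
  by rewrite compmA (reassoc2 (vP a).1) compm1.
Qed.

Lemma hom_reps_neq i j (f : hom (X i) (X j)) : i != j -> f = 0.
Proof.
move=> ij; have [//|[g fg]] := simple_hom ss f (reps_simple i) (reps_simple j).
by case/eqP: ij; case: XP => _ inj _; apply: inj; exists f, g.
Qed.

(** A generator of Hom(X i, X j), written uniformly in i and j although the
    two objects are equal only propositionally. *)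
Definition rep_id i j : hom (X i) (X j) :=
  if i =P j is ReflectT e then ecast l (hom (X i) (X l)) e (idm (X i)) else 0.

Lemma rep_idii i : rep_id i i = idm (X i).
Proof.
by rewrite /rep_id; case: eqP => // e; rewrite (Prop_irrelevance e erefl).
Qed.

Definition rep_coef i (f : hom (X i) (X i)) : K := scalar_of f.

Lemma rep_coefP i (f : hom (X i) (X i)) : f = rep_coef f *: idm (X i).
Proof. exact: (scalar_ofP ss _ (reps_simple i)). Qed.

Lemma rep_coef_lin i a (f g : hom (X i) (X i)) :
  rep_coef (a *: f + g) = a * rep_coef f + rep_coef g.
Proof.
apply: (scalar_of_uniq ss (reps_simple i)).
by rewrite {1}(rep_coefP f) {1}(rep_coefP g) scalerA scalerDl.
Qed.

Lemma rep_coefZ1 i a : rep_coef (a *: idm (X i)) = a.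
Proof. exact: (scalar_of_uniq ss (reps_simple i)). Qed.

Section DimSum.
Variables (P : C) (m : nat) (k : 'I_m -> 'I_n).
Hypothesis dsP : is_direct_sum (fun a => X (k a)) P.

Lemma dim_hom_to_rep j : \dim {: hom P (X j)} = #|[set a | k a == j]|.
Proof.
have [i [p [pi1 pi0 sum1]]] := dsP.
pose A := [set a | k a == j].
have kj (a : 'I_#|A|) : k (enum_val a) = j.
  by apply/eqP; have := enum_valP a; rewrite inE.
pose f (h : hom P (X j)) : 'rV[K]_#|A| :=
  \row_a rep_coef (h ∘ i (enum_val a) ∘ rep_id j (k (enum_val a))).
pose g (v : 'rV[K]_#|A|) : hom P (X j) :=
  \sum_a v 0 a *: (rep_id (k (enum_val a)) j ∘ p (enum_val a)).
have lf : linear f.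
  move=> a u v; apply/rowP => b; rewrite !mxE -rep_coef_lin.
  by congr rep_coef; rewrite !comp_addl !comp_scalel.
suff [fK gK] : cancel f g /\ cancel g f.
  by rewrite (dimv_linear_bij lf fK gK) dimvf /dim /= mul1n.
split=> [h|v].
  rewrite -[RHS]compm1 -sum1 comp_sumr (bigID (mem A)) /=.
  rewrite [X in _ = _ + X]big1 ?addr0 => [|q].
    rewrite [RHS]big_enum_val /=; apply: eq_bigr => a _; rewrite mxE.
    have h_i := rep_coefP (h ∘ i (enum_val a) ∘ rep_id j (k (enum_val a))).
    rewrite -comp_scalel compmA; congr (_ ∘ _).
    move: (i _) h_i; rewrite (kj a) => ia; rewrite !rep_idii compm1.
    exact: esym.
  rewrite inE => kq; rewrite compmA (hom_reps_neq (h ∘ i q)) ?comp0m //.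
apply/rowP => a; rewrite mxE /g comp_suml comp_suml.
rewrite (bigD1 a) //= big1 ?addr0 => [|b ba].
  rewrite !comp_scalel -(compmA (rep_id _ _)) pi1 compm1.
  by rewrite (kj a) !rep_idii compm1 rep_coefZ1.
rewrite !comp_scalel -(compmA (rep_id _ _)) pi0 ?compm0 ?comp0m ?scaler0 //.
by apply: contra_neq ba => /enum_val_inj.
Qed.

Lemma dim_hom_from_rep j : \dim {: hom (X j) P} = #|[set a | k a == j]|.
Proof.
have [i [p [pi1 pi0 sum1]]] := dsP.
pose A := [set a | k a == j].
have kj (a : 'I_#|A|) : k (enum_val a) = j.
  by apply/eqP; have := enum_valP a; rewrite inE.
pose f (h : hom (X j) P) : 'rV[K]_#|A| :=
  \row_a rep_coef (rep_id (k (enum_val a)) j ∘ (p (enum_val a) ∘ h)).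
pose g (v : 'rV[K]_#|A|) : hom (X j) P :=
  \sum_a v 0 a *: (i (enum_val a) ∘ rep_id j (k (enum_val a))).
have lf : linear f.
  move=> a u v; apply/rowP => b; rewrite !mxE -rep_coef_lin.
  by congr rep_coef; rewrite !comp_addr !comp_scaler.
suff [fK gK] : cancel f g /\ cancel g f.
  by rewrite (dimv_linear_bij lf fK gK) dimvf /dim /= mul1n.
split=> [h|v].
  rewrite -[RHS]comp1m -sum1 comp_suml (bigID (mem A)) /=.
  rewrite [X in _ = _ + X]big1 ?addr0 => [|q].
    rewrite [RHS]big_enum_val /=; apply: eq_bigr => a _; rewrite mxE.
    have p_h := rep_coefP (rep_id (k (enum_val a)) j ∘ (p (enum_val a) ∘ h)).
    rewrite -comp_scaler -compmA; congr (_ ∘ _).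
    move: (p _) p_h; rewrite (kj a) => pa; rewrite !rep_idii comp1m.
    exact: esym.
  rewrite inE eq_sym => kq; rewrite -compmA (hom_reps_neq (p q ∘ h)) ?compm0 //.
apply/rowP => a; rewrite mxE /g comp_sumr comp_sumr.
rewrite (bigD1 a) //= big1 ?addr0 => [|b ba].
  rewrite !comp_scaler (compmA (p _)) pi1 comp1m.
  by rewrite (kj a) !rep_idii compm1 rep_coefZ1.
rewrite !comp_scaler (compmA (p _)) pi0 ?comp0m ?compm0 ?scaler0 //.
by apply: contra_neq ba => /enum_val_inj ->.
Qed.

Lemma sum_direct_sum (phi : 'I_n -> K) :
  \sum_a phi (k a) = \sum_j (\dim {: hom P (X j)})%:R * phi j.
Proof.
rewrite (partition_big k predT) //=; apply: eq_bigr => j _.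
rewrite dim_hom_to_rep (eq_bigr (fun=> phi j)) => [|a /eqP-> //].
by rewrite sumr_const cardsE mulr_natl.
Qed.

End DimSum.

Lemma dim_hom_sym (P : C) j : \dim {: hom P (X j)} = \dim {: hom (X j) P}.
Proof.
have [m [k dsP]] := decomposition P.
by rewrite (dim_hom_to_rep dsP) (dim_hom_from_rep dsP).
Qed.

Lemma dim_hom_reps i j : \dim {: hom (X i) (X j)} = (i == j).
Proof.
have dsi : is_direct_sum (fun _ : 'I_1 => X i) (X i).
  exists (fun=> idm _), (fun=> idm _); split=> [_|a b|]; rewrite ?comp1m //.
  - by rewrite !ord1.
  - by rewrite big_ord1.
rewrite (dim_hom_to_rep (k := fun=> i) dsi); case: eqP => ij.
  by rewrite (_ : [set _ | _] = [set: _]%SET) ?cardsT ?card_ord //; apply/setP=>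
    a; rewrite !inE.
by rewrite (_ : [set _ | _] = finset.set0) ?cards0 //; apply/setP=> a; rewrite
  !inE.
Qed.

Lemma dim_hom_iso (P Q Z : C) : P ≅ Q ->
  \dim {: hom P Z} = \dim {: hom Q Z} /\ \dim {: hom Z P} = \dim {: hom Z Q}.
Proof.
case=> f [g [gf fg]]; split.
- apply: (dimv_linear_bij (f := fun h => h ∘ g) (g := fun h => h ∘ f)).
  + exact: comp_linear_l.
  + by move=> h; rewrite -compmA gf compm1.
  + by move=> h; rewrite -compmA fg compm1.
- apply: (dimv_linear_bij (f := fun h => f ∘ h) (g := fun h => g ∘ h)).
  + exact: comp_linear_r.
  + by move=> h; rewrite compmA gf comp1m.
  + by move=> h; rewrite compmA fg comp1m.
Qed.

End Decomposition.

(** * Hopf links of simple objects *)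

Section HopfLinkFamily.
Variables (K : fieldType) (C : ribbonCat K).
Implicit Types X Y Z W P : C.

Definition double_braid X Y : hom (X ⊗ Y) (X ⊗ Y) := braid Y X ∘ braid X Y.

(** A loop coloured Y around a strand coloured X. *)
Definition hopf X Y (D : famdual Y) W : hom (X ⊗ W) (X ⊗ W) :=
  (X ◁ tev D W) ∘ brd Y X (fd D ⊗ W) ∘ brd X Y (fd D ⊗ W) ∘ (X ◁ fco D W).

Lemma tev_dual_fam Y W :
  tev (dual_fam Y) W =
  fam_ev (ev Y ∘ braid Y (dual Y) ∘ (twist Y ▷ dual Y)) W.
Proof.
rewrite tevE /= !fam_evE brdE !compmA (reassoc2 (associK _ _ _)) compm1.
by rewrite (reassoc2 (associ_rw _ _ _)) !rw_comp !compmA.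
Qed.

Lemma fam_ev_coev A B (e : hom (A ⊗ B) tunit) (o : hom tunit (A ⊗ B)) W :
  fam_ev e W ∘ fam_coev o W = lunit W ∘ ((e ∘ o) ▷ W) ∘ luniti W.
Proof.
by rewrite fam_evE fam_coevE !compmA (reassoc2 (associK _ _ _)) compm1 rw_comp
  !compmA.
Qed.

Lemma brd_double X Y W :
  brd Y X W ∘ brd X Y W = assoc X Y W ∘ (double_braid X Y ▷ W) ∘ associ X Y W.
Proof.
by rewrite !brdE !compmA (reassoc2 (associK _ _ _)) compm1
  (reassoc2 (esym (rw_comp _ _ _))).
Qed.

(** A partial trace does not see the spectator W; pentagons and triangles move
    it out. *)
Lemma ptrace_rw X Y Y' (F : hom (X ⊗ Y) (X ⊗ Y)) (e : hom (Y ⊗ Y') tunit)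
    (o : hom tunit (Y ⊗ Y')) W :
  (X ◁ fam_ev e W) ∘ (assoc X Y (Y' ⊗ W) ∘ (F ▷ (Y' ⊗ W))
     ∘ associ X Y (Y' ⊗ W)) ∘ (X ◁ fam_coev o W) =
  (runit X ∘ (X ◁ e) ∘ assoc X Y Y' ∘ (F ▷ Y') ∘ associ X Y Y' ∘ (X ◁ o)
     ∘ runiti X) ▷ W.
Proof.
rewrite fam_evE fam_coevE !lw_comp !compmA (reassoc2 (associ_pentagon _ _ _ _))
  !compmA.
rewrite (reassoc2 (associ_rw _ _ _)) !compmA
  (reassoc2 (associ_pentagon2 _ _ _ _)) !compmA.
rewrite (reassoc2 (esym (lw_comp X (associ _ _ _) (assoc _ _ _)))) associK
  tensm1 compm1.
rewrite (reassoc2 (associ_nat _ _ _)) !compmA triangle_luniti !compmA.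
rewrite (reassoc2 (associK _ _ _)) compm1 (reassoc2 (esym (assoc_nat _ _ _)))
  !compmA.
by rewrite triangle !rw_comp.
Qed.

Lemma hopf_dual_rw X Y : exists h : hom X X, forall W,
  hopf X (dual_fam Y) W = h ▷ W.
Proof.
eexists=> W; rewrite /hopf tev_dual_fam -(compmA (X ◁ _)) brd_double.
exact: ptrace_rw.
Qed.

(** The double braiding of X with the pair of strands Y, Z. *)
Definition double_braid2 X Y Z U : hom (X ⊗ (Y ⊗ (Z ⊗ U))) (X ⊗ (Y ⊗ (Z ⊗ U))) :=
  locked (brd Y X (Z ⊗ U) ∘ (Y ◁ brd Z X U) ∘ (Y ◁ brd X Z U) ∘ brd X Y (Z ⊗ U)).

Lemma double_braid2E X Y Z U : double_braid2 X Y Z U =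
  brd Y X (Z ⊗ U) ∘ (Y ◁ brd Z X U) ∘ (Y ◁ brd X Z U) ∘ brd X Y (Z ⊗ U).
Proof. by rewrite /double_braid2 -lock. Qed.

Lemma double_braid2_nat X Y Z U U' (g : hom U U') :
  double_braid2 X Y Z U' ∘ (X ◁ Y ◁ Z ◁ g) = (X ◁ Y ◁ Z ◁ g) ∘ double_braid2 X Y Z U.
Proof.
rewrite !double_braid2E (reassoc2 (brd_natW _ _ _)) !compmA.
rewrite (reassoc2 (esym (lw_comp Y (brd X Z U') _))) brd_natW lw_comp !compmA.
rewrite (reassoc2 (esym (lw_comp Y (brd Z X U') _))) brd_natW lw_comp !compmA.
by rewrite brd_natW.
Qed.

(** A loop coloured Y ⊗ Z is a Z-loop inside a Y-loop, and the inner loop is a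
    scalar. *)
Lemma hopf_tens X Y Z (DY : famdual Y) (DZ : famdual Z) c W :
  (forall V, hopf X DZ V = c *: idm (X ⊗ V)) ->
  hopf X (tens_dual DY DZ) W = c *: hopf X DY W.
Proof.
move=> hZ; rewrite /hopf tev_tens /= tens_fcoE brd_hex1 brd_hex2 !lw_comp
  !compmA.
rewrite (reassoc2 (esym (lw_comp X (assoc _ _ _) (associ _ _ _)))) assocVK
  tensm1 compm1.
rewrite (reassoc2 (assocVK _ _ _)) compm1.
rewrite (reassoc2 (esym (lw_comp X (assoc _ _ _) (associ _ _ _)))) assocVK
  tensm1 compm1.
rewrite (reassoc4 (esym (double_braid2E X Y Z _)))
  (reassoc2 (double_braid2_nat _ _ _ _)) !compmA.
rewrite (reassoc2 (esym (lw_comp X (_ ◁ _) (_ ◁ _)))) -(lw_comp Y) -(lw_comp Z)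
  assocVK !tensm1.
rewrite compm1 nest_fcoE lw_comp !compmA double_braid2E !compmA.
rewrite (reassoc2 (brd_natW _ _ (fco DZ _))) !compmA.
rewrite (reassoc2 (esym (brd_natW _ _ (tev DZ _)))) !compmA.
have {}hZ : (Y ◁ X ◁ tev DZ (fd DY ⊗ W)) ∘ (Y ◁ brd Z X _) ∘ (Y ◁ brd X Z _)
  ∘ (Y ◁ X ◁ fco DZ _) = c *: idm _.
  by rewrite -!lw_comp -/(hopf X DZ _) hZ lw_scale !tensm1.
by rewrite (reassoc4 hZ) comp_scaler !comp_scalel compm1.
Qed.

(** Closing the encircled strand as well produces the trace of the double
    braiding, because the trace over X ⊗ Y is an iterated trace. *)
Lemma hopf_double_braid X Y (DX : famdual X) (DY : famdual Y) W :
  tev DX W ∘ hopf X DY (fd DX ⊗ W) ∘ fco DX W =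
  tev (tens_dual DX DY) W ∘ (double_braid X Y ▷ _) ∘ fco (tens_dual DX DY) W.
Proof.
rewrite /hopf tev_tens /= tens_fcoE nest_fcoE !compmA.
have E U : assoc X Y U ∘ (double_braid X Y ▷ U) ∘ associ X Y U = brd Y X U ∘ brd
  X Y U.
  by rewrite brd_double.
rewrite (reassoc3 (E _)) !compmA (reassoc2 (brd_natW _ _ _)) !compmA.
rewrite (reassoc2 (brd_natW _ _ _)) !compmA.
rewrite (reassoc2 (esym (lw_comp X (_ ◁ _) (_ ◁ _)))) -(lw_comp Y) assocVK
  !tensm1.
by rewrite compm1.
Qed.

Lemma loop_tens X Y (DX : famdual X) (DY : famdual Y) W c :
  (forall V, tev DY V ∘ fco DY V = c *: idm V) ->
  tev (tens_dual DX DY) W ∘ fco (tens_dual DX DY) W = c *: (tev DX W ∘ fco DX W).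
Proof.
move=> hY; rewrite tev_tens /= tens_fcoE nest_fcoE !compmA.
rewrite (reassoc2 (assocVK _ _ _)) compm1.
rewrite (reassoc2 (esym (lw_comp X (_ ◁ _) (_ ◁ _)))) -(lw_comp Y) assocVK
  !tensm1 compm1.
by rewrite (reassoc2 (esym (lw_comp X _ _))) hY lw_scale tensm1 comp_scaler
  comp_scalel compm1.
Qed.

(** Write the identity of P as the sum of the projections onto the summands
    and move each projection around the loop; the double braidings are natural
    in P. *)
Lemma hopf_sum X P (DP : famdual P) m (S : 'I_m -> C)
    (DS : forall a, famdual (S a)) W :
  is_direct_sum S P -> hopf X DP W = \sum_a hopf X (DS a) W.
Proof.
case=> i [p [pi1 _ sum1]].
have -> : hopf X DP W = (X ◁ tev DP W) ∘ brd P X _ ∘ brd X P _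
    ∘ (X ◁ ((\sum_a (i a ∘ p a)) ▷ _)) ∘ (X ◁ fco DP W).
  by rewrite sum1 !tensm1 compm1.
rewrite rw_sum lw_sum comp_sumr comp_suml; apply: eq_bigr => a _.
rewrite rw_comp lw_comp !compmA.
pose G V := brd P X V ∘ brd X P V ∘ (X ◁ (i a ▷ V)).
have Gnat V V' (g : hom V V') :
    G V' ∘ (X ◁ S a ◁ g) = (X ◁ P ◁ g) ∘ G V.
  rewrite /G (reassoc2 (esym (lw_comp X _ _))) -whisker_exchange lw_comp
    !compmA.
  by rewrite (reassoc2 (brd_natW _ _ _)) !compmA brd_natW.
have := ptrace_cyclic DP (DS a) (p a) Gnat W; rewrite /G !compmA => ->.
rewrite (reassoc2 (esym (brd_nat1 _ _ _))) !compmA.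
rewrite (reassoc2 (esym (brd_nat2 _ _ _))) !compmA
  (reassoc2 (esym (lw_comp X (_ ▷ _) (_ ▷ _)))).
by rewrite -rw_comp pi1 !tensm1 compm1.
Qed.

Lemma trace_sum P (DP : famdual P) m (S : 'I_m -> C)
    (DS : forall a, famdual (S a)) (F : hom P P) (c d : 'I_m -> K) W :
  is_direct_sum S P ->
  (forall a (f : hom (S a) P), F ∘ f = c a *: f) ->
  (forall a, tev (DS a) W ∘ fco (DS a) W = d a *: idm W) ->
  tev DP W ∘ (F ▷ _) ∘ fco DP W = (\sum_a c a * d a) *: idm W.
Proof.
case=> i [p [pi1 _ sum1]] Fc dS.
rewrite -(compm1 F) -sum1 comp_sumr rw_sum comp_sumr comp_suml scaler_suml.
apply: eq_bigr => a _.
rewrite compmA (trace_cyclic DP (DS a) (p a)) Fc comp_scaler pi1 rw_scale.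
by rewrite tensm1 comp_scaler compm1 comp_scalel dS scalerA.
Qed.

Lemma twist_iso_scalar X Y a (u : hom X Y) v :
  inverses u v -> twist X = a *: idm X -> twist Y = a *: idm Y.
Proof.
case=> vu uv tX; rewrite -[LHS]compm1 -uv compmA twist_nat tX comp_scaler.
by rewrite compm1 comp_scalel uv.
Qed.

Lemma twist_dual_scalar X a : twist X = a *: idm X ->
  twist (dual X) = a *: idm (dual X).
Proof.
move=> tX; rewrite twist_dual /dualm tX lw_scale rw_scale
  !(comp_scaler, comp_scalel).
by rewrite !tensm1 compm1 (dualP X).2.
Qed.

(** Tensoring with the dual of Y is left adjoint to tensoring with Y. *)
Lemma adjoint_dims Y (D : famdual Y) A B :
  \dim {: hom (fd D ⊗ A) B} = \dim {: hom A (Y ⊗ B)}.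
Proof.
apply: (dimv_linear_bij (f := fun h : hom (fd D ⊗ A) B => (Y ◁ h) ∘ fco D A)
   (g := fun h : hom A (Y ⊗ B) => fev D B ∘ (fd D ◁ h))).
- move=> a f g /=; have := tensm_linear_r (idm Y) a f g => /= ->.
  by rewrite comp_addl comp_scalel.
- by move=> h; rewrite lw_comp compmA fev_nat -compmA fzigzag2 compm1.
- by move=> h; rewrite lw_comp -compmA fco_nat compmA fzigzag1 comp1m.
Qed.

End HopfLinkFamily.

(** * The numerical data of a modular category *)

(** [md_chi i j] is the scalar by which a loop coloured j acts on a strand i.
    The number [md_dim i * md_chi i j] is the trace of the double braiding of
    i with j, which is the S-matrix entry in row [md_dual i] because
    [smatrix] is normalised with the dual of its first label. *)
Record modularDatum (K : fieldType) (n : nat) := ModularDatum {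
  md_unit : 'I_n;
  md_dual : 'I_n -> 'I_n;
  md_N : 'I_n -> 'I_n -> 'I_n -> nat;
  md_dim : 'I_n -> K;
  md_theta : 'I_n -> K;
  md_chi : 'I_n -> 'I_n -> K;
  md_theta_neq0 : forall i, md_theta i != 0;
  md_theta_dual : forall i, md_theta (md_dual i) = md_theta i;
  md_N1 : forall i k, md_N i md_unit k = (i == k);
  md_frobenius : forall i j k, md_N (md_dual i) j k = md_N i k j;
  md_chiM : forall i j k,
    md_chi i j * md_chi i k = \sum_l (md_N j k l)%:R * md_chi i l;
  md_dimM : forall i j,
    md_dim i * md_dim j = \sum_k (md_N i j k)%:R * md_dim k;
  md_balancing : forall i j,
    md_dim i * md_chi i j =
    (md_theta i)^-1 * (md_theta j)^-1 *
      \sum_k (md_N i j k)%:R * (md_theta k * md_dim k)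
}.

Section NumericalData.
Variables (K : closedFieldType) (C : ribbonCat K).
Hypotheses (ss : semisimple_cat C) (s1 : simple_obj (tunit : C)).
Variables (n : nat) (X : 'I_n -> C).
Hypothesis XP : simple_reps X.
Variable i0 : 'I_n.
Hypothesis X0 : X i0 ≅ tunit.

Let simpleX := reps_simple XP.

Lemma loop_qdim (Y : C) W :
  tev (dual_fam Y) W ∘ fco (dual_fam Y) W = qdim Y *: idm W.
Proof.
rewrite tev_dual_fam fam_ev_coev.
rewrite (scalar_ofP ss (ev Y ∘ _ ∘ _ ∘ _) s1) -/(qdim Y) rw_scale tensm1.
by rewrite comp_scaler compm1 comp_scalel (lunitK W).2.
Qed.

Lemma twist_theta i : twist (X i) = theta (X i) *: idm (X i).
Proof. exact: scalar_ofP. Qed.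

Lemma theta_neq0 i : theta (X i) != 0.
Proof.
apply/eqP => t0; have [g [gt _]] := twist_iso (X i).
by case: (simpleX i) => + _; apply; rewrite -gt twist_theta t0 scale0r compm0.
Qed.

Lemma idm_tunit_neq0 (Y : C) : simple_obj Y -> idm (Y ⊗ tunit) != 0.
Proof.
case=> Y0 _; apply/eqP => E; apply: Y0.
by rewrite -(runitK Y).2 -[runit Y]compm1 E compm0 comp0m.
Qed.

Lemma tens_iso (A A' B B' : C) : A ≅ A' -> B ≅ B' -> A ⊗ B ≅ A' ⊗ B'.
Proof.
case=> f [f' [ff ff']] [g [g' [gg gg']]].
by exists (f ⊠ g), (f' ⊠ g'); split; rewrite -tensm_comp ?ff ?ff' ?gg ?gg' tensm1.
Qed.

Lemma runit_iso (A : C) : A ⊗ tunit ≅ A.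
Proof. by exists (runit A), (runiti A); apply: runitK. Qed.

Lemma hopf_simple i j :
  exists c, forall W, hopf (X i) (dual_fam (X j)) W = c *: idm (X i ⊗ W).
Proof.
have [h hP] := hopf_dual_rw (X i) (X j); have [c hc] := schur ss h (simpleX i).
by exists c => W; rewrite hP hc rw_scale tensm1.
Qed.

Lemma double_braid_theta i j :
  double_braid (X i) (X j) =
  ((theta (X i))^-1 * (theta (X j))^-1) *: twist (X i ⊗ X j).
Proof.
rewrite twist_tens !twist_theta -/(double_braid _ _).
have -> : (theta (X i) *: idm (X i)) ⊠ (theta (X j) *: idm (X j)) =
    (theta (X i) * theta (X j)) *: idm (X i ⊗ X j).
  rewrite -[X in X ⊠ _]compm1 -[X in _ ⊠ X]comp1m tensm_comp.
  by rewrite rw_scale lw_scale tensm1 comp_scalel comp_scaler compm1 scalerA.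
rewrite comp_scaler compm1 scalerA mulrACA mulVf ?theta_neq0 // mul1r.
by rewrite mulVf ?theta_neq0 // scale1r.
Qed.

(** Two adjunctions and the braiding identify End(dual (X i)) with End(X i) up
    to dimension; in a semisimple category an object with one-dimensional
    endomorphism algebra is simple. *)
Lemma dual_rep i : exists j, dual (X i) ≅ X j.
Proof.
have dim1 : \dim {: hom (dual (X i)) (dual (X i))} = 1%N.
  rewrite -(dim_hom_iso _ (runit_iso (dual (X i)))).1.
  rewrite (adjoint_dims (dual_fam (X i))) /=.
  have [g gK] := braid_iso (X i) (dual (X i)).
  have bi : X i ⊗ dual (X i) ≅ dual (X i) ⊗ X i by exists (braid _ _), g.
  rewrite (dim_hom_iso _ bi).2 -(dim_hom_iso _ X0).1 -(dim_hom_sym ss XP).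
  rewrite (dim_hom_iso _ X0).2 (adjoint_dims (dual_fam (X i))).
  by rewrite (dim_hom_iso _ (runit_iso (X i))).2 (dim_hom_reps ss XP) eqxx.
have [m [k [u [p [pu1 pu0 sum1]]]]] := decomposition ss XP (dual (X i)).
have end_scalar (f : hom (dual (X i)) (dual (X i))) :
    exists c, f = c *: idm (dual (X i)).
  have id0 : idm (dual (X i)) != 0.
    apply/eqP => id0; have : (\dim {: hom (dual (X i)) (dual (X i))} == 0)%N.
      rewrite dimv_eq0; apply/eqP/vspaceP => f'.
      by rewrite memvf -(compm1 f') id0 compm0 mem0v.
    by rewrite dim1.
  have : f \in <[idm (dual (X i))]>%VS.
    rewrite (_ : <[_]>%VS = fullv) ?memvf //; apply/eqP.
    by rewrite eqEdim subvf dim_vline id0 dim1.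
  by case/vlineP => c ->; exists c.
case: m => [|m] in k u p pu1 pu0 sum1 *.
  move: sum1; rewrite big_ord0 => id0.
  have : (\dim {: hom (dual (X i)) (dual (X i))} == 0)%N.
    rewrite dimv_eq0; apply/eqP/vspaceP => f'.
    by rewrite memvf -(compm1 f') -id0 compm0 mem0v.
  by rewrite dim1.
exists (k ord0), (p ord0), (u ord0); split; last exact: pu1.
have [c cP] := end_scalar (u ord0 ∘ p ord0).
have c1 : c = 1.
  have : p ord0 ∘ (u ord0 ∘ p ord0) ∘ u ord0 = c *: idm _.
    by rewrite cP comp_scaler compm1 comp_scalel pu1.
  rewrite compmA pu1 comp1m pu1 => /eqP.
  rewrite -[X in X == _]scale1r -subr_eq0 -scalerBl scaler_eq0 subr_eq0.
  by case/orP=> [/eqP|/eqP /(simpleX _).1].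
by rewrite cP c1 scale1r.
Qed.

(** Each identity between numbers is an identity between multiples of some
    nonzero identity morphism, obtained by evaluating one diagram in two
    ways. *)
Lemma modular_datum_exists :
  exists M : modularDatum K n,
    [/\ md_unit M = i0, forall i, md_dim M i = qdim (X i),
        forall i, dual (X i) ≅ X (md_dual M i)
      & forall i j, smatrix X i j =
          md_dim M (md_dual M i) * md_chi M (md_dual M i) j].
Proof.
have /choice[star starP] : forall i, exists j, dual (X i) ≅ X j.
  exact: dual_rep.
have chiP i j : {c | forall W,
    hopf (X i) (dual_fam (X j)) W = c *: idm (X i ⊗ W)}.
  by apply: cid; apply: hopf_simple.
pose chi i j := sval (chiP i j).
have hopfE i j W : hopf (X i) (dual_fam (X j)) W = chi i j *: idm (X i ⊗ W).
  exact: (svalP (chiP i j)).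
pose N i j k : nat := \dim {: hom (X i ⊗ X j) (X k)}.
have dim_star i j k :
    \dim {: hom (dual (X i) ⊗ X j) (X k)} = N (star i) j k.
  by apply: (dim_hom_iso _ (tens_iso (starP i) (isomorphic_refl (X j)))).1.
have thetaS i : theta (X (star i)) = theta (X i).
  apply: (scalar_of_uniq ss (simpleX _)).
  have [u [v uv]] := starP i.
  by apply: (twist_iso_scalar uv); apply: twist_dual_scalar; apply: twist_theta.
have N1 i k : N i i0 k = (i == k).
  rewrite /N (dim_hom_iso _ (tens_iso (isomorphic_refl (X i)) X0)).1.
  by rewrite (dim_hom_iso _ (runit_iso (X i))).1 (dim_hom_reps ss XP).
have frob i j k : N (star i) j k = N i k j.
  rewrite -dim_star (adjoint_dims (dual_fam (X i))).
  by rewrite -(dim_hom_sym ss XP).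
have chiM i j k : chi i j * chi i k = \sum_l (N j k l)%:R * chi i l.
  have [m [l dsP]] := decomposition ss XP (X j ⊗ X k).
  rewrite -(sum_direct_sum ss XP dsP (chi i)).
  have := hopf_tens (dual_fam (X j)) tunit (hopfE i k).
  rewrite (hopf_sum (X i) _ (fun a => dual_fam (X (l a))) tunit dsP) hopfE
    scalerA.
  rewrite (eq_bigr (fun a => chi i (l a) *: idm _)) => [|a _]; last exact:
    hopfE.
  rewrite -scaler_suml => /eqP; rewrite -subr_eq0 -scalerBl scaler_eq0.
  rewrite (negPf (idm_tunit_neq0 (simpleX i))) orbF subr_eq0 mulrC => /eqP <-.
  by [].
have id1 : idm (tunit : C) != 0 by apply/eqP; case: s1.
have dimM i j : qdim (X i) * qdim (X j) = \sum_k (N i j k)%:R * qdim (X k).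
  have [m [l dsP]] := decomposition ss XP (X i ⊗ X j).
  rewrite -(sum_direct_sum ss XP dsP (fun k => qdim (X k))).
  have := loop_tens (dual_fam (X i)) tunit (loop_qdim (X j)).
  have := trace_sum (tens_dual (dual_fam (X i)) (dual_fam (X j)))
    (DS := fun a => dual_fam (X (l a))) (F := idm _) (c := fun=> 1)
    (d := fun a => qdim (X (l a))) (W := tunit) dsP.
  rewrite tensm1 compm1 => ->; first last.
  - by move=> a; apply: loop_qdim.
  - by move=> a f; rewrite comp1m scale1r.
  rewrite loop_qdim scalerA => /eqP; rewrite -subr_eq0 -scalerBl scaler_eq0.
  rewrite (negPf id1) orbF subr_eq0 mulrC => /eqP <-.
  by apply: eq_bigr => a _; rewrite mul1r.
have bal i j : qdim (X i) * chi i j =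
    (theta (X i))^-1 * (theta (X j))^-1 *
      \sum_k (N i j k)%:R * (theta (X k) * qdim (X k)).
  have [m [l dsP]] := decomposition ss XP (X i ⊗ X j).
  rewrite -(sum_direct_sum ss XP dsP (fun k => theta (X k) * qdim (X k))).
  have := hopf_double_braid (dual_fam (X i)) (dual_fam (X j)) tunit.
  rewrite (trace_sum _ (DS := fun a => dual_fam (X (l a)))
    (c := fun a => (theta (X i))^-1 * (theta (X j))^-1 * theta (X (l a)))
    (d := fun a => qdim (X (l a))) dsP); first last.
  - by move=> a; apply: loop_qdim.
  - move=> a f; rewrite double_braid_theta comp_scalel twist_nat twist_theta.
    by rewrite comp_scaler compm1 scalerA.
  rewrite hopfE comp_scaler compm1 comp_scalel loop_qdim scalerA => /eqP.
  rewrite -subr_eq0 -scalerBl scaler_eq0 (negPf id1) orbF subr_eq0 mulrC.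
  by move=> /eqP ->; rewrite mulr_sumr; apply: eq_bigr => a _; rewrite mulrA.
exists (ModularDatum theta_neq0 thetaS N1 frob chiM dimM bal); split=> //= i j.
rewrite mxE bal thetaS; congr (_ * _); apply: eq_bigr => k _.
by rewrite dim_star -mulrA (mulrC (qdim _)).
Qed.

End NumericalData.

(** * Characters of the fusion ring *)

Lemma nat_of_bool_inj : injective (fun b : bool => b : nat).
Proof. by case; case. Qed.

Section FusionCharacters.
Variables (K : numClosedFieldType) (n : nat) (M : modularDatum K n).

Local Notation o := (md_unit M).
Local Notation dd := (md_dual M).
Local Notation N := (md_N M).
Local Notation d := (md_dim M).
Local Notation th := (md_theta M).
Local Notation chi := (md_chi M).

Hypothesis d_gt0 : forall i, 0 < d i.
Hypothesis S_unit : (\matrix_(i, j) (d (dd i) * chi (dd i) j) : 'M[K]_n) \in unitmx.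

(** The unital ring homomorphisms from the fusion ring, given by their values
    on the basis. *)
Definition fusion_char (rho : 'I_n -> K) :=
  rho o = 1 /\ forall j k, rho j * rho k = \sum_l (N j k l)%:R * rho l.

Lemma dim_neq0 i : d i != 0.
Proof. by rewrite gt_eqF. Qed.

(** The functions chi_i are the rows of the invertible S-matrix, up to order
    and nonzero factors. *)
Lemma chi_separate (v : 'I_n -> K) :
  (forall i, \sum_j v j * chi i j = 0) -> forall j, v j = 0.
Proof.
move=> v0 j; pose S : 'M[K]_n := \matrix_(i, j) (d (dd i) * chi (dd i) j).
have Sv : S *m \col_j v j = 0.
  apply/matrixP => i z; rewrite !mxE.
  transitivity (d (dd i) * \sum_j v j * chi (dd i) j); last by rewrite v0 mulr0.
  by rewrite mulr_sumr; apply: eq_bigr => k _; rewrite !mxE -mulrA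
    [chi _ _ * _]mulrC.
have := congr1 (mulmx (invmx S)) Sv; rewrite mulmxA mulVmx // mul1mx mulmx0.
by move/colP/(_ j); rewrite !mxE.
Qed.

(** X_j X_k and X_k X_j have the same image under every chi_i, and these
    separate the elements of the fusion ring. *)
Lemma fusionC j k l : N j k l = N k j l.
Proof.
apply/eqP; rewrite -(eqr_nat K) -subr_eq0; apply/eqP.
apply: (chi_separate (v := fun l => (N j k l)%:R - (N k j l)%:R)) => i.
under eq_bigr do rewrite mulrBl.
by rewrite sumrB -!md_chiM mulrC subrr.
Qed.

Lemma dualK i : dd (dd i) = i.
Proof.
have dual_adj k l : (k == dd l) = (l == dd k).
  apply: nat_of_bool_inj; rewrite -!(md_N1 M) -(md_frobenius M k) fusionC.
  by rewrite md_frobenius.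
by apply/eqP; rewrite eq_sym -dual_adj.
Qed.

Lemma dual_inj : injective dd.
Proof. exact: can_inj dualK. Qed.

Lemma sum_dual (F : 'I_n -> K) : \sum_i F (dd i) = \sum_i F i.
Proof. by rewrite [RHS](reindex_inj dual_inj). Qed.

Lemma fusion_transpose j k l : N k (dd l) j = N l j k.
Proof. by rewrite fusionC md_frobenius. Qed.

Lemma fusion_dual j k l : N (dd j) (dd k) (dd l) = N j k l.
Proof.
by rewrite md_frobenius !fusion_transpose fusionC.
Qed.

Lemma fusion1 i k : N o i k = (i == k).
Proof. by rewrite fusionC md_N1. Qed.

Lemma chi_unit i : chi i o = 1.
Proof.
have chi1 j : chi i j * chi i o = chi i j.
  rewrite md_chiM (bigD1 j) //= md_N1 eqxx mul1r big1 ?addr0 // => k kj.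
  by rewrite md_N1 eq_sym (negPf kj) mul0r.
have [/existsP[j chij]|/existsPn chi0] := boolP [exists j, chi i j != 0].
  by apply: (mulfI chij); rewrite chi1 mulr1.
have : row (dd i) (\matrix_(i, j) (d (dd i) * chi (dd i) j) : 'M[K]_n) = 0.
  by apply/rowP => j; rewrite !mxE dualK; have /negPn/eqP -> := chi0 j; rewrite
    mulr0.
rewrite rowE =>
  /(congr1 (mulmx^~ (invmx (\matrix_(i, j) (d (dd i) * chi (dd i) j))))).
rewrite mulmxK // mul0mx => /rowP/(_ (dd i)); rewrite !mxE !eqxx => /eqP.
by rewrite oner_eq0.
Qed.

Lemma chi_char i : fusion_char (chi i).
Proof. by split; [exact: chi_unit | exact: md_chiM]. Qed.

Lemma dim_unit : d o = 1.
Proof.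
apply: (mulfI (dim_neq0 o)); rewrite md_dimM mulr1 (bigD1 o) //= md_N1 eqxx.
by rewrite mul1r big1 ?addr0 // => k ko; rewrite md_N1 eq_sym (negPf ko) mul0r.
Qed.

Lemma dim_char : fusion_char d.
Proof. by split; [exact: dim_unit | exact: md_dimM]. Qed.

(** The sum of rho(X_j) X_(dual j) is an eigenvector for multiplication by
    every X_k, with eigenvalue rho(X_k).  Applying phi gives
    (rho(X_k) - phi(X_k)) c = 0 for all k, where c is the pairing of rho and
    phi. *)
Lemma char_orthogonal rho phi : fusion_char rho -> fusion_char phi ->
  rho <> phi -> \sum_j rho j * phi (dd j) = 0.
Proof.
move=> [_ rhoM] [_ phiM] rho_phi.
have E k : phi k * (\sum_j rho j * phi (dd j)) = rho k *
  (\sum_j rho j * phi (dd j)).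
  transitivity (\sum_j \sum_l (N l j k)%:R * (rho j * phi l)).
    rewrite mulr_sumr; apply: eq_bigr => j _; rewrite mulrCA phiM mulr_sumr.
    by apply: eq_bigr => l _; rewrite fusion_transpose fusionC mulrCA.
  rewrite exchange_big /= -(sum_dual (fun j => rho j * phi (dd j))) mulr_sumr.
  apply: eq_bigr => l _; rewrite dualK mulrA rhoM mulr_suml.
  by apply: eq_bigr => j _; rewrite fusion_transpose mulrA.
apply/eqP; apply: contra_notT rho_phi => c0.
by apply: funext => k; apply: (mulIf c0); rewrite E.
Qed.

Lemma conj_dual_char rho : fusion_char rho ->
  fusion_char (fun j => (rho (dd j))^*).
Proof.
have dual_o : dd o = o.
  by apply/eqP; apply: nat_of_bool_inj; rewrite -(md_N1 M (dd o) o) md_frobenius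
    fusion1 eqxx.
move=> [rho1 rhoM]; split=> [|j k]; first by rewrite dual_o rho1 rmorph1.
rewrite -rmorphM rhoM rmorph_sum /= -[LHS]sum_dual.
by apply: eq_bigr => l _; rewrite fusion_dual rmorphM rmorph_nat.
Qed.

(** Conjugating the values of rho at dual objects gives a character whose
    pairing with rho is a sum of squares of moduli, hence nonzero; so it is
    rho. *)
Lemma conj_char rho : fusion_char rho -> forall j, (rho j)^* = rho (dd j).
Proof.
move=> rhoP j; pose rho' j := (rho (dd j))^*.
have [E|/(char_orthogonal rhoP (conj_dual_char rhoP))] := EM (rho = rho').
  by rewrite {1}E /rho' conjCK.
move=> /eqP; rewrite psumr_eq0 => [|i _]; last by rewrite dualK mul_conjC_ge0.
move/allP/(_ o (mem_index_enum _)); rewrite dualK rhoP.1 rmorph1 mul1r.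
by rewrite oner_eq0.
Qed.

Lemma char_norm_neq0 rho : fusion_char rho -> \sum_j rho j * rho (dd j) != 0.
Proof.
move=> rhoP; apply/negP; rewrite psumr_eq0 => [|i _]; last first.
  by rewrite -conj_char // mul_conjC_ge0.
move/allP/(_ o (mem_index_enum _)); rewrite -conj_char // rhoP.1 rmorph1 mul1r.
by rewrite oner_eq0.
Qed.

(** A further character would be orthogonal to all chi_i, which separate. *)
Lemma char_is_chi rho : fusion_char rho -> exists i, rho = chi i.
Proof.
move=> rhoP; apply: contrapT => /forallNP rho_chi.
have rho0 : forall j, rho (dd j) = 0.
  apply: chi_separate => i; under eq_bigr do rewrite mulrC.
  by apply: char_orthogonal => //; [exact: chi_char | move/esym/rho_chi].
by have := rho0 (dd o); rewrite dualK rhoP.1 => /eqP; rewrite oner_eq0.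
Qed.

Lemma chi_inj i k : chi i = chi k -> i = k.
Proof.
move=> E; pose S : 'M[K]_n := \matrix_(i, j) (d (dd i) * chi (dd i) j).
have : d k *: row (dd i) S - d i *: row (dd k) S = 0.
  by apply/rowP => j; rewrite !mxE !dualK E mulrCA subrr.
rewrite !rowE !scalemxAl -mulmxBl => /(congr1 (mulmx^~ (invmx S))).
rewrite mulmxK // mul0mx => /rowP/(_ (dd i)); rewrite !mxE !eqxx mulr1.
case: (dd i =P dd k) => [/dual_inj //|_] /=; rewrite mulr0 subr0 => /eqP.
by rewrite (negPf (dim_neq0 k)).
Qed.

Lemma chi_orthogonal i k : i != k -> \sum_j chi i j * chi k (dd j) = 0.
Proof.
move=> ik; apply: char_orthogonal; try exact: chi_char.
by move/chi_inj/eqP; apply/negP.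
Qed.

Lemma dim_dual i : d (dd i) = d i.
Proof. by rewrite -conj_char ?conj_Creal ?gtr0_real //; apply: dim_char. Qed.

Lemma theta_unit : th o = 1.
Proof.
have := md_balancing M o o; rewrite chi_unit dim_unit (bigD1 o) //= md_N1 eqxx.
rewrite dim_unit big1 => [|k ko]; last by rewrite md_N1 eq_sym (negPf ko) mul0r.
rewrite addr0 !mulr1 mul1r mulfVK ?md_theta_neq0 // => /(congr1 GRing.inv).
by rewrite invrK invr1.
Qed.

Lemma chi_unit_row j : chi o j = d j.
Proof.
have := md_balancing M o j; rewrite dim_unit mul1r theta_unit invr1 mul1r => ->.
rewrite (bigD1 j) //= fusion1 eqxx big1 => [|k kj].
  by rewrite addr0 mul1r mulKf ?md_theta_neq0.
by rewrite fusion1 eq_sym (negPf kj) mul0r.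
Qed.

Lemma chi_sym i j : d i * chi i j = d j * chi j i.
Proof.
rewrite !md_balancing (mulrC (th i)^-1); congr (_ * _).
by apply: eq_bigr => k _; rewrite fusionC.
Qed.

Lemma conj_chi i j : (chi i j)^* = chi i (dd j).
Proof. by apply: conj_char; apply: chi_char. Qed.

Lemma conj_dim i : (d i)^* = d i.
Proof. by rewrite conj_Creal // gtr0_real. Qed.

Lemma chi_dual i j : chi (dd i) j = chi i (dd j).
Proof.
apply: (mulfI (dim_neq0 i)); rewrite -[in LHS](dim_dual i) chi_sym -!conj_chi.
by rewrite -(conj_dim i) -(conj_dim j) -!rmorphM chi_sym.
Qed.

Definition gdim := \sum_j d j ^+ 2.

Lemma gdim_gt0 : 0 < gdim.
Proof.
rewrite /gdim (bigD1 o) //= dim_unit expr1n ltr_wpDr ?ltr01 //.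
by apply: sumr_ge0 => i _; rewrite exprn_ge0 // ltW.
Qed.

Definition chi_norm i := \sum_j chi i j * chi i (dd j).

(** By orthogonality the product of S and its conjugate is a diagonal matrix.
    Since S is symmetric, bracketing the product of S, conj S and S in two ways
    shows that this diagonal takes equal values at i and at the unit, as the
    entry of S at the unit and i is the nonzero number d_i. *)
Lemma dim2_norm i : d i ^+ 2 * chi_norm i = gdim.
Proof.
pose s a b := d a * chi a b.
have ssym a b : s a b = s b a by apply: chi_sym.
have sdual a b : s (dd a) b = s a (dd b) by rewrite /s dim_dual chi_dual.
have orth a b : \sum_j s a j * s b (dd j) = (a == b)%:R *
  (d a ^+ 2 * chi_norm a).
  have [<-|ab] := eqVneq a b.
    by rewrite mul1r mulr_sumr; apply: eq_bigr => j _; rewrite mulrACA -expr2.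
  rewrite mul0r; transitivity (d a * d b * \sum_j chi a j * chi b (dd j)).
    by rewrite mulr_sumr; apply: eq_bigr => j _; rewrite mulrACA.
  by rewrite chi_orthogonal ?mulr0.
have E : \sum_j \sum_k s o j * s j (dd k) * s k i =
         \sum_k \sum_j s o j * s j (dd k) * s k i by rewrite exchange_big.
have L j : \sum_k s o j * s j (dd k) * s k i =
     s o j * ((j == i)%:R * (d j ^+ 2 * chi_norm j)).
  rewrite -orth mulr_sumr -[LHS]sum_dual.
  by apply: eq_bigr => k _; rewrite dualK -mulrA (ssym _ i).
have Rr k : \sum_j s o j * s j (dd k) * s k i =
     (o == k)%:R * (d o ^+ 2 * chi_norm o) * s k i.
  rewrite -orth mulr_suml; apply: eq_bigr => j _.
  by rewrite (ssym j) sdual.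
rewrite (eq_bigr _ (fun j _ => L j)) (eq_bigr _ (fun k _ => Rr k)) in E.
rewrite (bigD1 i) //= big1 in E; last by move=> j /negPf->; rewrite mul0r mulr0.
rewrite (bigD1 o) //= big1 in E; last first.
  by move=> j; rewrite eq_sym => /negPf->; rewrite !mul0r.
rewrite !eqxx !mul1r !addr0 mulrC in E.
have s0 : s o i != 0 by rewrite /s dim_unit mul1r chi_unit_row dim_neq0.
rewrite (mulIf s0 E) dim_unit expr1n mul1r; apply: eq_bigr => j _.
by rewrite !chi_unit_row dim_dual expr2.
Qed.

(** S T d is a multiple of T^-1 d, where d is the vector of dimensions: expand
    by balancing and use that d is a character. *)
Lemma gauss_sum m :
  \sum_j th j * d j * chi m j = (\sum_j th j * d j ^+ 2) / th m.
Proof.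
apply: (mulfI (dim_neq0 m)); rewrite mulr_sumr.
transitivity (\sum_j \sum_k (th k * d k / th m) * ((N (dd m) k j)%:R * d j)).
  apply: eq_bigr => j _; rewrite mulrCA md_balancing mulr_sumr mulr_sumr.
  apply: eq_bigr => k _; rewrite md_frobenius.
  have := md_theta_neq0 M j; move: (th j) (th m)^-1 => x y x0.
  by field.
rewrite exchange_big /= mulr_suml mulr_sumr; apply: eq_bigr => k _.
rewrite -mulr_sumr -md_dimM dim_dual.
by rewrite expr2; move: (th m)^-1 => y; ring.
Qed.

(** The previous identity with S moved to the other side; the constant is
    nonzero because the global dimension is. *)
Lemma gauss_sum_inv : exists q, forall l,
  \sum_m chi l m * d m / th m = q * th l.
Proof.
pose p := \sum_j th j * d j ^+ 2.
have E l : p * (\sum_m chi l m * d m / th m) = gdim * th l.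
  rewrite -sum_dual mulr_sumr.
  transitivity (\sum_m \sum_j (th j * d j ^+ 2) * (chi j m * chi l (dd m))).
    apply: eq_bigr => m _; rewrite dim_dual md_theta_dual.
    transitivity (chi l (dd m) * d m * (p / th m)); first by ring.
    rewrite -gauss_sum mulr_sumr; apply: eq_bigr => j _.
    transitivity (chi l (dd m) * th j * d j * (d m * chi m j)); first by ring.
    by rewrite chi_sym; ring.
  rewrite exchange_big /= (bigD1 l) //= [X in _ + X]big1 => [|j jl].
    by rewrite addr0 -mulr_sumr -(dim2_norm l) /chi_norm; ring.
  by rewrite -mulr_sumr chi_orthogonal ?mulr0.
have p0 : p != 0.
  apply/eqP => p0; have /eqP := E o; rewrite p0 mul0r eq_sym mulf_eq0.
  by rewrite (negPf (md_theta_neq0 _ _)) orbF gt_eqF ?gdim_gt0.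
exists (gdim / p) => l; apply: (mulfI p0); rewrite E.
by field.
Qed.

(** With s_ij = d_i chi_i(j) this says S T^-1 S = q T S T.  Products of columns
    of S are expanded by the fusion rules, and the remaining sums are those of
    [gauss_sum_inv]. *)
Lemma twist_sum : exists q, forall i k,
  d k * (\sum_j chi i j * chi k j / th j) = q * th i * th k * chi i k.
Proof.
have [q qP] := gauss_sum_inv; exists q => i k; apply: (mulfI (dim_neq0 i)).
transitivity (\sum_m (N i k m)%:R * d m * (\sum_j chi m j * d j / th j)).
  under [RHS]eq_bigr do rewrite mulr_sumr.
  rewrite exchange_big /= mulrA mulr_sumr; apply: eq_bigr => j _.
  transitivity ((d i * chi i j) * (d k * chi k j) / th j); first by ring.
  rewrite !(chi_sym _ j).
  transitivity (d j ^+ 2 / th j * (chi j i * chi j k)); first by ring.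
  rewrite md_chiM mulr_sumr; apply: eq_bigr => m _.
  transitivity ((N i k m)%:R * d j / th j * (d j * chi j m)); first by ring.
  by rewrite chi_sym; ring.
transitivity (q * \sum_m (N i k m)%:R * (th m * d m)).
  by rewrite mulr_sumr; apply: eq_bigr => m _; rewrite qP; ring.
have := md_balancing M i k.
move/(congr1 (fun x => q * th i * th k * x)).
have := md_theta_neq0 M i; have := md_theta_neq0 M k.
move: (th i) (th k) (\sum_m _) => x y z y0 x0 E.
have -> : d i * (q * x * y * chi i k) = q * x * y * (d i * chi i k) by ring.
by rewrite E; field; rewrite x0 y0.
Qed.

End FusionCharacters.

(** * Galois theory of the field generated by the characters *)

Section PrimitiveElement.
Variable K : numClosedFieldType.
Implicit Types (z x : K) (p f : {poly rat}).

Local Notation "p ^Q" := (map_poly (ratr : rat -> K) p)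
  (at level 2, format "p ^Q").

(** Membership of x in the field generated by z over the rationals, when z is
    algebraic. *)
Definition rational_in z x := exists f, x = f^Q.[z].

Lemma alg_min_poly z : algebraicOver (ratr : rat -> K) z ->
  {p | root p^Q z & irreducible_poly p}.
Proof.
move=> /integral_algebraic zI.
have dec : decidable_embedding (ratr : rat -> K).
  by move=> y; have [?|?] := pselect (exists x : rat, y = ratr x); [left|right].
by have [p [_ pz ip]] := minPoly_decidable_closure dec zI; exists p.
Qed.

Lemma irreducible_coprime p f : irreducible_poly p -> ~~ (p %| f) -> coprimep p f.
Proof.
move=> [p_gt1 ip] pf; rewrite /coprimep; apply: contraNT pf => g1.
by rewrite -(eqp_dvdl _ (ip _ g1 (dvdp_gcdl p f))) dvdp_gcdr.
Qed.

Lemma dvdp_root p f z : p %| f -> root p^Q z -> f^Q.[z] = 0.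
Proof.
by case/dvdpP=> q ->; rewrite rmorphM hornerM => /rootP ->; rewrite mulr0.
Qed.

Lemma min_poly_dvd p f z : irreducible_poly p -> root p^Q z ->
  f^Q.[z] = 0 -> p %| f.
Proof.
move=> ip pz fz; apply: contraT => /(irreducible_coprime ip).
move/Bezout_eq1_coprimepP=> [[u v] /= uv].
have := congr1 (fun g => g^Q.[z]) uv.
rewrite rmorphD !rmorphM !hornerE fz (rootP pz) !mulr0 addr0 rmorph1 hornerC.
by move/eqP; rewrite eq_sym oner_eq0.
Qed.

Lemma rational_in_divring z : algebraicOver (ratr : rat -> K) z ->
  divring_closed [in [set x | rational_in z x]%classic].
Proof.
move=> /alg_min_poly[p pz ip].
split=> [|x y|x y]; rewrite !inE.
- by exists 1; rewrite rmorph1 hornerC.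
- by move=> [f ->] [g ->]; exists (f - g); rewrite rmorphB hornerD hornerN.
- move=> [f ->] [g ->]; have [g0|gn0] := eqVneq g^Q.[z] 0.
    by exists 0; rewrite g0 invr0 mulr0 rmorph0 horner0.
  have /(irreducible_coprime ip)/Bezout_eq1_coprimepP[[u v] /= uv] : ~~
    (p %| g).
    by apply: contra gn0 => pg; rewrite (dvdp_root pg pz).
  exists (f * v); rewrite rmorphM hornerM; congr (_ * _).
  apply: (mulIf gn0); rewrite mulVf //.
  have := congr1 (fun g => g^Q.[z]) uv.
  by rewrite rmorphD !rmorphM !hornerE (rootP pz) mulr0 add0r rmorph1 hornerC.
Qed.

Lemma rational_in_trans z x y : rational_in z x -> rational_in x y ->
  rational_in z y.
Proof.
move=> [f ->] [g ->]; exists (g \Po f).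
by rewrite map_comp_poly horner_comp.
Qed.

(** Besides generating, z must lie in F, so that F coincides with the field
    that z generates when the elements of s generate F. *)
Lemma primitive_element (F : {pred K}) (s : seq K) : divring_closed F ->
  (forall x, x \in s -> x \in F /\ algebraicOver (ratr : rat -> K) x) ->
  exists z, [/\ z \in F, algebraicOver (ratr : rat -> K) z
              & forall x, x \in s -> rational_in z x].
Proof.
move=> hF; have [F1 FB FD] := hF.
have F0 : 0 \in F by rewrite -(subrr 1) FB.
have FN x : x \in F -> - x \in F by move=> ?; rewrite -sub0r FB.
have FA x y : x \in F -> y \in F -> x + y \in F.
  by move=> ? ?; rewrite -[y]opprK FB ?FN.
have FM x n : x \in F -> x *+ n \in F.
  by move=> ?; elim: n => [|n IH]; rewrite ?mulr0n // mulrS FA.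
elim: s => [|x s IH] sF.
  exists 0; split=> //; exists 'X; first by rewrite polyX_eq0.
  by rewrite map_polyX rootX.
have [y yF|z [zF za zs]] := IH; first by apply: sF; rewrite inE yF orbT.
have [xF xa] := sF x (mem_head _ _).
have [p p0 px] := xa; have [q q0 qz] := za.
have [n /= [[f fx] [g gz]]] := pchar0_PET p0 px q0 qz (pchar_num _).
exists (z *+ n - x); split.
- by rewrite FB ?FM.
- apply/integral_algebraic; apply: integral_sub; last exact/integral_algebraic.
  rewrite -mulr_natr; apply: integral_mul; first exact/integral_algebraic.
  exact: integral_nat.
move=> y; rewrite inE => /orP[/eqP -> |/zs]; first by exists f.
by apply: rational_in_trans; exists g.
Qed.

End PrimitiveElement.

Section GaloisOfCharacters.
Variables (K : numClosedFieldType) (n : nat) (M : modularDatum K n).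
Hypothesis d_gt0 : forall i, 0 < md_dim M i.
Hypothesis S_unit : (\matrix_(i, j)
  (md_dim M (md_dual M i) * md_chi M (md_dual M i) j) : 'M[K]_n) \in unitmx.
Variable F : set K.
Hypothesis F_divring : divring_closed [in F].
Local Notation psi i j := (md_chi M (md_dual M i) j).
Hypothesis F_psi : forall i j, F (psi i j).
Hypothesis F_min : forall G : set K, divring_closed [in G] ->
  (forall i j, G (psi i j)) -> (F `<=` G)%classic.

(** psi_i(j) is an eigenvalue of the integral matrix of multiplication by
    X_j. *)
Lemma psi_integral i j : integralOver (intr : int -> K) (psi i j).
Proof.
pose A : 'M[int]_n := \matrix_(l, k) (md_N M j k l)%:R.
exists (char_poly A); first exact: char_poly_monic.
rewrite map_char_poly -eigenvalue_root_char; apply/eigenvalueP.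
exists (\row_k psi i k).
  apply/rowP => k; rewrite !mxE md_chiM; apply: eq_bigr => l _.
  by rewrite !mxE rmorph_nat mulrC.
apply/eqP => /rowP/(_ (md_unit M)); rewrite !mxE chi_unit // => /eqP.
by rewrite oner_eq0.
Qed.

Lemma psi_algebraic i j : algebraicOver (ratr : rat -> K) (psi i j).
Proof.
have [p p1 px] := psi_integral i j.
exists (map_poly intr p); first by rewrite monic_neq0 // monic_map.
rewrite -map_poly_comp; congr (root _ _): px; apply: eq_map_poly => m /=.
by rewrite ratr_int.
Qed.

Lemma psi_inj i k : (forall j, psi i j = psi k j) -> i = k.
Proof.
by move=> E; apply: (dual_inj S_unit); apply: (chi_inj d_gt0 S_unit); apply:
  funext.
Qed.

Lemma field_one : F 1.
Proof. by case: F_divring => /set_mem. Qed.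

Lemma field_sub x y : F x -> F y -> F (x - y).
Proof.
move=> Fx Fy; have [_ FB _] := F_divring.
exact: set_mem (FB x y (mem_set Fx) (mem_set Fy)).
Qed.

Lemma field_div x y : F x -> F y -> F (x / y).
Proof.
move=> Fx Fy; have [_ _ FD] := F_divring.
exact: set_mem (FD x y (mem_set Fx) (mem_set Fy)).
Qed.

Lemma field_zero : F 0.
Proof. by rewrite -(subrr 1); apply: field_sub; apply: field_one. Qed.

Lemma field_opp x : F x -> F (- x).
Proof. by move=> Fx; rewrite -sub0r; apply: field_sub => //; apply: field_zero.
  Qed.

Lemma field_inv x : F x -> F x^-1.
Proof. by move=> Fx; rewrite -[_^-1]mul1r; apply: field_div => //; apply:
  field_one. Qed.

Lemma field_add x y : F x -> F y -> F (x + y).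
Proof. by move=> Fx Fy; rewrite -[y]opprK; apply: field_sub => //; apply:
  field_opp. Qed.

Lemma field_mul x y : F x -> F y -> F (x * y).
Proof. by move=> Fx Fy; rewrite -[y]invrK; apply: field_div => //; apply:
  field_inv. Qed.

Section Embedding.
Variable g : K -> K.
Hypothesis gQ : forall q : rat, g (ratr q) = ratr q.
Hypothesis gD : forall x y, F x -> F y -> g (x + y) = g x + g y.
Hypothesis gM : forall x y, F x -> F y -> g (x * y) = g x * g y.

Lemma embed_nat m : g m%:R = m%:R.
Proof. by rewrite -(ratr_nat K m) gQ. Qed.

Lemma embed_0 : g 0 = 0.
Proof. by have := embed_nat 0%N; rewrite mulr0n. Qed.

Lemma embed_1 : g 1 = 1.
Proof. exact: embed_nat 1%N. Qed.

Lemma embed_sub x y : F x -> F y -> g (x - y) = g x - g y.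
Proof.
move=> Fx Fy; have Fy' := field_opp Fy; rewrite gD //; congr (_ + _).
by apply/eqP; rewrite -addr_eq0 -gD // addNr embed_0.
Qed.

Lemma embed_div x y : F x -> F y -> g (x / y) = g x / g y.
Proof.
move=> Fx Fy; have Fy' := field_inv Fy; rewrite gM //; congr (_ * _).
have [->|y0] := eqVneq y 0; first by rewrite invr0 embed_0 invr0.
have gy : g y^-1 * g y = 1 by rewrite -gM // mulVf // embed_1.
have gy0 : g y != 0 by apply: contra_eq_neq gy => ->; rewrite mulr0 eq_sym
  oner_eq0.
by apply: (mulIf gy0); rewrite gy mulVf.
Qed.

Lemma embed_inj x y : F x -> F y -> g x = g y -> x = y.
Proof.
move=> Fx Fy gxy; apply/eqP; rewrite -subr_eq0; apply/negPn/negP => xy0.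
have Fxy := field_sub Fx Fy.
have : g ((x - y) / (x - y)) = 0 by rewrite embed_div // embed_sub // gxy subrr
  mul0r.
by rewrite divff // embed_1 => /eqP; rewrite oner_eq0.
Qed.

Lemma embed_sum (f : 'I_n -> K) : (forall i, F (f i)) ->
  F (\sum_i f i) /\ g (\sum_i f i) = \sum_i g (f i).
Proof.
move=> Ff; elim/big_rec2: _ => [|i y1 y2 _ [Fy gy]]; first by split;
  [exact: field_zero | exact: embed_0].
by split; [apply: field_add | rewrite gD // gy].
Qed.

(** The structure constants are integers, so g maps characters to
    characters. *)
Lemma embedding_perm : exists s : 'S_n, forall i j, g (psi i j) = psi (s i) j.
Proof.
have F_nat m : F m%:R.
  elim: m => [|m IH]; first exact: field_zero.
  by rewrite -addn1 natrD; apply: field_add => //; apply: field_one.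
have g_char i : fusion_char M (fun j => g (psi i j)).
  split=> [|j k]; first by rewrite chi_unit // embed_1.
  rewrite -gM // md_chiM (embed_sum _).2 => [|l]; last exact: field_mul.
  by apply: eq_bigr => l _; rewrite gM // embed_nat.
have /choice[s sP] : forall i, exists k, forall j, g (psi i j) = psi k j.
  move=> i; have [k E] := char_is_chi S_unit (g_char i).
  exists (md_dual M k) => j; rewrite (dualK S_unit).
  exact: (congr1 (fun f => f j) E).
have s_inj : injective s.
  move=> i k sik; apply: psi_inj => j.
  by apply: embed_inj => //; rewrite !sP sik.
by exists (perm s_inj) => i j; rewrite permE.
Qed.

(** Both the elements of F mapped into F and the image of F form fields that
    contain the psi_i(j), by [embedding_perm]. *)
Lemma embedding_galois : galois_aut F g.
Proof.
have [s sP] := embedding_perm.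
have gF x : F x -> F (g x).
  pose G := [set y | F y /\ F (g y)]%classic.
  have sub : (F `<=` G)%classic.
    apply: F_min => [|i j]; last by split; rewrite ?sP.
    split=> [|x1 y|x1 y]; rewrite !inE => //.
    - by split; rewrite ?embed_1; apply: field_one.
    - by move=> [Fx gx] [Fy gy]; split; rewrite ?embed_sub //; apply: field_sub.
    - by move=> [Fx gx] [Fy gy]; split; rewrite ?embed_div //; apply: field_div.
  by case/sub.
split=> //; split=> //; first by move=> x y /set_mem ? /set_mem ?; apply: embed_inj.
apply: F_min => [|i j].
  split=> [|x y|x y]; rewrite !inE /=.
  - by exists 1; [apply: field_one | apply: embed_1].
  - by move=> [u Fu <-] [v Fv <-]; exists (u - v);
      [apply: field_sub | rewrite embed_sub].
  - by move=> [u Fu <-] [v Fv <-]; exists (u / v);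
      [apply: field_div | rewrite embed_div].
by exists (psi (s^-1 i)%g j) => //; rewrite sP permKV.
Qed.

End Embedding.

Lemma field_ratr q : F (ratr q).
Proof.
pose Fp : {pred K} := [in F].
pose FpP := GRing.isDivringClosed.Build K Fp F_divring.
pose Fs : divringClosed K := HB.pack Fp FpP.
exact: set_mem (rpred_rat Fs q).
Qed.

Lemma field_horner z (f : {poly rat}) : F z -> F (map_poly ratr f).[z].
Proof.
move=> Fz.
pose Fp : {pred K} := [in F].
pose FpP := GRing.isDivringClosed.Build K Fp F_divring.
pose Fs : divringClosed K := HB.pack Fp FpP.
apply: set_mem; apply: (@rpred_horner K Fs); last exact: mem_set.
by apply/polyOverP => i; rewrite coef_map /=; apply: mem_set; apply: field_ratr.
Qed.

(** Write x = f(z) with z primitive and f of smaller degree than the minimal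
    polynomial p of z.  Every root b of p gives an automorphism of F that maps
    z to b, and x to f(b).  So f - x vanishes at all roots of p, which are
    distinct, and f is constant. *)
Lemma fixed_rational x : F x ->
  (forall g, galois_aut F g -> g x = x) -> exists q : rat, x = ratr q.
Proof.
move=> Fx fix_x.
pose s := [seq psi t.1 t.2 | t <- enum {: 'I_n * 'I_n}].
have [|z [zF za zs]] := @primitive_element K [in F] s F_divring.
  move=> _ /mapP[t _ ->]; split; first exact: mem_set.
  exact: psi_algebraic.
move/set_mem in zF.
have Fz y : F y <-> rational_in z y.
  split=> [|[f ->]]; last exact: field_horner.
  apply: (F_min (rational_in_divring za)) => i j.
  by apply: zs; apply/mapP; exists (i, j); rewrite ?mem_enum.
have [p pz ip] := alg_min_poly za.
have gext b : root (map_poly ratr p) b -> exists2 g, galois_aut F g &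
    forall f : {poly rat}, g (map_poly ratr f).[z] = (map_poly ratr f).[b].
  move=> pb.
  pose g y := xget 0 [set w | exists f : {poly rat},
    y = (map_poly ratr f).[z] /\ w = (map_poly ratr f).[b]]%classic.
  have gE f : g (map_poly ratr f).[z] = (map_poly ratr f).[b].
    rewrite /g; case: xgetP => [w _ [f' [fz ->]]|/(_ (map_poly ratr f).[b])];
      last first.
      by case; exists f.
    apply/eqP; rewrite -subr_eq0 -hornerN -hornerD -rmorphB.
    have pf : p %| f' - f.
      by apply: (min_poly_dvd ip pz); rewrite rmorphB hornerD hornerN fz subrr.
    by rewrite (dvdp_root pf pb).
  exists g; last exact: gE.
  have gQ q : g (ratr q) = ratr q.
    by have := gE q%:P; rewrite map_polyC !hornerC.
  have gD y w : F y -> F w -> g (y + w) = g y + g w.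
    move=> /Fz[f1 ->] /Fz[f2 ->].
    by rewrite -hornerD -rmorphD !gE rmorphD hornerD.
  have gM y w : F y -> F w -> g (y * w) = g y * g w.
    move=> /Fz[f1 ->] /Fz[f2 ->].
    by rewrite -hornerM -rmorphM !gE rmorphM hornerM.
  exact: embedding_galois.
have [f xf] : rational_in z x by apply/Fz.
pose r := f %% p.
have xr b : root (map_poly ratr p) b ->
    (map_poly ratr f).[b] = (map_poly (ratr : rat -> K) r).[b].
  move=> pb; rewrite [in LHS](divp_eq f p) rmorphD rmorphM hornerD hornerM.
  by rewrite (rootP pb) mulr0 add0r.
have p0 : p != 0 by rewrite -size_poly_gt0 (ltn_trans _ ip.1).
have [rs pE] := closed_field_poly_normal (map_poly (ratr : rat -> K) p).
have lp0 : lead_coef (map_poly (ratr : rat -> K) p) != 0.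
  by rewrite lead_coef_eq0 map_poly_eq0.
have p_gt1 := ip.1.
have rs_uniq : uniq rs.
  rewrite -separable_prod_XsubC -(eqp_separable (eqp_scale _ lp0)) -pE.
  rewrite separable_map unlock; apply: irreducible_coprime => //.
  have p'0 : p^`() != 0.
    apply/eqP => /(congr1 (fun q : {poly rat} => q`_(size p).-2)).
    rewrite coef_deriv coef0 prednK ?ltn_predRL // => /eqP.
    rewrite mulrn_eq0 -lead_coefE lead_coef_eq0 (negPf p0) orbF.
    by move: p_gt1; case: (size p) => [|[|k]].
  by apply/negP => /(dvdp_leq p'0); rewrite leqNgt lt_size_deriv.
have rs_size : size p = (size rs).+1.
  rewrite -(size_map_poly (ratr : {rmorphism rat -> K}) p) /= pE size_scale //.
  by rewrite size_prod_XsubC.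
have rs_root b : b \in rs -> root (map_poly (ratr : rat -> K) p) b.
  by move=> brs; rewrite pE rootZ // root_prod_XsubC.
pose h : {poly K} := map_poly ratr r - x%:P.
have h0 : h = 0.
  apply/eqP; apply: contraT => hn0.
  have h_roots : all (root h) rs.
    apply/allP => b /rs_root pb; apply/rootP.
    have [g gF gE] := gext b pb.
    by rewrite !hornerE -xr // -gE -xf fix_x // subrr.
  have := max_poly_roots hn0 h_roots rs_uniq; rewrite ltnNge -ltnS -rs_size.
  move=> /negP; case; apply: leq_ltn_trans (size_polyD _ _) _.
  rewrite gtn_max size_polyN size_map_poly ltn_modp p0.
  by rewrite (leq_ltn_trans (size_polyC_leq1 _)).
exists r`_0; have /(congr1 (fun q : {poly K} => q`_0)) := h0.
by rewrite coefB coefC coef_map coef0 /= => /eqP; rewrite subr_eq0 => /eqP.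
Qed.

End GaloisOfCharacters.

(** * Rational algebraic integers *)

Section Rationals.
Variable K : numClosedFieldType.

Lemma rat_sqr_neq2 (q : rat) : q ^+ 2 != 2%:R.
Proof.
apply/eqP => q2; have dq0 := denq_neq0 q.
have : (numq q ^+ 2 = 2%:R * denq q ^+ 2)%R.
  apply: (@intr_inj rat); rewrite rmorphXn rmorphM rmorphXn /=
    [2%:~R](_ : _ = q ^+ 2) ?q2 //.
  by rewrite -q2 -{2}(divq_num_den q) expr_div_n divfK // expf_neq0 // intr_eq0.
move=> /(congr1 absz); rewrite abszM !abszX /= => E.
have n0 : (0 < `|denq q|)%N by rewrite absz_gt0.
have := congr1 (logn 2) E; rewrite lognM ?expn_gt0 ?n0 // !lognX
  (logn_prime 2 (isT : prime 2)) eqxx.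
lia.
Qed.

Lemma rational_sqr_neq2 (x : K) q : x = ratr q -> x ^+ 2 != 2%:R.
Proof.
move=> ->; rewrite -rmorphXn /= -(ratr_nat K 2).
by rewrite (inj_eq (fmorph_inj _)) rat_sqr_neq2.
Qed.

(** Gauss's lemma: if 'X - q divides a monic integral polynomial, then it is a
    rational multiple of an integral factor, whose leading coefficient is a
    unit. *)
Lemma rational_integral (x : K) q : x = ratr q -> integralOver (intr : int -> K) x ->
  exists m : int, x = m%:~R.
Proof.
move=> xq [p p1 px].
have pq : root (map_poly (intr : int -> rat) p) q.
  rewrite -(fmorph_root (ratr : {rmorphism rat -> K})) /= -xq -map_poly_comp.
  by congr (root _ _): px; apply: eq_map_poly => m /=; rewrite ratr_int.
have /dvdpP_rat_int[p' [a a0 Xq] [r pr]] : 'X - q%:P %| map_poly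
  (intr : int -> rat) p.
  by rewrite dvdp_XsubCl.
have lc1 : lead_coef p' * lead_coef r = 1 by rewrite -lead_coefM -pr
  (monicP p1).
have a_lc : a * (lead_coef p')%:~R = 1.
  rewrite -(lead_coef_map_inj (f := intr : int -> rat)) //; last exact:
    intr_inj.
  by rewrite -lead_coefZ -Xq lead_coefXsubC.
have a_int : a = (lead_coef r)%:~R.
  have := congr1 (fun c => c * (lead_coef r)%:~R) a_lc.
  by rewrite mul1r -mulrA -intrM lc1 mulr1.
exists (- (lead_coef r * p'`_0)); rewrite xq.
have := congr1 (fun u : {poly rat} => u`_0) Xq.
rewrite coefB coefX coefC /= sub0r coefZ coef_map /= a_int -intrM => /eqP.
by rewrite eqr_oppLR -mulrNz => /eqP ->; rewrite ratr_int.
Qed.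

End Rationals.

(** * Case analysis on the matrix of characters *)

Section CaseAnalysis.
Variable K : numClosedFieldType.

Lemma sqr_eq1 (x : K) : x ^+ 2 = 1 -> x = 1 \/ x = -1.
Proof. by move/eqP; rewrite sqrf_eq1 => /orP[] /eqP; [left|right]. Qed.

Lemma pos_int_ge1 (x : K) (m : int) : x = m%:~R -> 0 < x -> 1 <= x.
Proof. by move=> ->; rewrite ltr0z -[1]/(1%:~R) ler_int; lia. Qed.

Lemma two_neq0 : 2%:R != 0 :> K.
Proof. by rewrite pnatr_eq0. Qed.

(** The table of characters when an automorphism exchanges the unit with the
    label a, on the labels 0, a, b, u, v with v dual to u:
<<
      psi_0 = (1, d1, d2, d3, d3)    psi_u = (1, w1, w2, z, zb)
      psi_a = (1, e,  y2, y3, y3)    psi_v = (1, w1, w2, zb, z)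
      psi_b = (1, m,  k,  l,  l)
>>
    The hypotheses [symNN] and [orthNN] are symmetry and orthogonality, the
    [galN] come from the automorphism, and the [twNN] are entries of the
    relation between S and T, with f1, f2, f3 the inverse twists of a, b, u. *)
Section SwapUnit.
Variables d1 d2 d3 e y2 y3 m k l w1 w2 z zb : K.
Hypotheses (d1_gt0 : 0 < d1) (d2_gt0 : 0 < d2) (d3_gt0 : 0 < d3).
Hypotheses (sym12 : d1 * y2 = d2 * m) (sym13 : d1 * y3 = d3 * w1)
  (sym23 : d2 * l = d3 * w2).
Hypotheses (orth01 : 1 + d1 * e + d2 * y2 + 2%:R * d3 * y3 = 0)
  (orth02 : 1 + d1 * m + d2 * k + 2%:R * d3 * l = 0)
  (orth03 : 1 + d1 * w1 + d2 * w2 + d3 * (z + zb) = 0)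
  (orth12 : 1 + e * m + y2 * k + 2%:R * y3 * l = 0)
  (orth34 : 1 + w1 ^+ 2 + w2 ^+ 2 + z ^+ 2 + zb ^+ 2 = 0).
Hypotheses (gal1 : d1 ^+ 2 * e ^+ 2 = 1) (gal2 : d1 ^+ 2 * y2 ^+ 2 = d2 ^+ 2)
  (gal3 : d1 ^+ 2 * y3 ^+ 2 = d3 ^+ 2).
Hypotheses (l_rat : exists q, l = ratr q) (w2_rat : exists q, w2 = ratr q)
  (t_rat : exists q, z + zb = ratr q).
Hypotheses (y2_int : exists a : int, d2 * y2 = a%:~R)
  (y3_int : exists a : int, d3 * y3 = a%:~R).
Hypothesis zzb_ge0 : 0 <= z * zb.
Variables q th2 th3 f1 f2 f3 : K.
Hypothesis th3f3 : th3 * f3 = 1.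
Hypotheses
  (tw23 : d3 * (1 + m * w1 * f1 + k * w2 * f2 + l * z * f3 + l * zb * f3)
          = q * th2 * th3 * l)
  (tw03 : d3 * (1 + d1 * w1 * f1 + d2 * w2 * f2 + d3 * z * f3 + d3 * zb * f3)
          = q * th3 * d3)
  (tw33 : d3 * (1 + w1 ^+ 2 * f1 + w2 ^+ 2 * f2 + z ^+ 2 * f3 + zb ^+ 2 * f3)
          = q * th3 * th3 * zb)
  (tw34 : d3 * (1 + w1 ^+ 2 * f1 + w2 ^+ 2 * f2 + z * zb * f3 + zb * z * f3)
          = q * th3 * th3 * z).

Let d1n0 : d1 != 0. Proof. by rewrite gt_eqF. Qed.
Let d2n0 : d2 != 0. Proof. by rewrite gt_eqF. Qed.
Let d3n0 : d3 != 0. Proof. by rewrite gt_eqF. Qed.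

Lemma sign_m : m ^+ 2 = 1.
Proof.
apply: (mulfI (expf_neq0 2 d2n0)).
by rewrite -exprMn -sym12 exprMn gal2 mulr1.
Qed.

Lemma sign_w1 : w1 ^+ 2 = 1.
Proof.
apply: (mulfI (expf_neq0 2 d3n0)).
by rewrite -exprMn -sym13 exprMn gal3 mulr1.
Qed.

Lemma orth01' : d1 + d1 * (d1 * e) + m * d2 ^+ 2 + 2%:R * w1 * d3 ^+ 2 = 0.
Proof.
have -> : d1 + d1 * (d1 * e) + m * d2 ^+ 2 + 2%:R * w1 * d3 ^+ 2 =
    d1 * (1 + d1 * e + d2 * y2 + 2%:R * d3 * y3)
    + d2 * (d2 * m - d1 * y2) + 2%:R * d3 * (d3 * w1 - d1 * y3) by ring.
by rewrite orth01 sym12 sym13 !subrr !mulr0 !addr0.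
Qed.

Lemma orth12' : d1 + (d1 * e) * m + m * k * d2 + 2%:R * w1 * l * d3 = 0.
Proof.
have -> : d1 + (d1 * e) * m + m * k * d2 + 2%:R * w1 * l * d3 =
    d1 * (1 + e * m + y2 * k + 2%:R * y3 * l)
    + k * (d2 * m - d1 * y2) + 2%:R * l * (d3 * w1 - d1 * y3) by ring.
by rewrite orth12 sym12 sym13 !subrr !mulr0 !addr0.
Qed.

Lemma two_eq0_absurd : 2%:R = 0 :> K -> False.
Proof. by move/eqP; apply/negP/two_neq0. Qed.

(** Orthogonality of psi_0 and psi_a gives d2^2 = 2 d3^2, so d2 l = d3 w2 with
    rational l and w2 is possible only for l = 0; then orthogonality of psi_b to
    psi_0 and to psi_a is inconsistent. *)
Lemma case_e_minus : d1 * e = -1 -> False.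
Proof.
move=> e1; have := orth01'; have := orth12'; rewrite e1 => o12 o01.
have l0 : l = 0.
  apply/eqP; apply: contraT => ln0.
  have d23 : d2 ^+ 2 = 2%:R * d3 ^+ 2.
    have E : m * d2 ^+ 2 = - (2%:R * w1 * d3 ^+ 2).
      apply/eqP; rewrite -addr_eq0; apply/eqP; rewrite -[RHS]o01; ring.
    have d2p : 0 < d2 ^+ 2 by rewrite exprn_gt0.
    have d3p : 0 < 2%:R * d3 ^+ 2 by rewrite mulr_gt0 ?exprn_gt0 // ltr0n.
    case: (sqr_eq1 sign_m) (sqr_eq1 sign_w1) => mE [] wE; move: E; rewrite mE wE.
    + rewrite mul1r mulr1 => E; move: d2p; rewrite E oppr_gt0 =>
        /(lt_trans d3p).
      by rewrite ltxx.
    + by rewrite mul1r mulrN1 mulNr opprK.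
    + by rewrite mulN1r mulr1 => /oppr_inj.
    + rewrite mulN1r mulrN1 mulNr opprK => E; move: d3p; rewrite -E oppr_gt0.
      by move/(lt_trans d2p); rewrite ltxx.
  have [[ql lE] [qw wE]] := (l_rat, w2_rat).
  have : (w2 / l) ^+ 2 != 2%:R.
    by apply: (@rational_sqr_neq2 _ _ (qw / ql)); rewrite lE wE fmorph_div.
  move/negP; case; apply/eqP; apply: (mulIf (expf_neq0 2 (mulf_neq0 ln0 d3n0))).
  have -> : (w2 / l) ^+ 2 * (l * d3) ^+ 2 = (d3 * w2) ^+ 2 by field.
  by rewrite -sym23 !exprMn d23; ring.
have o02 := orth02; rewrite l0 mulr0 addr0 in o02.
rewrite l0 mulr0 mul0r addr0 in o12.
apply: two_eq0_absurd.
have -> : 2%:R = (1 + d1 * m + d2 * k) - m * (d1 + -1 * m + m * k * d2)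
  + (d2 * k - 1) * (m ^+ 2 - 1) :> K by ring.
by rewrite o02 o12 sign_m subrr !mulr0 subrr addr0.
Qed.

(** The integers d2 y2 and d3 y3 are the opposites of d2^2 / d1 and d3^2 / d1,
    and orthogonality of psi_0 and psi_a makes A + 2 B = 2 for these two
    positive numbers A and B. *)
Lemma case_minus_minus : d1 * e = 1 -> m = -1 -> w1 = -1 -> False.
Proof.
move=> e1 mE wE; have o01 := orth01'; rewrite e1 mE wE in o01.
have [[a aE] [b bE]] := (y2_int, y3_int).
have aE' : d2 ^+ 2 / d1 = (- a)%:~R.
  rewrite mulrNz -aE; apply: (mulIf d1n0); rewrite divfK //.
  have -> : - (d2 * y2) * d1 = - d2 * (d1 * y2) by ring.
  by rewrite sym12 mE; ring.
have bE' : d3 ^+ 2 / d1 = (- b)%:~R.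
  rewrite mulrNz -bE; apply: (mulIf d1n0); rewrite divfK //.
  have -> : - (d3 * y3) * d1 = - d3 * (d1 * y3) by ring.
  by rewrite sym13 wE; ring.
have a1 := pos_int_ge1 aE' (divr_gt0 (exprn_gt0 2 d2_gt0) d1_gt0).
have b1 := pos_int_ge1 bE' (divr_gt0 (exprn_gt0 2 d3_gt0) d1_gt0).
have E : d2 ^+ 2 / d1 + 2%:R * (d3 ^+ 2 / d1) = 2%:R.
  apply: (mulIf d1n0).
  have -> : (d2 ^+ 2 / d1 + 2%:R * (d3 ^+ 2 / d1)) * d1 = d2 ^+ 2 + 2%:R * d3 ^+
    2.
    by field.
  apply/eqP; rewrite -subr_eq0; apply/eqP; rewrite -[RHS]oppr0 -[in RHS]o01;
    ring.
have := lerD a1 (ler_wpM2l (ler0n K 2) b1); rewrite E mulr1.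
by rewrite gerDr ler10.
Qed.

(** Orthogonality of psi_b to psi_0 and psi_a gives l = w2 = 0.  The vanishing
    entry of S at (b, u) makes the twist of a trivial; the entries of the
    relation between S and T at (0, u), (u, u) and (u, v) then determine the
    twist of u in terms of z and its conjugate, and eliminating it leaves
    t^2 = 2 for the rational number t = z + zb. *)
Lemma case_opposite : d1 * e = 1 -> w1 = - m -> False.
Proof.
move=> e1 wE; have o12 := orth12'; rewrite e1 wE in o12.
have m2 := sign_m.
have l0 : l = 0.
  apply: (mulfI (mulf_neq0 (mulf_neq0 two_neq0 two_neq0) d3n0)); rewrite mulr0.
  have -> : 2%:R * 2%:R * d3 * l = (1 + d1 * m + d2 * k + 2%:R * d3 * l)
    - m * (d1 + 1 * m + m * k * d2 + 2%:R * - m * l * d3)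
    + (1 + d2 * k - 2%:R * d3 * l) * (m ^+ 2 - 1) by ring.
  by rewrite orth02 o12 m2 subrr !mulr0 subrr addr0.
have w20 : w2 = 0.
  by apply: (mulfI d3n0); rewrite -sym23 l0 !mulr0.
have f1E : f1 = 1.
  have := tw23; rewrite l0 w20 !mulr0 !mul0r !addr0 wE => /eqP.
  rewrite mulf_eq0 (negPf d3n0) /= mulrN -expr2 m2 mulN1r subr_eq0 => /eqP.
  by [].
have o34 := orth34; rewrite w20 sign_w1 in o34.
have z2 : z ^+ 2 + zb ^+ 2 = - 2%:R.
  apply/eqP; rewrite -subr_eq0; apply/eqP; rewrite -[RHS]o34; ring.
pose t := z + zb.
have t03 : d3 * t * (f3 - 1) = q * th3.
  apply: (mulfI d3n0); rewrite [RHS]mulrC -tw03 f1E w20.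
  have -> : d3 * (d3 * t * (f3 - 1)) =
    d3 * (1 + d1 * w1 * 1 + d2 * 0 * f2 + d3 * z * f3 + d3 * zb * f3)
    - d3 * (1 + d1 * w1 + d2 * 0 + d3 * (z + zb)) by rewrite /t; ring.
  by have := orth03; rewrite w20 => ->; rewrite !mulr0 subr0.
have t33 : 2%:R * (1 - f3) = t * (f3 - 1) * th3 * zb.
  apply: (mulfI d3n0).
  have -> : d3 * (t * (f3 - 1) * th3 * zb) = (d3 * t * (f3 - 1)) * th3 * zb by
    ring.
  rewrite t03 -tw33 f1E w20 sign_w1.
  have -> : 1 + 1 * 1 + 0 ^+ 2 * f2 + z ^+ 2 * f3 + zb ^+ 2 * f3 =
    2%:R + (z ^+ 2 + zb ^+ 2) * f3 by ring.
  by rewrite z2; ring.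
have t34 : 2%:R * (1 + z * zb * f3) = t * (f3 - 1) * th3 * z.
  apply: (mulfI d3n0).
  have -> : d3 * (t * (f3 - 1) * th3 * z) = (d3 * t * (f3 - 1)) * th3 * z by
    ring.
  by rewrite t03 -tw34 f1E w20 sign_w1; ring.
have f3n1 : f3 - 1 != 0.
  apply/eqP => f31; have f3E : f3 = 1 by apply/eqP; rewrite -subr_eq0 f31.
  move: t34; rewrite f31 f3E mulr0 !mul0r mulr1 => /eqP.
  rewrite mulf_eq0 (negPf two_neq0) /= => /eqP E.
  have : 0 < 1 + z * zb by apply: ltr_wpDr.
  by rewrite E ltxx.
have tth : t * th3 * zb = - 2%:R.
  apply: (mulfI f3n1); rewrite [RHS]mulrC.
  have -> : - 2%:R * (f3 - 1) = 2%:R * (1 - f3) by ring.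
  by rewrite t33; ring.
have f3E : 2%:R * f3 = - (t * zb).
  have -> : 2%:R * f3 = - (t * zb) * (th3 * f3) + (t * th3 * zb + 2%:R) * f3 by
    ring.
  by rewrite tth addNr mul0r addr0 th3f3 mulr1.
have key : (zb - z) * (4%:R - t ^+ 2 * (z * zb)) = 0.
  have E : zb * (2%:R * (1 + z * zb * f3)) = - 2%:R * (f3 - 1) * z.
    by rewrite t34 -tth; ring.
  have -> : (zb - z) * (4%:R - t ^+ 2 * (z * zb)) =
     2%:R * (zb * (2%:R * (1 + z * zb * f3)) - - 2%:R * (f3 - 1) * z)
     - 2%:R * z * (zb ^+ 2 + 1) * (2%:R * f3 - - (t * zb))
     + t * z * zb * (z ^+ 2 + zb ^+ 2 - - 2%:R) by rewrite /t; ring.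
  by rewrite E f3E z2 !subrr !mulr0 subr0 addr0.
move/eqP: key; rewrite mulf_eq0 !subr_eq0 => /orP[/eqP zz|/eqP t4].
  have : 0 <= - 1 :> K.
    rewrite -(pmulr_rge0 _ (ltr0n K 2)) //.
    have -> : 2%:R * -1 = z ^+ 2 + zb ^+ 2 by rewrite z2 mulrN1.
    by have := zzb_ge0; rewrite zz -expr2 => z2_ge0; rewrite addr_ge0.
  by rewrite oppr_ge0 ler10.
have tp : t ^+ 2 - 2%:R * (z * zb) = - 2%:R by rewrite -z2 /t; ring.
have /eqP : (t ^+ 2 + 4%:R) * (t ^+ 2 - 2%:R) = 0.
  have -> : (t ^+ 2 + 4%:R) * (t ^+ 2 - 2%:R) =
    t ^+ 2 * (t ^+ 2 - 2%:R * (z * zb) - - 2%:R) - 2%:R * (4%:R - t ^+ 2 * (z * zb)) by ring.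
  by rewrite tp -t4 !subrr !mulr0 subrr.
rewrite mulf_eq0 subr_eq0 => /orP[|].
  have [qt tE] := t_rat; rewrite /t tE gt_eqF // ltr_wpDl ?ltr0n //.
  by rewrite -rmorphXn /= ler0q sqr_ge0.
by have [qt tE] := t_rat; rewrite /t (negPf (rational_sqr_neq2 tE)).
Qed.

Lemma swap_unit_impossible : False.
Proof.
have /sqr_eq1[e1|] : (d1 * e) ^+ 2 = 1 by rewrite exprMn.
  have [mE|mE] := sqr_eq1 sign_m; have [wE|wE] := sqr_eq1 sign_w1.
  - have := orth01'; rewrite e1 mE wE => /eqP; rewrite gt_eqF //.
    by rewrite !mul1r !mulr1 !addr_gt0 // ?exprn_gt0 // mulr_gt0 ?exprn_gt0 //
      ltr0n.
  - by apply: case_opposite; rewrite ?wE ?mE.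
  - by apply: case_opposite; rewrite ?wE ?mE ?opprK.
  - exact: case_minus_minus.
exact: case_e_minus.
Qed.

End SwapUnit.

(** The left-hand side is an odd integer. *)
Lemma swap_fixing_unit_impossible (x y r : K) :
  1 + 2%:R * (x * y) + 2%:R * r ^+ 2 = 0 ->
  (exists a : int, x * y = a%:~R) -> (exists b : int, r = b%:~R) -> False.
Proof.
move=> E [a aE] [b bE]; move: E; rewrite aE bE.
have -> : 1 + 2%:R * a%:~R + 2%:R * b%:~R ^+ 2 = (1 + 2 * a + 2 * (b * b))%:~R
  :> K.
  by rewrite !intrD !intrM expr2.
by move/eqP; rewrite intr_eq0; lia.
Qed.

End CaseAnalysis.

(** * Rank five *)

Section RankFive.
Variables (K : numClosedFieldType) (M : modularDatum K 5).
Hypothesis d_gt0 : forall i, 0 < md_dim M i.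
Hypothesis S_unit : (\matrix_(i, j)
  (md_dim M (md_dual M i) * md_chi M (md_dual M i) j) : 'M[K]_5) \in unitmx.
Variable F : set K.
Hypothesis F_divring : divring_closed [in F].
Local Notation d := (md_dim M).
Local Notation dd := (md_dual M).
Local Notation th := (md_theta M).
Local Notation psi i j := (md_chi M (dd i) j).
Hypothesis F_psi : forall i j, F (psi i j).
Hypothesis F_min : forall G : set K, divring_closed [in G] ->
  (forall i j, G (psi i j)) -> (F `<=` G)%classic.

Local Notation o := (md_unit M).
Variables a b u v : 'I_5.
Hypotheses (dd_a : dd a = a) (dd_b : dd b = b) (dd_u : dd u = v).
Hypothesis sum5 : forall f : 'I_5 -> K,
  \sum_i f i = f o + f a + f b + f u + f v.
Hypotheses (ab : a != b) (oa : o != a) (ob : o != b) (ou : o != u)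
  (au : a != u) (bu : b != u) (uv : u != v).

Let dK := dualK S_unit.

Lemma dd_v : dd v = u.
Proof. by rewrite -dd_u dK. Qed.

Lemma psi_unit i : psi i o = 1.
Proof. exact: chi_unit. Qed.

Lemma dual_unit : dd o = o.
Proof.
apply: (chi_inj d_gt0 S_unit); apply: funext => j.
by rewrite chi_dual // !chi_unit_row // dim_dual.
Qed.

Lemma psi_dim j : psi o j = d j.
Proof. by rewrite dual_unit chi_unit_row. Qed.

Lemma psi_dual i j : psi (dd i) j = psi i (dd j).
Proof. by rewrite chi_dual. Qed.

Lemma psi_sym i j : d i * psi i j = d j * psi j i.
Proof. by rewrite -(dim_dual d_gt0 S_unit i) chi_sym // [in RHS]chi_dual. Qed.

Lemma psi_orth i k : i != k -> \sum_j psi i j * psi k (dd j) = 0.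
Proof. by move=> ik; apply: chi_orthogonal => //; rewrite
  (inj_eq (dual_inj S_unit)). Qed.

Lemma psi_norm i : d i ^+ 2 * chi_norm M (dd i) = gdim M.
Proof. by rewrite -(dim_dual d_gt0 S_unit i) dim2_norm. Qed.

Lemma dim_v : d v = d u.
Proof. by rewrite -dd_u dim_dual. Qed.

Lemma psi_selfdual i : dd i = i -> psi i v = psi i u.
Proof. by move=> ii; rewrite -dd_u -psi_dual !ii. Qed.

Lemma psi_dual_row j : psi v j = psi u (dd j).
Proof. by rewrite -dd_u psi_dual. Qed.

Lemma norm_F i : F (chi_norm M (dd i)).
Proof.
apply: (embed_sum F_divring (g := id) _ _ _).1 => // j.
exact: (field_mul F_divring).
Qed.

Lemma galois_norm g s : galois_aut F g ->
  (forall i j, g (psi i j) = psi (s i) j) ->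
  forall i, g (chi_norm M (dd i)) = chi_norm M (dd (s i)).
Proof.
move=> [_ gQ gD gM] gs i; rewrite (embed_sum F_divring gQ gD _).2 => [|j].
  by apply: eq_bigr => j _; rewrite gM // !gs.
exact: (field_mul F_divring).
Qed.

Lemma gdimE : gdim M = chi_norm M (dd o).
Proof. by rewrite -(psi_norm o) dim_unit // expr1n mul1r. Qed.

Lemma norm_neq0 i : chi_norm M i != 0.
Proof. exact: char_norm_neq0 (chi_char S_unit i). Qed.

Lemma fixed_int x : F x -> integralOver (intr : int -> K) x ->
  (forall g, galois_aut F g -> g x = x) -> exists m : int, x = m%:~R.
Proof.
move=> Fx xI fx.
have [q xq] := fixed_rational d_gt0 S_unit F_divring F_psi F_min Fx fx.
exact: rational_integral xq xI.
Qed.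

Lemma psiM_integral i j k l : integralOver (intr : int -> K) (psi i j * psi k l).
Proof. by apply: integral_mul; apply: psi_integral. Qed.

Lemma psi_orth5 i k : i != k -> 1 + psi i a * psi k a + psi i b * psi k b
    + psi i u * psi k v + psi i v * psi k u = 0.
Proof.
by move=> /psi_orth; rewrite sum5 dual_unit !psi_unit mulr1 dd_a dd_b dd_u dd_v.
Qed.

Section SwapUnitCase.
Variable g0 : K -> K.
Hypothesis g0_gal : galois_aut F g0.
Hypotheses (g0_o : forall j, g0 (psi o j) = psi a j)
  (g0_a : forall j, g0 (psi a j) = psi o j)
  (g0_b : forall j, g0 (psi b j) = psi b j)
  (g0_u : forall j, g0 (psi u j) = psi u j)
  (g0_v : forall j, g0 (psi v j) = psi v j).
Hypothesis galP : forall g, galois_aut F g ->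
  [/\ forall j, g (psi b j) = psi b j,
      (forall j, g (psi o j) = psi o j /\ g (psi a j) = psi a j) \/
      (forall j, g (psi o j) = psi a j /\ g (psi a j) = psi o j)
    & (forall j, g (psi u j) = psi u j /\ g (psi v j) = psi v j) \/
      (forall j, g (psi u j) = psi v j /\ g (psi v j) = psi u j)].

Let rationalP x := fixed_rational (x := x) d_gt0 S_unit F_divring F_psi F_min.

Lemma swap_norm i : g0 (chi_norm M (dd i)) =
  if i == o then chi_norm M (dd a) else if i == a then chi_norm M (dd o)
  else chi_norm M (dd i).
Proof.
have [s sP] := embedding_perm d_gt0 S_unit F_divring F_psi
  (let: And4 _ q _ _ := g0_gal in q) (let: And4 _ _ q _ := g0_gal in q)
  (let: And4 _ _ _ q := g0_gal in q).
have sE i1 k : (forall j, g0 (psi i1 j) = psi k j) -> s i1 = k.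
  by move=> E; apply: (psi_inj d_gt0 S_unit) => j; rewrite -sP E.
rewrite (galois_norm g0_gal sP).
have [->|io] := eqVneq i o; first by rewrite (sE o a).
have [->|ia] := eqVneq i a; first by rewrite (sE a o).
suff -> : s i = i by [].
have := sum5 (fun k => (k == i)%:R); rewrite (bigD1 i) //= eqxx big1 ?addr0.
  case: (b =P i) => [<-|_]; first by rewrite (sE b b).
  case: (u =P i) => [<-|_]; first by rewrite (sE u u).
  case: (v =P i) => [<-|_]; first by rewrite (sE v v).
  rewrite eq_sym (negPf io) eq_sym (negPf ia) !addr0 => /eqP.
  by rewrite oner_eq0.
by move=> k /negPf ->.
Qed.

(** Applying g0 to d_i^2 |psi_i|^2 = D replaces d_i by psi_a(i) and exchanges
    |psi_0|^2 with |psi_a|^2.  Compared with the original identities this gives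
    d_a^2 psi_a(i)^2 = d_i^2 for the labels i fixed by g0, and
    d_a^2 psi_a(a)^2 = 1. *)
Lemma swap_unit_case : False.
Proof.
have [_ gQ gD gM] := g0_gal.
have gd i : g0 (d i) = psi a i by rewrite -psi_dim g0_o.
have Fd i : F (d i) by rewrite -psi_dim.
have gnorm i : g0 (d i ^+ 2 * chi_norm M (dd i)) = psi a i ^+ 2 * g0
  (chi_norm M (dd i)).
  have Fn := norm_F i.
  rewrite expr2 gM //; last exact: (field_mul F_divring).
  by rewrite gM // gd -expr2.
have norm_a : d a ^+ 2 * g0 (gdim M) = gdim M.
  by rewrite gdimE swap_norm eqxx -gdimE psi_norm.
have gal_a : d a ^+ 2 * psi a a ^+ 2 = 1.
  have g0n : gdim M != 0 by rewrite gdimE norm_neq0.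
  apply: (mulIf g0n); rewrite mul1r -[RHS]norm_a -[in RHS](psi_norm a) gnorm.
  by rewrite swap_norm eq_sym (negPf oa) eqxx -gdimE mulrA.
have gal_fix i : i != o -> i != a -> d a ^+ 2 * psi a i ^+ 2 = d i ^+ 2.
  move=> io ia; apply: (mulIf (norm_neq0 (dd i))).
  rewrite psi_norm -[RHS]norm_a -[in RHS](psi_norm i) gnorm swap_norm.
  by rewrite (negPf io) (negPf ia) mulrA.
have Fu : psi v u = psi u v by rewrite psi_dual_row dd_u.
have va : psi v a = psi u a by rewrite psi_dual_row dd_a.
have vb : psi v b = psi u b by rewrite psi_dual_row dd_b.
have vv : psi v v = psi u u by rewrite psi_dual_row dd_v.
have av := psi_selfdual dd_a; have bv := psi_selfdual dd_b.
have orth := psi_orth5.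
have [q tw] := twist_sum d_gt0 S_unit.
have {}tw i k : d k * (1 + psi i a * psi k a / th a + psi i b * psi k b / th b
    + psi i u * psi k u / th u + psi i v * psi k v / th u) =
    q * th i * th k * psi i (dd k).
  have := tw (dd i) (dd k); rewrite dim_dual // !md_theta_dual sum5 !psi_unit.
  have -> : th v = th u by rewrite -dd_u md_theta_dual.
  by rewrite theta_unit // mulr1 divr1.
have Fpp i j k l : F (psi i j * psi k l) by apply: (field_mul F_divring).
have th3 : th u * (th u)^-1 = 1 by rewrite divff // md_theta_neq0.
apply: (@swap_unit_impossible K (d a) (d b) (d u) (psi a a) (psi a b) (psi a u)
  (psi b a) (psi b b) (psi b u) (psi u a) (psi u b) (psi u u) (psi u v)
  _ _ _ _ _ _ _ _ _ _ _ _ _ _ _ _ _ _ _ _ q (th b) (th u)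
  (th a)^-1 (th b)^-1 (th u)^-1 th3) => //.
- exact: psi_sym.
- exact: psi_sym.
- exact: psi_sym.
- have := orth o a oa; rewrite !psi_dim av dim_v => <-; ring.
- have := orth o b ob; rewrite !psi_dim bv dim_v => <-; ring.
- have := orth o u ou; rewrite !psi_dim dim_v => <-; ring.
- have := orth a b ab; rewrite av bv => <-; ring.
- have := orth u v uv; rewrite Fu va vb vv => <-; ring.
- by apply: gal_fix; rewrite eq_sym.
- by apply: gal_fix; rewrite eq_sym.
- by apply: rationalP => // g /galP[].
- apply: rationalP => // g /galP[_ _ [H|H]]; first exact: (H b).1.
  by rewrite (H b).1 vb.
- apply: rationalP; first exact: (field_add F_divring).
  move=> g gg; have [_ _ gD' _] := gg; rewrite gD' //.
  have [_ _ [H|H]] := galP gg; first by rewrite (H u).1 (H v).1.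
  by rewrite (H u).1 (H v).1 Fu vv addrC.
- rewrite -psi_dim; apply: fixed_int; [exact: Fpp|exact: psiM_integral|].
  move=> g gg; have [_ _ _ gM'] := gg; rewrite gM' //.
  have [_ [H|H] _] := galP gg; first by rewrite (H b).1 (H b).2.
  by rewrite (H b).1 (H b).2 mulrC.
- rewrite -psi_dim; apply: fixed_int; [exact: Fpp|exact: psiM_integral|].
  move=> g gg; have [_ _ _ gM'] := gg; rewrite gM' //.
  have [_ [H|H] _] := galP gg; first by rewrite (H u).1 (H u).2.
  by rewrite (H u).1 (H u).2 mulrC.
- by rewrite -dd_u -conj_chi // mul_conjC_ge0.
- have := tw b u; rewrite dd_u bv => <-; ring.
- have := tw o u; rewrite !psi_dim dd_u theta_unit // mulr1 dim_v => <-; ring.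
- have := tw u u; rewrite dd_u => <-; ring.
- have := tw u v; rewrite Fu va vb vv dim_v dd_v.
  have -> : th v = th u by rewrite -dd_u md_theta_dual.
  by move=> <-; ring.
Qed.

End SwapUnitCase.

Section FixUnitCase.
Variable g0 : K -> K.
Hypothesis g0_gal : galois_aut F g0.
Hypotheses (g0_o : forall j, g0 (psi o j) = psi o j)
  (g0_a : forall j, g0 (psi a j) = psi b j)
  (g0_b : forall j, g0 (psi b j) = psi a j).
Hypothesis galP : forall g, galois_aut F g ->
  [/\ forall j, g (psi o j) = psi o j,
      (forall j, g (psi a j) = psi a j /\ g (psi b j) = psi b j) \/
      (forall j, g (psi a j) = psi b j /\ g (psi b j) = psi a j)
    & (forall j, g (psi u j) = psi u j) \/ (forall j, g (psi u j) = psi v j)].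

(** Here the dimensions are rational.  Comparing |psi_a|^2 = D / d_a^2 with its
    image |psi_b|^2 = D / d_b^2 under g0 gives d_a = d_b, and the symmetry of S
    then makes psi_b the image of psi_a with the values at a and b exchanged. *)
Lemma fix_unit_case : False.
Proof.
have [_ gQ gD gM] := g0_gal.
have Fd i : F (d i) by rewrite -psi_dim.
have gd i : g0 (d i) = d i by rewrite -psi_dim g0_o.
have [s sP] := embedding_perm d_gt0 S_unit F_divring F_psi gQ gD gM.
have sE i k : (forall j, g0 (psi i j) = psi k j) -> s i = k.
  by move=> E; apply: (psi_inj d_gt0 S_unit) => j; rewrite -sP E.
have dab : d a = d b.
  apply/eqP; rewrite -(eqrXn2 (n := 2)) ?ltW //; apply/eqP.
  apply: (mulIf (norm_neq0 (dd b))); rewrite psi_norm -(sE a b g0_a).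
  rewrite -(galois_norm g0_gal sP) -[in LHS](gd a) expr2.
  rewrite -!gM //; try exact: norm_F; last by apply: (field_mul F_divring).
  by rewrite -expr2 psi_norm gdimE (galois_norm g0_gal sP) (sE o o g0_o).
have ba : psi a b = psi b a.
  have da0 : d b != 0 by apply: dim_neq0.
  by apply: (mulfI da0); rewrite -[in LHS]dab psi_sym.
have bb : psi b b = psi a a by rewrite -g0_a ba g0_b.
have rE : psi a u = d u * psi u a / d a.
  by rewrite -psi_sym mulrAC divff ?mul1r //; apply: dim_neq0.
have va : psi v a = psi u a by rewrite psi_dual_row dd_a.
have r_fix g : galois_aut F g -> g (psi a u) = psi a u.
  move=> gg; have [go _ gu] := galP gg; have [_ gQ' gD' gM'] := gg.
  have gd' i : g (d i) = d i by rewrite -psi_dim go.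
  rewrite rE (embed_div F_divring gQ' gM') // ?gM' //; last exact:
    (field_mul F_divring).
  by rewrite !gd'; case: gu => ->; rewrite ?va.
have bu' : psi b u = psi a u by rewrite -g0_a r_fix.
have r_rat := fixed_int (F_psi a u) (psi_integral S_unit a u) r_fix.
apply: (@swap_fixing_unit_impossible K (psi a a) (psi b a) (psi a u)) => //.
  have := psi_orth5 ab.
  by rewrite (psi_selfdual dd_a) (psi_selfdual dd_b) bu' ba bb => <-; ring.
apply: fixed_int; [exact: (field_mul F_divring)|exact: psiM_integral|].
move=> g gg; have [_ _ _ gM'] := gg; rewrite gM' //.
have [_ [H|H] _] := galP gg; first by rewrite (H a).1 (H a).2.
by rewrite (H a).1 (H a).2 mulrC.
Qed.

End FixUnitCase.

End RankFive.

(** * Klein four-groups of permutations of five labels *)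

Section KleinFour.

Local Notation p0 := (inord 0 : 'I_5).
Local Notation p1 := (inord 1 : 'I_5).
Local Notation p2 := (inord 2 : 'I_5).
Local Notation p3 := (inord 3 : 'I_5).
Local Notation p4 := (inord 4 : 'I_5).

Lemma inord5_eq i j : (i < 5)%N -> (j < 5)%N ->
  (inord i == inord j :> 'I_5) = (i == j).
Proof. by move=> i5 j5; rewrite -val_eqE /= !inordK. Qed.

Lemma ord5P (i : 'I_5) : [\/ i = p0, i = p1, i = p2 | i = p3 \/ i = p4].
Proof.
by rewrite -(inord_val i); case: i => [[|[|[|[|[|//]]]]] /= _];
  [constructor 1 | constructor 2 | constructor 3 | constructor 4; left
  | constructor 4; right].
Qed.

Lemma sum_ord5 (V : zmodType) (f : 'I_5 -> V) :
  \sum_i f i = f p0 + f p1 + f p2 + f p3 + f p4.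
Proof.
rewrite !big_ord_recr big_ord0 /= add0r.
by congr (f _ + f _ + f _ + f _ + f _); apply: val_inj; rewrite /= inordK.
Qed.

Local Open Scope group_scope.

Let c := tperm p3 p4.
Let t := tperm p0 p1.

Lemma klein_model :
  [/\ abelian <<[set t; c]>>, #|<<[set t; c]>>| = 4
    & {in <<[set t; c]>>, forall x, x ^+ 2 = 1}].
Proof.
have tc : commute t c.
  apply/commgP/conjg_fixP; rewrite tpermJ !tpermD //; by rewrite inord5_eq.
have genE : <<[set t; c]>> = <[t]> * <[c]>.
  rewrite -cent_joinEr; first by rewrite joing_idl joing_idr.
  by rewrite cent_cycle cycle_subG; apply/cent1P.
have sq x : x \in <<[set t; c]>> -> exists i j, x = t ^+ i * c ^+ j.
  rewrite genE => /mulsgP[_ _ /cycleP[i ->] /cycleP[j ->] ->].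
  by exists i, j.
have t2 : t ^+ 2 = 1 by rewrite expgS expg1 tperm2.
have c2 : c ^+ 2 = 1 by rewrite expgS expg1 tperm2.
have sq1 : {in <<[set t; c]>>, forall x, x ^+ 2 = 1}.
  move=> x /sq[i [j ->]]; rewrite expgMn; last exact: commuteX2.
  by rewrite -!expgM !(mulnC _ 2) !expgM t2 c2 !expg1n mulg1.
have ct_sub : <[c]> \subset 'C(<[t]>).
  by rewrite cent_cycle cycle_subG; apply/cent1P; apply: commute_sym.
have ab : abelian <<[set t; c]>>.
  by rewrite genE abelianM !cycle_abelian ct_sub.
have tn1 : t != 1.
  apply/eqP => /permP/(_ p0); rewrite tpermL perm1 => /eqP.
  by rewrite inord5_eq.
have cn1 : c != 1.
  apply/eqP => /permP/(_ p3); rewrite tpermL perm1 => /eqP.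
  by rewrite inord5_eq.
have ot : #|<[t]>| = 2 by apply: (nt_prime_order (p := 2)).
have oc : #|<[c]>| = 2 by apply: (nt_prime_order (p := 2)).
split=> //; rewrite genE TI_cardMg ?ot ?oc //.
apply: prime_TIg; first by rewrite ot.
rewrite cycle_subG /= (cycle2g oc) !inE negb_or tn1; apply/eqP.
move/permP/(_ p0); rewrite tpermL tpermD ?inord5_eq // => /eqP.
by rewrite inord5_eq.
Qed.

(** An element s outside the group generated by (3 4) commutes with (3 4), so
    it preserves the set of 3 and 4.  Replacing s by s (3 4) if necessary, it
    fixes both labels, and as a nontrivial involution of 0, 1, 2 it is a
    transposition. *)
Lemma klein_four (G : {group 'S_5}) : G \isog <<[set t; c]>> -> c \in G ->
  exists2 s, s \in G &
  [/\ s p3 = p3, s p4 = p4,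
      [\/ [/\ s p0 = p1, s p1 = p0 & s p2 = p2],
          [/\ s p0 = p2, s p2 = p0 & s p1 = p1]
        | [/\ s p1 = p2, s p2 = p1 & s p0 = p0]]
    & forall r, r \in G -> [\/ r = 1, r = c, r = s | r = s * c]].
Proof.
have [abB cardB sqB] := klein_model => isoG cG.
have cardG : #|G| = 4 by rewrite (card_isog isoG).
have abG : abelian G by rewrite (isog_abelian isoG).
have sqG : {in G, forall x, x ^+ 2 = 1}.
  have /isogP[f injf fG] := isoG => x xG.
  apply/eqP; rewrite -(morph_injm_eq1 injf) ?groupX // morphX //.
  by apply/eqP; apply: sqB; rewrite -fG mem_morphim.
have c2 : c * c = 1 by apply: tperm2.
have c3 : c p3 = p4 by apply: tpermL.
have c4 : c p4 = p3 by apply: tpermR.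
have cfix x : x \in [:: p0; p1; p2] -> c x = x.
  by rewrite !inE => /or3P[] /eqP ->; rewrite tpermD // inord5_eq.
have [s sG s1c] : exists2 s, s \in G & s \notin [set 1; c].
  have : ~~ (G \subset [set 1; c]).
    apply/negP => /subset_leq_card; rewrite cardG cards2.
    by case: (_ != _).
  by case/subsetPn => s sG sn; exists s.
have sc x : s (c x) = c (s x) by rewrite -!permM (centsP abG s sG c cG).
have s34 : s p3 = p3 \/ s p3 = p4.
  by case: (ord5P (s p3)) => [E|E|E|//]; have := sc p3;
    rewrite c3 E cfix ?inE ?eqxx ?orbT // -E => /perm_inj/eqP; rewrite
      inord5_eq.
wlog s3 : s sG s1c sc s34 / s p3 = p3.
  move=> W; case: (s34) => [s3|s3]; first exact: (W s sG s1c sc s34 s3).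
  apply: (W (s * c)); rewrite ?groupM ?permM ?s3 ?c4 //; try by left.
  - apply: contra s1c; rewrite !inE => /orP[/eqP E|/eqP E].
      by apply/orP; right; rewrite -(mulg1 s) -c2 mulgA E mul1g.
    by apply/orP; left; rewrite -(inj_eq (mulIg c)) E mul1g.
  - by move=> x; rewrite !permM sc.
have s4 : s p4 = p4 by rewrite -c3 sc s3.
have s2 : s * s = 1 by have := sqG s sG; rewrite expgS expg1.
have ss x : s (s x) = x by rewrite -permM s2 perm1.
exists s => //; split=> //; last first.
  have sn1 : s != 1 by apply: contra s1c => /eqP ->; rewrite !inE eqxx.
  have snc : s != c by apply: contra s1c => /eqP ->; rewrite !inE eqxx orbT.
  have cn1 : c != 1.
    apply/eqP => /permP/(_ p3); rewrite c3 perm1 => /eqP.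
    by rewrite inord5_eq.
  have scn1 : s * c != 1.
    by apply: contra snc => /eqP E; rewrite -(mulg1 s) -c2 mulgA E mul1g.
  have scnc : s * c != c by rewrite -[X in _ != X]mul1g (inj_eq (mulIg c)).
  have scns : s * c != s by rewrite -[X in _ != X]mulg1 (inj_eq (mulgI s)).
  have GE : [set 1; c; s; s * c] = G :> {set 'S_5}.
    apply/eqP; rewrite eqEcard !finset.subUset !finset.sub1set group1 cG sG
      groupM //= cardG.
    rewrite finset.setUC cardsU1 !inE !negb_or scn1 scnc scns finset.setUC
      cardsU1 !inE.
    by rewrite !negb_or sn1 snc cards2 eq_sym cn1.
  by move=> r; rewrite -GE !inE -!orbA => /or4P[] /eqP ->;
    [constructor 1 | constructor 2 | constructor 3 | constructor 4].
have sinj i j : (i < 5)%N -> (j < 5)%N -> i != j ->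
    s (inord i) <> s (inord j) :> 'I_5.
  by move=> i5 j5 ij /perm_inj/eqP; rewrite inord5_eq // (negPf ij).
have p2fix : s p0 = p1 -> s p2 = p2.
  move=> s0; have s1 : s p1 = p0 by rewrite -s0 ss.
  by case: (ord5P (s p2)) => [E|E|//|[E|E]];
    [case: (@sinj 2%N 1%N) | case: (@sinj 2%N 0%N) | case: (@sinj 2%N 3%N) | case: (@sinj 2%N 4%N)];
    rewrite // E.
have p1fix : s p0 = p2 -> s p1 = p1.
  move=> s0; have s2' : s p2 = p0 by rewrite -s0 ss.
  by case: (ord5P (s p1)) => [E|//|E|[E|E]];
    [case: (@sinj 1%N 2%N) | case: (@sinj 1%N 0%N) | case: (@sinj 1%N 3%N) | case: (@sinj 1%N 4%N)];
    rewrite // E.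
case: (ord5P (s p0)) => [s0|s0|s0|[s0|s0]].
- constructor 3; case: (ord5P (s p1)) => [E|s1|s1|[E|E]].
  + by case: (@sinj 1%N 0%N); rewrite // E.
  + case/negP: s1c; rewrite !inE; apply/orP; left; apply/eqP/permP => x.
    rewrite perm1; case: (ord5P x) => [->|->|->|[->|->]] //.
    by case: (ord5P (s p2)) => [E|E|//|[E|E]];
      [case: (@sinj 2%N 0%N) | case: (@sinj 2%N 1%N) | case: (@sinj 2%N 3%N) | case: (@sinj 2%N 4%N)];
      rewrite // E.
  + by split=> //; rewrite -s1 ss.
  + by case: (@sinj 1%N 3%N); rewrite // E.
  + by case: (@sinj 1%N 4%N); rewrite // E.
- by constructor 1; split=> //; [rewrite -s0 ss | exact: p2fix].
- by constructor 2; split=> //; [rewrite -s0 ss | exact: p1fix].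
- by case: (@sinj 0%N 3%N); rewrite // s0.
- by case: (@sinj 0%N 4%N); rewrite // s0.
Qed.

End KleinFour.

(** * Modular categories of rank five *)

Section SmatrixField.
Variables (K : numFieldType) (C : ribbonCat K) (n : nat) (X : 'I_n -> C).
Let F := smatrix_field X.

Lemma smatrix_field_divring : divring_closed [in F].
Proof.
split=> [|x y /set_mem Fx /set_mem Fy|x y /set_mem Fx /set_mem Fy];
  apply: mem_set => G [G_closed sG].
- by case: G_closed => /set_mem.
- have [_ GB _] := G_closed.
  by apply: set_mem (GB x y _ _); apply: mem_set; [apply: Fx | apply: Fy].
- have [_ _ GD] := G_closed.
  by apply: set_mem (GD x y _ _); apply: mem_set; [apply: Fx | apply: Fy].
Qed.

Lemma smatrix_in_field i j : F (smatrix X i j).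
Proof. by move=> G [_]; apply; exists i, j. Qed.

Lemma smatrix_field_min (G : set K) : divring_closed [in G] ->
  (forall i j, G (smatrix X i j)) -> (F `<=` G)%classic.
Proof. by move=> hG sG; apply: smallest_sub => // _ [i [j ->]]. Qed.

Lemma galois_aut_comp g h : galois_aut F g -> galois_aut F h ->
  galois_aut F (g \o h).
Proof.
move=> [bg gQ gD gM] [bh hQ hD hM].
have hF x : F x -> F (h x) by case: bh => + _ _; apply.
split=> [|q|x y Fx Fy|x y Fx Fy] /=.
- exact: set_bij_comp bh bg.
- by rewrite hQ gQ.
- by rewrite hD // gD //; apply: hF.
- by rewrite hM // gM //; apply: hF.
Qed.

(** [Gal] is defined as a set of permutations, whereas counting elements through
    an isomorphism needs a group. *)
Lemma Gal_group_set : group_set (Gal X).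
Proof.
apply/group_setP; split=> [|s t].
  rewrite !inE; exists id; last by move=> i j; rewrite perm1.
  by split=> //; split=> [x //|x y _ _ //|x Fx]; exists x.
rewrite !inE => -[g gg gs] [h hh ht].
exists (h \o g); first exact: galois_aut_comp.
by move=> i j /=; rewrite gs ht permM.
Qed.

End SmatrixField.

Section RankFiveCategory.
Variables (K : numClosedFieldType) (C : ribbonCat K) (X : 'I_5 -> C).
Hypotheses (modC : modular C) (repsX : simple_reps X).
Hypotheses (X0 : X (inord 0) ≅ tunit) (qdim_gt0 : forall i, 0 < qdim (X i)).
Hypotheses (X34 : dual (X (inord 3)) ≅ X (inord 4))
  (X11 : dual (X (inord 1)) ≅ X (inord 1))
  (X22 : dual (X (inord 2)) ≅ X (inord 2)).

(** [Gal] contains (3 4), realised by complex conjugation; [klein_four] then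
    leaves the transpositions (0 1), (0 2) and (1 2). *)
Lemma rank_five_impossible :
  (Gal X \isog <<[set tperm (inord 0 : 'I_5) (inord 1);
                      tperm (inord 3 : 'I_5) (inord 4)]>>)%g -> False.
Proof.
move=> isoG; have [ss s1 _ Sinv] := modC.
have [M [Mo Md Mdual MS]] := modular_datum_exists ss s1 repsX X0.
have d_gt0 i : 0 < md_dim M i by rewrite Md.
have S_unit : (\matrix_(i, j)
  (md_dim M (md_dual M i) * md_chi M (md_dual M i) j) : 'M[K]_5) \in unitmx.
  rewrite (_ : matrix_of_fun _ _ = smatrix X) ?Sinv //.
  by apply/matrixP => i j; rewrite mxE MS.
have dualE i k : dual (X i) ≅ X k -> md_dual M i = k.
  move=> ik; have [_ repsI _] := repsX; apply: repsI.
  exact: isomorphic_trans (isomorphic_sym (Mdual i)) ik.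
have dd3 := dualE _ _ X34; have dd1 := dualE _ _ X11; have dd2 := dualE _ _ X22.
have dd4 : md_dual M (inord 4) = inord 3 by rewrite -dd3 dualK.
have dd0 : md_dual M (inord 0) = inord 0 by rewrite -Mo dual_unit.
have psiE i j : psi X i j = md_chi M (md_dual M i) j.
  by rewrite /psi MS dim_dual // Md mulrAC divff ?mul1r // gt_eqF.
pose F := smatrix_field X.
have hF : divring_closed [in F] by apply: smatrix_field_divring.
have F_psi i j : F (md_chi M (md_dual M i) j).
  rewrite -psiE /psi -Md -(dim_dual d_gt0 S_unit) -[md_dim M _]mulr1.
  rewrite -(chi_unit S_unit (md_dual M i)) -MS.
  by apply: (field_div hF) => //; apply: smatrix_in_field.
have F_min (G : set K) : divring_closed [in G] ->
    (forall i j, G (md_chi M (md_dual M i) j)) -> (F `<=` G)%classic.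
  move=> hG psiG; apply: smatrix_field_min => // i j.
  rewrite MS; apply: (field_mul hG) => //.
  by rewrite -(psi_dim d_gt0 S_unit).
have galE g : galois_aut F g -> exists2 s, s \in Gal X &
    forall i j, g (md_chi M (md_dual M i) j) = md_chi M (md_dual M (s i)) j.
  move=> gg; have [_ gQ gD gM] := gg.
  have [s sP] := embedding_perm d_gt0 S_unit hF F_psi gQ gD gM.
  exists s => //; rewrite !inE; exists g => // i j.
  by rewrite !psiE sP.
pose G := Group (Gal_group_set X).
have cG : tperm (inord 3 : 'I_5) (inord 4) \in G.
  rewrite !inE; exists (@Num.conj_op K) => [|i j].
    apply: (embedding_galois d_gt0 S_unit hF F_psi F_min) =>
      [q|x y _ _|x y _ _].
    - exact: fmorph_rat.
    - exact: rmorphD.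
    - exact: rmorphM.
  rewrite !psiE conj_chi // -chi_dual //; congr (md_chi M (md_dual M _) j).
  case: (ord5P i) => [->|->|->|[->|->]]; rewrite ?dd0 ?dd1 ?dd2 ?dd3 ?dd4.
  - by rewrite tpermD // inord5_eq.
  - by rewrite tpermD // inord5_eq.
  - by rewrite tpermD // inord5_eq.
  - by rewrite tpermL.
  - by rewrite tpermR.
have [s sG [s3 s4 pat sE]] := klein_four (G := G) isoG cG.
have [g0 g0g g0P] : exists2 g, galois_aut F g & forall i j,
    g (md_chi M (md_dual M i) j) = md_chi M (md_dual M (s i)) j.
  move: sG; rewrite !inE => -[g gg gs]; exists g => // i j.
  by rewrite -!psiE gs.
have sum12 (f : 'I_5 -> K) : \sum_i f i = f (md_unit M) + f (inord 1)
    + f (inord 2) + f (inord 3) + f (inord 4) by rewrite Mo sum_ord5.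
have sum21 (f : 'I_5 -> K) : \sum_i f i = f (md_unit M) + f (inord 2)
    + f (inord 1) + f (inord 3) + f (inord 4).
  by rewrite sum12 -!addrA; congr (_ + _); rewrite addrCA.
have c3 : tperm (inord 3) (inord 4) (inord 3) = inord 4 :> 'I_5 by apply:
  tpermL.
have c4 : tperm (inord 3) (inord 4) (inord 4) = inord 3 :> 'I_5 by apply:
  tpermR.
have cfix i : (i < 3)%N -> tperm (inord 3) (inord 4) (inord i) = inord i :>
  'I_5.
  by move=> i3; rewrite tpermD // inord5_eq //; case: i i3 => [|[|[]]].
have csfix i : (i < 3)%N -> tperm (inord 3) (inord 4) (s (inord i)) = s
  (inord i).
  by case: pat => [] [E1 E2 E3]; case: i => [|[|[|//]]] _; rewrite ?E1 ?E2 ?E3 cfix.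
have galP g : galois_aut F g -> exists e f : bool,
    (forall i j, (i < 3)%N -> g (md_chi M (md_dual M (inord i)) j) =
       md_chi M (md_dual M (if e then s (inord i) else inord i)) j) /\
    (forall j, g (md_chi M (md_dual M (inord 3)) j) =
       md_chi M (md_dual M (if f then inord 4 else inord 3)) j /\
     g (md_chi M (md_dual M (inord 4)) j) =
       md_chi M (md_dual M (if f then inord 3 else inord 4)) j).
  move=> /galE[r rG gr].
  case: (sE r rG) => rE; [exists false, false|exists false, true
    |exists true, false|exists true, true]; split=> [i j i3|j];
    rewrite !gr rE ?permM ?perm1 ?s3 ?s4 ?c3 ?c4 ?cfix ?csfix //.
case: pat => [[s0 s1' s2]|[s0 s2 s1']|[s1' s2 s0]].
- apply: (swap_unit_case d_gt0 S_unit hF F_psi F_min dd1 dd2 dd3 sum12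
    _ _ _ _ _ _ g0g); rewrite ?Mo ?inord5_eq //;
    try by move=> j; rewrite g0P ?s0 ?s1' ?s2 ?s3 ?s4.
  move=> g /galP[e [f [gl gh]]]; split.
  + by move=> j; rewrite gl // s2 if_same.
  + by case: e gl => gl; [right|left] => j; rewrite !gl // ?s0 ?s1'.
  + by case: f gh => gh; [right|left]; exact: gh.
- apply: (swap_unit_case d_gt0 S_unit hF F_psi F_min dd2 dd1 dd3 sum21
    _ _ _ _ _ _ g0g); rewrite ?Mo ?inord5_eq //;
    try by move=> j; rewrite g0P ?s0 ?s1' ?s2 ?s3 ?s4.
  move=> g /galP[e [f [gl gh]]]; split.
  + by move=> j; rewrite gl // s1' if_same.
  + by case: e gl => gl; [right|left] => j; rewrite !gl // ?s0 ?s2.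
  + by case: f gh => gh; [right|left]; exact: gh.
- apply: (fix_unit_case d_gt0 S_unit hF F_psi F_min dd1 dd2 dd3 sum12 _ g0g);
    rewrite ?Mo ?inord5_eq //;
    try by move=> j; rewrite g0P ?s0 ?s1' ?s2 ?s3 ?s4.
  move=> g /galP[e [f [gl gh]]]; split.
  + by move=> j; rewrite gl // s0 if_same.
  + by case: e gl => gl; [right|left] => j; rewrite !gl // ?s1' ?s2.
  + by case: f gh => gh; [right|left] => j; rewrite (gh j).1.
Qed.

End RankFiveCategory.

Theorem theorem3p26 :
  forall (R : realType) (C : ribbonCat R[i]) (X : 'I_5 -> C),
    modular C ->
    simple_reps X ->
    X (inord 0) ≅ tunit ->
    (forall i, 0 < qdim (X i)) ->
    dual (X (inord 3)) ≅ X (inord 4) ->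
    dual (X (inord 1)) ≅ X (inord 1) ->
    dual (X (inord 2)) ≅ X (inord 2) ->
    (Gal X \isog <<[set tperm (inord 0 : 'I_5) (inord 1);
                        tperm (inord 3 : 'I_5) (inord 4)]>>)%g ->
    False.
Proof.
move=> R C X modC repsX X0 dim_pos X34 X11 X22.
exact: (rank_five_impossible modC repsX X0 dim_pos X34 X11 X22).
Qed.
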